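(* Let $\Omega=(-1,1)$ and let $u,u',\dots,u^{(k-1)}\in\mathrm{AC}([-1,1])$ with $k\in\mathbb N$, $k\ge1$. (i) Let $\mu\in(k-1,k)$ and $\theta\in(-1,1)$, and suppose ${}^{C}\!D_{\theta+}^{\mu}u\in\mathrm{BV}([\theta,1])$ and ${}^{C}\!D_{\theta-}^{\mu}u\in\mathrm{BV}([-1,\theta])$. Put $$U_\theta^{(\mu)}:=V_{[-1,\theta]}[{}^{C}\!D_{\theta-}^{\mu}u]+V_{[\theta,1]}[{}^{C}\!D_{\theta+}^{\mu}u]+|({}^{C}\!D_{\theta-}^{\mu}u)(\theta-)|+|({}^{C}\!D_{\theta+}^{\mu}u)(\theta+)|.$$ Then for every integer $N$ with $-1/2<\mu<N$, $$\|u-\pi_N^Lu\|_{L^2(\Omega)}\le\sqrt{\frac{2}{(2\mu+1)\pi}\,\frac{\Gamma(N-\mu)}{\Gamma(N+\mu+1)}}\;U_\theta^{(\mu)}.$$ (ii) If $u^{(k)}\in\mathrm{BV}([-1,1])$, then for every integer $N>k$ the same estimate holds with $\mu=k$ and with $U_\theta^{(\mu)}$ replaced by the total variation $V_{[-1,1]}[u^{(k)}]$.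
   Context: $P_n$ is the Legendre polynomial of degree $n$, $\hat u_n^L=\frac{2n+1}{2}\int_{-1}^1u(x)P_n(x)\,\mathrm dx$, and $\pi_N^Lu=\sum_{n=0}^N\hat u_n^LP_n$ is the $L^2(-1,1)$-orthogonal projection onto polynomials of degree at most $N$. $\mathrm{AC}$ and $\mathrm{BV}$ denote absolutely continuous functions and functions of bounded variation on the indicated closed interval; $V_{[c,d]}[h]$ is the total variation of $h$ on $[c,d]$; $h(c\pm)$ are one-sided limits. Fractional integrals: for $\rho>0$ and $f\in L^1(a,b)$, $(I_{a+}^\rho f)(x)=\frac1{\Gamma(\rho)}\int_a^x\frac{f(y)}{(x-y)^{1-\rho}}\,\mathrm dy$ and $(I_{b-}^\rho f)(x)=\frac1{\Gamma(\rho)}\int_x^b\frac{f(y)}{(y-x)^{1-\rho}}\,\mathrm dy$; $I^0$ is the identity. Caputo derivatives: for $\mu\in(k-1,k]$, $({}^{C}\!D_{a+}^{\mu}f)(x)=(I_{a+}^{k-\mu}f^{(k)})(x)$ and $({}^{C}\!D_{b-}^{\mu}f)(x)=(-1)^k(I_{b-}^{k-\mu}f^{(k)})(x)$. These (and $u^{(k)}$) are defined almost everywhere; saying that such a function is in BV means it agrees a.e. with a BV function, with which it is then identified. *)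

(* Defs.v *)
From HB Require Import structures.
From mathcomp Require Import all_boot all_order all_algebra.
From mathcomp Require Import all_classical all_reals all_analysis.

Set Implicit Arguments.
Unset Strict Implicit.
Unset Printing Implicit Defensive.

Import Order.TTheory GRing.Theory Num.Theory.
Import numFieldNormedType.Exports.

Local Open Scope classical_set_scope.
Local Open Scope ring_scope.

(* Euler's integral: this is the Gamma function for s > 0 only. *)
Definition Gamma {R : realType} (s : R) : R :=
  \int[lebesgue_measure]_(t in `]0, +oo[) (t `^ (s - 1) * expR (- t)).

(* Rodrigues' formula: P_n = (2^n n!)^-1 ((X^2 - 1)^n)^(n), so P_n(1) = 1. *)
Definition legendre {R : realType} (n : nat) : {poly R} :=
  (2 ^+ n * n`!%:R)^-1 *: derivn n (('X^2 - 1) ^+ n).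

Definition legendre_coef {R : realType} (u : R -> R) (n : nat) : R :=
  (2 * n%:R + 1) / 2 *
  \int[lebesgue_measure]_(x in `[-1, 1]) (u x * (legendre n).[x]).

Definition legendre_proj {R : realType} (N : nat) (u : R -> R) : {poly R} :=
  \sum_(n < N.+1) legendre_coef u n *: legendre n.

(* The norm of L^2(-1,1): the library's L^2 norm of f extended by 0. *)
Definition L2norm {R : realType} (f : R -> R) : \bar R :=
  Lnorm lebesgue_measure 2%:E (EFin \o (f \_ `]-1, 1[)).

Definition abs_continuous {R : realType} (a b : R) (f : R -> R) : Prop :=
  forall e : R, 0 < e -> exists2 d : R, 0 < d &
    forall (n : nat) (x y : 'I_n -> R),
      (forall i, a <= x i /\ x i <= y i /\ y i <= b) ->
      trivIset setT (fun i => `]x i, y i[%classic) ->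
      \sum_(i < n) (y i - x i) < d ->
      \sum_(i < n) `|f (y i) - f (x i)| < e.

(* f, f', ..., f^(k-1) are absolutely continuous on [a, b] (k >= 1).  For
   0 < j the classical derivative f^(j) is taken on ]a, b[ and is required to
   extend to an absolutely continuous function on [a, b]; the extension then
   gives the one-sided derivatives at a and b.  Nothing is assumed of f outside
   [a, b]. *)
Definition ac_derivs {R : realType} (a b : R) (k : nat) (f : R -> R) : Prop :=
  abs_continuous a b f /\
  forall j : nat, (0 < j < k)%N ->
    (forall x, a < x < b -> derivable (derive1n j.-1 f) x 1) /\
    exists2 g : R -> R, abs_continuous a b g &
      forall x, a < x < b -> g x = derive1n j f x.

Definition frac_int_left {R : realType} (a rho : R) (f : R -> R) (x : R) : R :=
  if rho == 0 then f x else
  (Gamma rho)^-1 *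
  \int[lebesgue_measure]_(y in `[a, x]) (f y / (x - y) `^ (1 - rho)).

Definition frac_int_right {R : realType} (b rho : R) (f : R -> R) (x : R) : R :=
  if rho == 0 then f x else
  (Gamma rho)^-1 *
  \int[lebesgue_measure]_(y in `[x, b]) (f y / (y - x) `^ (1 - rho)).

(* Caputo derivatives of order mu, where k - 1 < mu <= k.  At points where
   derive1n k f or the integral does not exist the value is meaningless; the
   functions are only used up to almost everywhere equality. *)
Definition caputo_left {R : realType} (a : R) (k : nat) (mu : R) (f : R -> R)
    : R -> R :=
  frac_int_left a (k%:R - mu) (derive1n k f).

Definition caputo_right {R : realType} (b : R) (k : nat) (mu : R) (f : R -> R)
    : R -> R :=
  fun x => (-1) ^+ k * frac_int_right b (k%:R - mu) (derive1n k f) x.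

(* v is a representative of bounded variation on [a, b] of the almost
   everywhere defined function f. *)
Definition bv_representative {R : realType} (a b : R) (f v : R -> R) : Prop :=
  bounded_variation a b v /\
  {ae lebesgue_measure, forall x : R, a <= x <= b -> v x = f x}.

(* U_theta, for representatives vl on [-1, theta] and vr on [theta, 1] of the
   right and left Caputo derivatives at theta. *)
Definition U_theta {R : realType} (theta : R) (vl vr : R -> R) : \bar R :=
  (total_variation (-1) theta vl + total_variation theta 1 vr
   + `|lim (vl @ theta^'-)|%:E + `|lim (vr @ theta^'+)|%:E)%E.

Definition legendre_const {R : realType} (mu : R) (N : nat) : R :=
  Num.sqrt (2 / ((2 * mu + 1) * pi) * (Gamma (N%:R - mu) / Gamma (N%:R + mu + 1))).

(* Main.v *)
(* Write E = pi_M u - pi_N u for M > N. By orthogonality ||E||^2 is the integral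
   of u E, hence, after k integrations by parts, that of u^(k) Psi, where Psi is
   the k-fold antiderivative of E (up to sign), which vanishes to order k at both
   ends of [-1, 1] because E is orthogonal to polynomials of degree <= N.
   When mu = k one more primitive H of Psi gives the bound V(u^(k)) sup|H|. When
   k - 1 < mu < k, on [theta, 1] the function Psi is the right Riemann-Liouville
   integral of order k - mu of Phi = I^mu_{1-} E (a Beta integral), so by Fubini
   the integral of u^(k) Psi over [theta, 1] is that of v Phi with v the Caputo
   derivative; since Phi is the derivative of H = I^(mu+1)_{1-} E up to sign, it
   is at most (|v(theta+)| + V(v)) sup|H|. Reflection handles [-1, theta].
   By Cauchy-Schwarz, sup|H| is controlled by ||E|| and by the sum over n > N of
   (2n+1)/2 (I^(mu+1)_{1-} P_n)^2. Sonin's function reduces a bound of each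
   term to the values at 0, which the reflection and duplication formulas and the
   log-convexity of Gamma bound by (2/pi) Gamma(n-mu-1) / Gamma(n+mu+1); the sum
   of these bounds telescopes to 2/((2mu+1)pi) Gamma(N-mu) / Gamma(N+mu+1).
   Finally M tends to infinity by the Weierstrass approximation theorem. *)
Require Import Defs.
From HB Require Import structures.
From mathcomp Require Import all_boot all_order all_algebra.
From mathcomp Require Import all_classical all_reals all_analysis.
From mathcomp Require Import measurable_realfun ring lra.

Set Implicit Arguments.
Unset Strict Implicit.
Unset Printing Implicit Defensive.

Import Order.TTheory GRing.Theory Num.Theory.
Import numFieldNormedType.Exports.

Local Open Scope classical_set_scope.
Local Open Scope ring_scope.

(** * Integration *)

(** [Gamma] is Euler's integral for positive arguments only, so its reflection, duplication and Beta
    formulas are derived here, for any [G] with the Bohr-Mollerup properties [G_gt0], [GS], [G1] and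
    [GD_le]. The sine enters through the integrals of cos(2sx) cos(x)^(2m). The polynomial E, unlike
    u - pi_N u, has fractional integrals that are finite sums of powers of 1 - t. The estimate
    obtained is ||E||^2 <= ||E|| C U, so one factor ||E|| cancels and leaves a bound independent of
    M. In (i) the limits at theta enter the bound because H need not vanish there; in (ii) H
    vanishes at both ends and only the variation remains. Absolute continuity is the epsilon-delta
    notion, so the almost everywhere existence of u^(k) and its integrability are proved: the
    variation of u^(k-1) yields Stieltjes measures, to which Radon-Nikodym applies. The resulting
    density then replaces u^(k). *)

Section ae_eq_integral_any.
Import HBNNSimple.
Context d (T : measurableType d) (R : realType).
Variable mu : {measure set T -> \bar R}.
Local Open Scope ereal_scope.

(** The integral of a nonnegative function is a supremum over the simple functions below it,
    measurable or not. Cutting such a simple function off on the null set [A] keeps its integral and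
    puts it below [g]. *)
Let ge0_le_integral_any (A : set T) (f g : T -> \bar R) :
  measurable A -> mu A = 0 -> (forall x, 0 <= f x) -> (forall x, 0 <= g x) ->
  (forall x, ~ A x -> f x <= g x) -> \int[mu]_x f x <= \int[mu]_x g x.
Proof.
move=> mA A0 f0 g0 fg; rewrite (ge0_integralE _ (fun x _ => f0 x)).
apply: ge_ereal_sup => _ [h /= hf <-]; rewrite patch_setT in hf.
have -> : sintegral mu h = \int[mu]_x (proj_nnsfun h (measurableC mA) x)%:E.
  transitivity (\int[mu]_x (h x)%:E).
    by rewrite integral_nnsfun// patch_setT.
  apply: ae_eq_integral => //.
  - exact/measurable_EFinP.
  - exact/measurable_EFinP.
  - exists A; split => // x /= xA; apply: contrapT => nAx; apply: xA => _.
    by rewrite mindicE mem_set// mulr1.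
rewrite integral_nnsfun// (ge0_integralE _ (fun x _ => g0 x)).
apply: ereal_sup_ubound; exists (proj_nnsfun h (measurableC mA)); last first.
  by rewrite patch_setT.
move=> x /=; rewrite patch_setT mindicE.
have [Ax|nAx] := pselect (A x).
  by rewrite memNset ?mulr0//; apply: contraPP Ax; rewrite notK.
by rewrite mem_set// mulr1 (le_trans (hf x))// fg.
Qed.

(* No measurability of [f] or [g] is required: a classical derivative is only
   known to agree almost everywhere with a measurable function. *)
Lemma ae_eq_integral_any (D : set T) (f g : T -> \bar R) :
  {ae mu, forall x, D x -> f x = g x} ->
  \int[mu]_(x in D) f x = \int[mu]_(x in D) g x.
Proof.
move=> [A [mA A0 fgA]].
have fg x : ~ A x -> (f \_ D) x = (g \_ D) x.
  move=> nAx; rewrite !patchE; case: ifPn => // /set_mem Dx.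
  by apply: contrapT => nfg; apply: nAx; apply: fgA => /= /(_ Dx).
rewrite integralE [RHS]integralE !(integral_mkcond D).
by congr (_ - _); rewrite -?funepos_restrict -?funeneg_restrict;
  apply/eqP; rewrite eq_le; apply/andP; split; apply: (ge0_le_integral_any mA A0);
  move=> x; rewrite ?funepos_ge0 ?funeneg_ge0// => /fg fgx;
  rewrite ?funeposE ?funenegE fgx.
Qed.

End ae_eq_integral_any.

Lemma ae_eq_Rintegral_any d (T : measurableType d) (R : realType)
    (mu : {measure set T -> \bar R}) (D : set T) (f g : T -> R) :
  {ae mu, forall x, D x -> f x = g x} ->
  \int[mu]_(x in D) f x = \int[mu]_(x in D) g x.
Proof.
move=> fg; congr fine; apply: ae_eq_integral_any.
by apply: filterS fg => x fgx Dx; rewrite fgx.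
Qed.

Section FTC2_exhaustion.
Context {R : realType}.
Notation mu := (@lebesgue_measure R).
Variables (f1 f2 F : R -> R) (a b : nat -> R) (c l : R).
Hypothesis ab : forall n, a n < b n.
Hypothesis a_ni : forall n, a n.+1 <= a n.
Hypothesis b_nd : forall n, b n <= b n.+1.
Let I := \bigcup_n `[a n, b n]%classic.
Hypothesis f10 : forall x, I x -> 0 <= f1 x.
Hypothesis f20 : forall x, I x -> 0 <= f2 x.
Hypothesis cf1 : forall x, I x -> {for x, continuous f1}.
Hypothesis cf2 : forall x, I x -> {for x, continuous f2}.
Hypothesis dF : forall x, I x -> is_derive x 1 F (f1 x - f2 x).
Hypothesis Fa : F (a n) @[n --> \oo] --> c.
Hypothesis Fb : F (b n) @[n --> \oo] --> l.

(* The fundamental theorem of calculus for a primitive whose derivative may be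
   singular at both ends. *)
Lemma ge0_FTC2_exhaustion :
  (\int[mu]_(x in I) (f1 x)%:E + c%:E = \int[mu]_(x in I) (f2 x)%:E + l%:E)%E.
Proof.
have sub n x : x \in `[a n, b n] -> I x by move=> xab; exists n.
have nd : nondecreasing_seq (fun n => `[a n, b n]%classic).
  apply/nondecreasing_seqP => n; rewrite subsetEset => x /=.
  rewrite !in_itv/= => /andP[ax xb].
  by rewrite (le_trans (a_ni n) ax) (le_trans xb (b_nd n)).
have cfw (h : R -> R) n : (forall x, I x -> {for x, continuous h}) ->
    {within `[a n, b n], continuous h}.
  move=> ch; apply: continuous_in_subspaceT => x.
  by rewrite inE/= => xab; apply: ch; exact: sub xab.
have mfE (h : R -> R) : (forall x, I x -> {for x, continuous h}) ->
    forall n, measurable_fun `[a n, b n]%classic (EFin \o h).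
  move=> ch n; apply/measurable_EFinP.
  by apply: subspace_continuous_measurable_fun => //; exact: cfw.
have cv (h : R -> R) : (forall x, I x -> {for x, continuous h}) ->
    (forall x, I x -> 0 <= h x) ->
    (\int[mu]_(x in `[a n, b n]) (h x)%:E @[n --> \oo] -->
      \int[mu]_(x in I) (h x)%:E)%E.
  move=> ch h0; apply: ge0_nondecreasing_set_cvg_integral => //.
  - exact: mfE.
  - by move=> n x xab; rewrite lee_fin h0//; exists n.
have eqn n : (\int[mu]_(x in `[a n, b n]) (f1 x)%:E + (F (a n))%:E =
    \int[mu]_(x in `[a n, b n]) (f2 x)%:E + (F (b n))%:E)%E.
  have if_ (h : R -> R) : (forall x, I x -> {for x, continuous h}) ->
      mu.-integrable `[a n, b n] (EFin \o h).
    by move=> ch; apply: continuous_compact_integrable => //;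
      [exact: segment_compact | exact: cfw].
  have := @continuous_FTC2 R (f1 \- f2) F (a n) (b n) (ab n).
  have -> : (\int[mu]_(x in `[a n, b n]) ((f1 \- f2) x)%:E =
     \int[mu]_(x in `[a n, b n]) (f1 x)%:E -
     \int[mu]_(x in `[a n, b n]) (f2 x)%:E)%E.
    by rewrite -integralB_EFin//; exact: if_.
  have fin1 : (\int[mu]_(x in `[a n, b n]) (f1 x)%:E)%E \is a fin_num.
    by apply: integrable_fin_num => //; exact: if_.
  have fin2 : (\int[mu]_(x in `[a n, b n]) (f2 x)%:E)%E \is a fin_num.
    by apply: integrable_fin_num => //; exact: if_.
  rewrite -(fineK fin1) -(fineK fin2) -!EFinB -!EFinD => H.
  congr EFin; suff: fine (\int[mu]_(x in `[a n, b n]) (f1 x)%:E) -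
    fine (\int[mu]_(x in `[a n, b n]) (f2 x)%:E) = F (b n) - F (a n) by lra.
  apply: EFin_inj; apply: H.
  - by apply: cfw => x Ix; apply: cvgB; [exact: cf1|exact: cf2].
  - have cF x : I x -> {for x, continuous F}.
      by move=> /dF[dx _]; exact/differentiable_continuous/derivable1_diffP.
    split.
    + by move=> x /subset_itv_oo_cc /sub /dF[].
    + apply: cvg_at_right_filter; apply: cF; apply: (sub n).
      by rewrite in_itv/= lexx ltW.
    + apply: cvg_at_left_filter; apply: cF; apply: (sub n).
      by rewrite in_itv/= lexx ltW.
  - by move=> x /subset_itv_oo_cc /sub /dF h; rewrite derive1E derive_val.
have h1 : ((\int[mu]_(x in `[a n, b n]) (f1 x)%:E + (F (a n))%:E)%E @[n --> \oo] -->
    (\int[mu]_(x in I) (f1 x)%:E + c%:E)%E).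
  by apply: cvgeD; [exact: fin_num_adde_defl | exact: cv | apply: cvg_comp; [eassumption | exact: cvg_id]].
have h2 : ((\int[mu]_(x in `[a n, b n]) (f1 x)%:E + (F (a n))%:E)%E @[n --> \oo] -->
    (\int[mu]_(x in I) (f2 x)%:E + l%:E)%E).
  under eq_fun do rewrite eqn.
  by apply: cvgeD; [exact: fin_num_adde_defl | exact: cv | apply: cvg_comp; [eassumption | exact: cvg_id]].
exact: (cvg_unique _ h1 h2).
Qed.

End FTC2_exhaustion.

Section calculus.
Context {R : realType}.
Notation mu := (@lebesgue_measure R).
Implicit Types (a b : R) (f g F df : R -> R).

Lemma is_derive_ge0_le f df a b : a <= b ->
  (forall x, a <= x <= b -> is_derive x 1 f (df x)) ->
  (forall x, a <= x <= b -> 0 <= df x) -> f a <= f b.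
Proof.
rewrite le_eqVlt => /predU1P[->//|ab] dfx df0.
have [x|x|c] := @MVT R f df a b ab.
- by rewrite in_itv/= => /andP[ax xb]; apply: dfx; rewrite !ltW.
- move=> xab; apply: continuous_in_subspaceT xab => {}x; rewrite inE/= in_itv/= => xab.
  by have [d _] := dfx _ xab; apply: differentiable_continuous; exact/derivable1_diffP.
rewrite in_itv/= => /andP[ac cb] fE; rewrite -subr_ge0 fE mulr_ge0//.
  by rewrite df0 ?(ltW ac) ?(ltW cb).
by rewrite subr_ge0 ltW.
Qed.

Lemma is_derive_continuous f (x d : R) : is_derive x 1 f d -> {for x, continuous f}.
Proof. by move=> [df _]; exact/differentiable_continuous/derivable1_diffP. Qed.

Lemma powRD_gt0 (x r s : R) : 0 < x -> x `^ (r + s) = x `^ r * x `^ s.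
Proof. by move=> x0; rewrite powRD//; apply/implyP => _; rewrite gt_eqF. Qed.

Lemma powRB_gt0 (x r s : R) : 0 < x -> x `^ (r - s) = x `^ r / x `^ s.
Proof. by move=> x0; rewrite powRB//; apply/implyP => _; rewrite gt_eqF. Qed.

Lemma within_continuous_bounded a b f : a <= b -> {within `[a, b], continuous f} ->
  exists K, forall x, a <= x <= b -> `|f x| <= K.
Proof.
move=> ab fc; have [c _ cM] := EVT_max ab fc; have [d _ dM] := EVT_min ab fc.
exists (`|f c| + `|f d|) => x xab.
have /cM h1 : x \in `[a, b] by rewrite in_itv.
have /dM h2 : x \in `[a, b] by rewrite in_itv.
have := ler_norm (f c); have := ler_norm (- f d); rewrite normrN => h3 h4.
have := normr_ge0 (f c); have := normr_ge0 (f d); rewrite ler_norml; lra.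
Qed.

Lemma within_continuous_integrable f a b :
  {within `[a, b], continuous f} -> mu.-integrable `[a, b] (EFin \o f).
Proof. by apply: continuous_compact_integrable; exact: segment_compact. Qed.

Lemma for_continuous_within f a b :
  (forall x, a <= x <= b -> {for x, continuous f}) -> {within `[a, b], continuous f}.
Proof.
by move=> cf; apply: continuous_in_subspaceT => x; rewrite inE/= in_itv/=; exact: cf.
Qed.

Lemma Rintegral_FTC2 f F a b : a < b ->
  (forall x, a <= x <= b -> is_derive x 1 F (f x)) ->
  (forall x, a <= x <= b -> {for x, continuous f}) ->
  \int[mu]_(x in `[a, b]) f x = F b - F a.
Proof.
move=> ab dF cf; apply: EFin_inj; rewrite EFinB -(continuous_FTC2 (f := f) ab).
- rewrite fineK//; apply: integrable_fin_num => //.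
  exact/within_continuous_integrable/for_continuous_within.
- exact: for_continuous_within.
- have cF x : a <= x <= b -> {for x, continuous F}.
    by move=> /dF[d _]; exact/differentiable_continuous/derivable1_diffP.
  split.
  + by move=> x /subset_itv_oo_cc; rewrite in_itv/= => /dF[].
  + by apply: cvg_at_right_filter; apply: cF; rewrite lexx ltW.
  + by apply: cvg_at_left_filter; apply: cF; rewrite lexx ltW.
- move=> x /subset_itv_oo_cc; rewrite in_itv/= => /dF dFx.
  by rewrite derive1E derive_val.
Qed.

Lemma integrableB_EFin d (T : measurableType d) (nu : {measure set T -> \bar R})
    (D : set T) (f g : T -> R) : measurable D ->
  nu.-integrable D (EFin \o f) -> nu.-integrable D (EFin \o g) ->
  nu.-integrable D (EFin \o (fun x => f x - g x)).
Proof. by move=> mD; exact: integrableB. Qed.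

Lemma integrableZl_EFin d (T : measurableType d) (nu : {measure set T -> \bar R})
    (D : set T) (k : R) (f : T -> R) : measurable D ->
  nu.-integrable D (EFin \o f) -> nu.-integrable D (EFin \o (fun x => k * f x)).
Proof. by move=> mD; exact: integrableZl. Qed.

Lemma integrable_sum_EFin d (T : measurableType d) (nu : {measure set T -> \bar R})
    (D : set T) (n : nat) (f : 'I_n -> T -> R) : measurable D ->
  (forall i, nu.-integrable D (EFin \o f i)) ->
  nu.-integrable D (EFin \o (fun x => \sum_(i < n) f i x)).
Proof.
move=> mD fi.
rewrite (_ : _ \o _ = fun x => (\sum_(i < n) (f i x)%:E)%E); last first.
  by apply/funext => x /=; rewrite sumEFin.
by apply: integrable_sum => // i _; exact: fi.
Qed.

Lemma Rintegral_sum d (T : measurableType d) (nu : {measure set T -> \bar R})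
    (D : set T) (n : nat) (f : 'I_n -> T -> R) : measurable D ->
  (forall i, nu.-integrable D (EFin \o f i)) ->
  \int[nu]_(x in D) (\sum_(i < n) f i x) = \sum_(i < n) \int[nu]_(x in D) f i x.
Proof.
move=> mD; elim: n f => [|n IH] f fi.
  under eq_Rintegral => x _ do rewrite big_ord0.
  by rewrite big_ord0 Rintegral_cst// mul0r.
under eq_Rintegral => x _ do rewrite big_ord_recl.
rewrite RintegralD//; last exact: integrable_sum_EFin.
by rewrite IH// big_ord_recl.
Qed.

End calculus.

(** * The Gamma function *)

Section Gamma_function.
Context {R : realType}.
Notation mu := (@lebesgue_measure R).
Implicit Types s x : R.

Let gfun s (t : R) : R := t `^ (s - 1) * expR (- t).

Let itv0y : `]0%R, +oo[%classic =
  \bigcup_n `[n.+1%:R^-1, n.+2%:R]%classic :> set R.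
Proof.
apply/seteqP; split=> [x/=|x [n _]/=]; rewrite !in_itv/= ?andbT.
  move=> x0; exists (maxn (Num.truncn x) (Num.truncn x^-1)) => //=.
  rewrite in_itv/=; apply/andP; split.
    rewrite invf_ple ?posrE// (le_trans (ltW (truncnS_gt _)))//.
    by rewrite ler_nat ltnS leq_maxr.
  rewrite (le_trans (ltW (truncnS_gt _)))// ler_nat ltnS ltnW// ltnS.
  by rewrite leq_maxl.
by move=> /andP[+ _]; apply: lt_le_trans; rewrite invr_gt0.
Qed.

Let gfun_ge0 s t : 0 <= gfun s t.
Proof. by rewrite mulr_ge0 ?powR_ge0 ?expR_ge0. Qed.

Let gfun_continuous s (t : R) : 0 < t -> {for t, continuous (gfun s)}.
Proof.
move=> t0.
have c : {for t, continuous (@powR R ^~ (s - 1))}.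
  have [d _] := @is_derive1_powR R (s - 1) t t0.
  exact/differentiable_continuous/derivable1_diffP.
apply: cvgM; first exact: c.
apply: (@continuous_comp _ _ _ (@GRing.opp R) expR); first exact: opp_continuous.
exact: continuous_expR.
Qed.

Let mgfun s : measurable_fun (`]0%R, +oo[%classic : set R) (gfun s).
Proof.
apply: subspace_continuous_measurable_fun => //.
apply: continuous_in_subspaceT => x; rewrite inE/= in_itv/= andbT.
exact: gfun_continuous.
Qed.

Let mEgfun s : measurable_fun (`]0%R, +oo[%classic : set R) (EFin \o gfun s).
Proof. apply/measurable_EFinP. exact: mgfun. Qed.

Let EGamma s := (\int[mu]_(t in `]0%R, +oo[) (gfun s t)%:E)%E.

Let EGamma_ge0 s : (0 <= EGamma s)%E.
Proof. by apply: integral_ge0 => t _; rewrite lee_fin. Qed.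

Lemma powR_expRN_cvg0 s : n.+2%:R `^ s * expR (- n.+2%:R) @[n --> \oo] --> (0 : R).
Proof.
(* With m >= s + 1, the bound exp(x) >= x^m / m! gives x^s exp(-x) <= m! / x. *)
set m := `|Num.ceil s|%N.+1.
have sm : s + 1 <= m%:R.
  rewrite /m -natr1 lerD2r.
  apply: (le_trans (ceil_ge s)); rewrite pmulrn ler_int.
  by rewrite abszE ler_norm.
apply: (@squeeze_cvgr _ _ _ _ (cst 0) (fun n => m`!%:R * n.+1%:R^-1)).
- near=> n; rewrite mulr_ge0 ?powR_ge0 ?expR_ge0//=.
  have n0 : 0 < n.+2%:R :> R by [].
  have h : n.+2%:R `^ m%:R / m`!%:R <= expR n.+2%:R :> R.
    have := @expR_ge1Dxn R n.+2%:R m.-1 (ltW n0); rewrite prednK//.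
    by rewrite powR_mulrn//; lra.
  rewrite expRN ler_pdivrMr ?expR_gt0//.
  apply: (@le_trans _ _ (n.+2%:R `^ (m%:R - 1))).
    by rewrite ler_powR ?ler1n// lerBrDr.
  rewrite (@le_trans _ _ (m`!%:R / n.+2%:R * (n.+2%:R `^ m%:R / m`!%:R)))//.
    rewrite powRB ?pnatr_eq0 ?implybT// powRr1 ?(ltW n0)//.
    have m0 : m`!%:R != 0 :> R by rewrite pnatr_eq0 -lt0n fact_gt0.
    by rewrite [leRHS]mulrC mulrA divfK.
  apply: ler_pM => //; rewrite ?divr_ge0 ?powR_ge0//.
  by rewrite ler_wpM2l// lef_pV2 ?posrE// ler_nat.
- exact: cvg_cst.
- rewrite -(mulr0 m`!%:R); apply: cvgMr; exact: cvg_harmonic.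
Unshelve. all: by end_near. Qed.

Let powR_cvg0_harmonic s : 0 < s -> n.+1%:R^-1 `^ s @[n --> \oo] --> (0 : R).
Proof.
move=> s0.
apply: (@cvg_comp _ _ _ (fun n => n.+1%:R^-1 : R) (@powR R ^~ s) \oo (0^'+));
  last exact: powR_cvg0.
move=> A /= [e e0 he]; have := @cvg_harmonic R.
move=> /cvgrPdist_lt /(_ e e0); apply: filterS => n /= hn.
by apply: he => //=; rewrite invr_gt0.
Qed.

(** Integration by parts with primitive t^s exp(-t). The identity lives in the extended reals
    because the finiteness of the integral is deduced from it afterwards. *)
Let EGammaS s : 0 < s -> EGamma (s + 1) = (s%:E * EGamma s)%E.
Proof.
move=> s0.
have <- : (\int[mu]_(t in `]0%R, +oo[) (s * gfun s t)%:E = s%:E * EGamma s)%E.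
  rewrite -ge0_integralZl ?lee_fin//; last exact: ltW.
  - exact: mEgfun.
  - by move=> t _; rewrite lee_fin.
have := @ge0_FTC2_exhaustion R (fun t => s * gfun s t) (gfun (s + 1))
  (fun t => t `^ s * expR (- t)) (fun n => n.+1%:R^-1) (fun n => n.+2%:R) 0 0.
rewrite -itv0y !adde0 => H; apply/esym/H => //.
- by move=> n; apply: (@le_lt_trans _ _ 1); rewrite ?invf_le1 ?ler1n ?ltr1n.
- by move=> n; rewrite lef_pV2 ?posrE// ler_nat.
- by move=> n; rewrite ler_nat.
- by move=> x _; apply: mulr_ge0; [exact: ltW|exact: gfun_ge0].
- by move=> x/=; rewrite in_itv/= andbT => x0; apply: cvgMr; exact: (gfun_continuous (s := s)).
- by move=> x/=; rewrite in_itv/= andbT => x0; exact: gfun_continuous.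
- move=> x/=; rewrite in_itv/= andbT => x0.
  have dp := is_derive1_powR s x0.
  apply: is_derive_eq; rewrite /gfun addrK.
  by rewrite -![_ *: _]/(_ * _); ring.
- apply: (@squeeze_cvgr _ _ _ _ (cst 0) (fun n => n.+1%:R^-1 `^ s)).
  + near=> n; rewrite mulr_ge0 ?powR_ge0 ?expR_ge0//=.
    by apply: ler_piMr; rewrite ?powR_ge0// expR_le1 oppr_le0.
  + exact: cvg_cst.
  + exact: powR_cvg0_harmonic.
- exact: powR_expRN_cvg0.
Unshelve. all: by end_near. Qed.

Let EGamma1 : EGamma 1 = 1%E.
Proof.
have := @ge0_FTC2_exhaustion R (gfun 1) (cst 0)
  (fun t => - expR (- t)) (fun n => n.+1%:R^-1) (fun n => n.+2%:R) (- 1) 0.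
rewrite -itv0y integral0 => H.
suff : (EGamma 1 + (- 1)%:E = 0%E + 0%:E)%E.
  move: (EGamma 1) => [r| |]//=; rewrite adde0 -EFinD => -[] /eqP.
  by rewrite subr_eq0 => /eqP ->.
apply: H => //.
- by move=> n; apply: (@le_lt_trans _ _ 1); rewrite ?invf_le1 ?ler1n ?ltr1n.
- by move=> n; rewrite lef_pV2 ?posrE// ler_nat.
- by move=> n; rewrite ler_nat.
- by move=> x/=; rewrite in_itv/= andbT => x0; exact: gfun_continuous.
- by move=> x _; exact: cvg_cst.
- move=> x _; apply: is_derive_eq; rewrite /gfun subrr powRr0.
  by rewrite /cst/=; ring.
- apply: cvgN; rewrite -[X in _ --> X]expR0 -oppr0.
  apply: (@cvg_comp _ _ _ _ expR _ (nbhs (- 0 : R))); last exact: continuous_expR.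
  by apply: cvgN; exact: cvg_harmonic.
- rewrite -oppr0; apply: cvgN; have := powR_expRN_cvg0 0.
  by under eq_fun do rewrite powRr0 mul1r.
Qed.

Let EGamma_nat n : EGamma n.+1%:R = n`!%:R%:E.
Proof.
elim: n => [|n IH]; first by rewrite EGamma1 fact0.
by rewrite -[n.+2%:R]natr1 EGammaS// IH -EFinM -natrM factS.
Qed.

(** Passing to s + 1 removes the singularity at 0; there t^s is at most 1 + t^(m+1), and the two
    resulting integrals are factorials. *)
Let EGamma_fin s : 0 < s -> (EGamma s < +oo)%E.
Proof.
move=> s0; suff : (EGamma (s + 1) < +oo)%E.
  rewrite EGammaS//; have := EGamma_ge0 s.
  case: (EGamma s) => [r _ _| _ |]; [exact: ltry | |by rewrite leeNy_eq].
  by rewrite gt0_muley ?lte_fin.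
set m := Num.truncn s; apply: (@le_lt_trans _ _ (EGamma 1 + EGamma m.+2%:R)%E).
  rewrite /EGamma -ge0_integralD//; last first.
  - exact: mEgfun.
  - by move=> t _; rewrite lee_fin.
  - exact: mEgfun.
  - by move=> t _; rewrite lee_fin.
  apply: ge0_le_integral => //.
  - by move=> t _; rewrite lee_fin.
  - exact: mEgfun.
  - by apply: emeasurable_funD; exact: mEgfun.
  move=> t/=; rewrite in_itv/= andbT => t0; rewrite lee_fin /gfun -mulrDl.
  rewrite ler_wpM2r ?expR_ge0// addrK subrr powRr0 -natr1 addrK.
  have [t1|/ltW t1] := leP t 1.
    rewrite ler_wpDr ?powR_ge0// -(powRr0 t) ger_powR// ?t0//.
    exact: ltW.
  by rewrite ler_wpDl// ler_powR// ltW// truncnS_gt.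
by rewrite EGamma1 EGamma_nat ltry.
Qed.

Let gfun_integrable s : 0 < s -> mu.-integrable `]0%R, +oo[ (EFin \o gfun s).
Proof.
move=> s0; apply/integrableP; split; first exact: mEgfun.
under eq_integral => t _ do rewrite /= ger0_norm//.
exact: EGamma_fin.
Qed.

Let Gamma_fineE s : Gamma s = fine (EGamma s). Proof. by []. Qed.

Lemma GammaS s : 0 < s -> Gamma (s + 1) = s * Gamma s.
Proof.
move=> s0; rewrite !Gamma_fineE EGammaS// fineM// ge0_fin_numE//.
exact: EGamma_fin.
Qed.

Lemma Gamma_nat n : Gamma n.+1%:R = n`!%:R :> R.
Proof. by rewrite Gamma_fineE EGamma_nat. Qed.

Lemma Gamma1 : Gamma 1 = 1 :> R. Proof. by rewrite (Gamma_nat 0). Qed.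

(** Young's inequality for y^s and 1, with exponents 1/s and 1/(1-s). *)
Let powR_le_tangent (y s : R) : 0 <= y -> 0 <= s <= 1 -> y `^ s <= 1 - s + s * y.
Proof.
move=> y0 /andP[]; rewrite le_eqVlt => /predU1P[<- _|s0].
  by rewrite powRr0 mul0r; lra.
rewrite le_eqVlt => /predU1P[->|s1]; first by rewrite powRr1//; lra.
have q0 : 0 < 1 - s by lra.
have := @conjugate_powR R (y `^ s) 1 s^-1 (1 - s)^-1 (powR_ge0 _ _) ler01.
rewrite !invr_gt0 !invrK s0 q0 addrCA subrr addr0 mulr1 powR1 mul1r.
rewrite -powRrM mulfV ?gt_eqF// powRr1// => /(_ isT isT erefl) h.
by rewrite (le_trans h)// addrC mulrC.
Qed.

(* Weighted AM-GM under the integral sign; this is the only form of the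
   log-convexity of Gamma that is needed. *)
Lemma GammaD_le x s : 0 < x -> 0 <= s <= 1 -> Gamma (x + s) <= x `^ s * Gamma x.
Proof.
move=> x0 /andP[s0 s1].
have -> : x `^ s * Gamma x = x `^ s * (1 - s) * Gamma x + x `^ s * (s / x) * Gamma (x + 1).
  by rewrite GammaS//; field; rewrite gt_eqF.
rewrite /Gamma -/(gfun (x + s)) -!RintegralZl//=; last first.
- exact: gfun_integrable.
- by apply: gfun_integrable; lra.
have i1 : mu.-integrable `]0, +oo[
    (EFin \o (fun t => x `^ s * (1 - s) * (t `^ (x - 1) * expR (- t)))).
  by apply: (integrableZl _ (x `^ s * (1 - s)) (gfun_integrable x0)).
have i2 : mu.-integrable `]0, +oo[
    (EFin \o (fun t => x `^ s * (s / x) * (t `^ (x + 1 - 1) * expR (- t)))).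
  have x1 : 0 < x + 1 by lra.
  by apply: (integrableZl _ (x `^ s * (s / x)) (gfun_integrable x1)).
rewrite -RintegralD//=.
apply: le_Rintegral => //.
- by apply: (gfun_integrable (s := x + s)); lra.
- exact: (integrableD _ i1 i2).
move=> t/=; rewrite in_itv/= andbT => t0.
rewrite !mulrA -mulrDl ler_wpM2r ?expR_ge0//.
have -> : t `^ (x + s - 1) = x `^ s * (t / x) `^ s * t `^ (x - 1).
  rewrite -powRM ?divr_ge0 ?ltW// mulrCA divff ?gt_eqF// mulr1 -powRD.
    by congr (_ `^ _); ring.
  by apply/implyP => _; rewrite gt_eqF.
have -> : t `^ (x + 1 - 1) = t * t `^ (x - 1) by rewrite mulr_powRB1 ?addrK// ltW.
rewrite [leRHS](_ : _ = x `^ s * (1 - s + s * (t / x)) * t `^ (x - 1)); last first.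
  by field; rewrite gt_eqF.
rewrite ler_wpM2r ?powR_ge0// ler_wpM2l ?powR_ge0//.
by rewrite powR_le_tangent ?s0// divr_ge0// ltW.
Qed.

(** The inequality [GammaD_le], taken from s up to the next integer, bounds a positive factorial by
    a multiple of Gamma(s). *)
Lemma Gamma_gt0 s : 0 < s -> 0 < Gamma s.
Proof.
move=> s0; set m := Num.truncn s.
have /andP[ms sm] : m%:R <= s < m.+1%:R by apply: truncn_itv; exact: ltW.
have h : m`!%:R <= s `^ (m.+1%:R - s) * Gamma s.
  have e : s + (m.+1%:R - s) = m.+1%:R by ring.
  rewrite -Gamma_nat -{1}e; apply: GammaD_le => //.
  by rewrite -natr1 in sm *; lra.
have : 0 < s `^ (m.+1%:R - s) * Gamma s.
  by apply: lt_le_trans h; rewrite ltr0n fact_gt0.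
by rewrite pmulr_rgt0// powR_gt0.
Qed.

Lemma GammaDhalf_le x : 0 < x -> Gamma (x + 2^-1) ^+ 2 <= x * Gamma x ^+ 2.
Proof.
move=> x0; have G0 := Gamma_gt0 x0.
have : Gamma (x + 2^-1) <= Num.sqrt x * Gamma x.
  by rewrite -powR12_sqrt ?(ltW x0)//; apply: GammaD_le => //; lra.
have Gh : 0 < Gamma (x + 2^-1) by apply: Gamma_gt0; lra.
rewrite -ler_sqr ?nnegrE ?mulr_ge0 ?sqrtr_ge0 ?(ltW G0) ?(ltW Gh)//.
by rewrite exprMn sqr_sqrtr// (ltW x0).
Qed.

End Gamma_function.

(** * Duplication formula and quotient limits from the Bohr-Mollerup properties *)

Section Gamma_like.
Context {R : realType}.
Implicit Types s z : R.

(* By Bohr-Mollerup these hypotheses characterize Gamma. *)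
Variable G : R -> R.
Hypothesis G_gt0 : forall s, 0 < s -> 0 < G s.
Hypothesis GS : forall s, 0 < s -> G (s + 1) = s * G s.
Hypothesis G1 : G 1 = 1.
Hypothesis GD_le : forall x s, 0 < x -> 0 <= s <= 1 -> G (x + s) <= x `^ s * G x.

(** Gamma(m+1+s) divided by its asymptotic value m! (m+1)^s. *)
Let rho s m : R := G (m.+1%:R + s) / (G m.+1%:R * m.+1%:R `^ s).

Let G_neq0 z : 0 < z -> G z != 0.
Proof. by move=> /G_gt0 /lt0r_neq0. Qed.

Let rhoE s m : 0 <= s -> G (m.+1%:R + s) = rho s m * G m.+1%:R * m.+1%:R `^ s.
Proof.
move=> s0; rewrite /rho -mulrA divfK// mulf_neq0 ?G_neq0//.
Qed.

Let invS_cvg0 s : s / m.+1%:R @[m --> \oo] --> (0 : R).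
Proof. by rewrite -(mulr0 s); apply: cvgMr; exact: cvg_harmonic. Qed.

Let rhoS s m : 0 <= s -> rho (s + 1) m = rho s m * (1 + s / m.+1%:R).
Proof.
move=> s0; have m0 : 0 < m.+1%:R :> R by [].
rewrite /rho addrA GS ?ltr_wpDr// powRD_gt0//.
rewrite powRr1 ?(ltW m0)//; field.
by rewrite !gt_eqF ?powR_gt0 ?G_gt0.
Qed.

(** For 0 <= t <= 1 and x = m + 1, convexity at x + t gives [rho] <= 1, and convexity at x + 1 = (x
    + t) + (1 - t) gives [rho] >= 1 - t/x. Steps of 1 in s only bring factors 1 + s/x. *)
Let rho_cvg s : 0 <= s -> rho s m @[m --> \oo] --> (1 : R).
Proof.
move=> s0; have [n [t [t0 t1 ->]]] : exists n t, [/\ 0 <= t, t <= 1 & s = t + n%:R].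
  exists (Num.truncn s), (s - (Num.truncn s)%:R).
  have /andP[h1 h2] : (Num.truncn s)%:R <= s < (Num.truncn s).+1%:R.
    exact: truncn_itv.
  by rewrite -natr1 in h2; split; lra.
elim: n => [|n IH]; last first.
  rewrite -natr1 addrA.
  have -> : rho (t + n%:R + 1) = (fun m => rho (t + n%:R) m * (1 + (t + n%:R) / m.+1%:R)).
    by apply/funext => m; rewrite rhoS// addr_ge0.
  have h : 1 + (t + n%:R) / m.+1%:R @[m --> \oo] --> (1 + 0 : R).
    by apply: cvgD; [exact: cvg_cst|exact: invS_cvg0].
  by have := cvgM IH h; rewrite addr0 mulr1; apply.
rewrite addr0.
apply: (@squeeze_cvgr _ _ _ _ (fun m => 1 - t / m.+1%:R) (cst 1)); last first.
- exact: cvg_cst.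
- have h : 1 - t / m.+1%:R @[m --> \oo] --> (1 - 0 : R).
    by apply: cvgB; [exact: cvg_cst|exact: invS_cvg0].
  by move: h; rewrite subr0; apply.
near=> m; have m0 : 0 < m.+1%:R :> R by [].
have G0 := G_gt0 m0; set x := m.+1%:R : R in m0 G0 *.
have xt0 : 0 < x + t by rewrite ltr_wpDr.
have px : 0 < x `^ t by exact: powR_gt0.
apply/andP; split; last first.
  rewrite /rho ler_pdivrMr ?mulr_gt0// mul1r mulrC.
  by apply: GD_le => //; rewrite t0.
rewrite /rho ler_pdivlMr ?mulr_gt0//.
have h : x * G x <= (x + t) `^ (1 - t) * G (x + t).
  rewrite -GS// (_ : x + 1 = x + t + (1 - t)); last by ring.
  by apply: GD_le => //; lra.
have pxt : 0 < (x + t) `^ (1 - t) by exact: powR_gt0.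
rewrite -(ler_pM2l pxt); apply: le_trans h.
rewrite [leLHS](_ : _ = (x + t) `^ (1 - t) * (1 - t / x) * x `^ t * G x);
  last by ring.
rewrite ler_wpM2r ?(ltW G0)//.
have -> : (x + t) `^ (1 - t) * (1 - t / x) * x `^ t =
    (1 - t / x) * ((x + t) / x) `^ (1 - t) * x.
  have e : x^-1 `^ (1 - t) = x `^ t / x.
    by rewrite -{1}powR_inv1 ?(ltW m0)// -powRrM mulN1r opprB powRB_gt0// powRr1 ?(ltW m0).
  by rewrite powRM ?invr_ge0 ?(ltW m0) ?(ltW xt0)// e; field; rewrite gt_eqF.
rewrite -[leRHS]mul1r ler_wpM2r ?(ltW m0)//.
apply: (@le_trans _ _ ((1 - t / x) * ((x + t) / x))).
  apply: ler_wpM2l.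
    rewrite subr_ge0 ler_pdivrMr// mul1r (le_trans t1)// /x.
    by rewrite ler1n.
  by apply: ler1_powR; [rewrite ler_pdivlMr// mul1r lerDl|lra].
rewrite [leLHS](_ : _ = 1 - (t / x) ^+ 2); last by field; rewrite gt_eqF.
by rewrite gerBl sqr_ge0.
Unshelve. all: by end_near. Qed.

Let c : R := 4.
Let c4 : c = 4. Proof. by []. Qed.
Let c0 : 0 < c. Proof. by rewrite c4. Qed.

Let dup z : R := c `^ z * G z * G (z + 2^-1) / G (2 * z).

Let dupD z n : 0 < z -> dup (z + n%:R) = dup z.
Proof.
move=> z0; elim: n => [|n IH]; first by rewrite addr0.
rewrite -{}IH -natr1 addrA; set y := z + n%:R.
have y0 : 0 < y by rewrite /y ltr_wpDr.
rewrite /dup (_ : y + 1 + 2^-1 = y + 2^-1 + 1); last by ring.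
rewrite (_ : 2 * (y + 1) = 2 * y + 1 + 1); last by ring.
rewrite !GS; try lra.
rewrite (powRD_gt0 _ _ c0) (powRr1 (ltW c0)) c4; field.
by rewrite ?gt_eqF ?G_gt0//; lra.
Qed.

(** [dup] is invariant under z -> z + 1, and after a shift by m + 1 it is [K m], which does not
    depend on z, times [r z m], which tends to 1. So any two values of [dup] agree; the one at 1/2
    supplies the constant. *)
Let dup_const z : 0 < z -> dup z = dup 2^-1.
Proof.
move=> z0.
pose K m : R := c `^ m.+1%:R * G m.+1%:R ^+ 2 * m.+1%:R `^ 2^-1 / G (m.*2).+2%:R.
pose r z m := rho z m * rho (z + 2^-1) m / rho (2 * z) (m.*2).+1.
have dupE y m : 0 < y -> dup y = K m * r y m.
  move=> y0; rewrite -(dupD m.+1 y0) [y + _]addrC /dup /K /r.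
  have x0 : 0 < m.+1%:R :> R by [].
  have e2 : (m.*2).+2%:R = 2 * m.+1%:R :> R.
    by rewrite -natrM mulnC muln2 doubleS.
  rewrite mulrDr -e2 -addrA !rhoE; try lra.
  have r0 : rho (2 * y) (m.*2).+1 != 0.
    by rewrite gt_eqF// divr_gt0 ?mulr_gt0 ?powR_gt0 ?G_gt0//; lra.
  have -> : (m.*2).+2%:R `^ (2 * y) = c `^ y * m.+1%:R `^ y * m.+1%:R `^ y :> R.
    rewrite e2 powRM// (_ : 2 * y = y + y); last by ring.
    rewrite !powRD_gt0// -[2 `^ y * 2 `^ y]powRM//.
    by rewrite (_ : 2 * 2 = c) ?mulrA// c4; ring.
  rewrite !powRD_gt0//; field.
  rewrite r0/= !gt_eqF ?powR_gt0 ?G_gt0//.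
have rcvg y : 0 < y -> r y m @[m --> \oo] --> (1 : R).
  move=> y0.
  have h1 : rho y m * rho (y + 2^-1) m @[m --> \oo] --> (1 * 1 : R).
    by apply: cvgM; apply: rho_cvg; lra.
  suff h2 : (rho (2 * y) (m.*2).+1)^-1 @[m --> \oo] --> (1^-1 : R).
    by have := cvgM h1 h2; rewrite invr1 !mulr1 /r; exact.
  apply: cvgV; first exact: oner_neq0.
  apply: (@cvg_comp _ _ _ (fun m => (m.*2).+1) (rho (2 * y)) \oo \oo).
    move=> A [N _ hA]; exists N => // n /= Nn; apply: hA => /=.
    by rewrite (leq_trans Nn)// -addnn ltnW// ltnS leq_addr.
  by apply: rho_cvg; lra.
have h0 : 0 < 2^-1 :> R by lra.
have e m : dup z * r 2^-1 m = dup 2^-1 * r z m.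
  by rewrite (dupE z m z0) (dupE 2^-1 m h0); ring.
have h1 : dup z * r 2^-1 m @[m --> \oo] --> dup z * 1 by apply: cvgMr; exact: rcvg.
have h2 : dup z * r 2^-1 m @[m --> \oo] --> dup 2^-1 * 1.
  by under eq_fun do rewrite e; apply: cvgMr; exact: rcvg.
by have := cvg_unique _ h1 h2; rewrite !mulr1; apply.
Qed.

Lemma Gamma_like_duplication z : 0 < z ->
  4 `^ z * (G z * G (z + 2^-1)) = 2 * G 2^-1 * G (2 * z).
Proof.
move=> z0; rewrite -c4; have := dup_const z0; rewrite /dup.
have -> : 2 * 2^-1 = 1 :> R by field.
have -> : 2^-1 + 2^-1 = 1 :> R by field.
have -> : c `^ 2^-1 = 2.
  rewrite (powR12_sqrt (ltW c0)) c4 (_ : 4 = 2 ^+ 2 :> R); last by ring.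
  by rewrite sqrtr_sqr ger0_norm.
rewrite G1 => /(canRL (divfK _)) h.
rewrite mulrA h; last by apply: G_neq0; lra.
by field.
Qed.

Lemma Gamma_like_quotient_cvg a b s t : 0 <= a -> 0 <= b -> 0 <= s -> 0 <= t ->
  a + b = s + t ->
  G (n.+1%:R + a) * G (n.+1%:R + b) / (G (n.+1%:R + s) * G (n.+1%:R + t))
    @[n --> \oo] --> (1 : R).
Proof.
move=> a0 b0 s0 t0 abst.
have rho0 z n : 0 <= z -> rho z n != 0.
  by move=> z0; rewrite gt_eqF// divr_gt0 ?mulr_gt0 ?powR_gt0 ?G_gt0// ltr_wpDr.
have -> : (fun n => G (n.+1%:R + a) * G (n.+1%:R + b) / (G (n.+1%:R + s) * G (n.+1%:R + t))) =
    (fun n => rho a n * rho b n / (rho s n * rho t n)).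
  apply/funext => n; have x0 : 0 < n.+1%:R :> R by [].
  rewrite !rhoE//.
  have := powRD_gt0 a b x0; rewrite abst powRD_gt0// => e.
  rewrite [X in X / _](_ : _ =
    rho a n * rho b n * G n.+1%:R ^+ 2 * (n.+1%:R `^ a * n.+1%:R `^ b)); last by ring.
  rewrite -e; field.
  by rewrite !rho0// !gt_eqF ?powR_gt0 ?G_gt0.
have h1 : rho a n * rho b n @[n --> \oo] --> (1 * 1 : R) by apply: cvgM; exact: rho_cvg.
have h2 : (rho s n * rho t n)^-1 @[n --> \oo] --> ((1 * 1)^-1 : R).
  by apply: cvgV; [rewrite mulr1 oner_neq0|apply: cvgM; exact: rho_cvg].
by have := cvgM h1 h2; rewrite !mulr1 invr1 mulr1; exact.
Qed.

Lemma Gamma_like_symmetric_cvg s m : - 1 < s -> s < m%:R + 1 ->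
  G ((m + n.+1)%:R + 1 + s) * G ((m + n.+1)%:R + 1 - s) /
  G ((m + n.+1)%:R + 1) ^+ 2 @[n --> \oo] --> (1 : R).
Proof.
move=> s1 sm; have m0 : 0 <= m%:R :> R by [].
have := @Gamma_like_quotient_cvg (m%:R + 1 + s) (m%:R + 1 - s) (m%:R + 1) (m%:R + 1).
set u := (fun n : nat => _); set v := (fun n : nat => _).
have -> : u = v; last by apply; lra.
apply/funext => n; rewrite /u /v natrD.
by congr (G _ * G _ / (G _ * G _)); ring.
Qed.

End Gamma_like.

(** * The reflection formula *)

Section sine_product.
Context {R : realType}.
Notation mu := (@lebesgue_measure R).
Implicit Types (s x : R) (m : nat).

(** Cauchy's cosine integral. At m = 0 it contains sin(pi s), and its recurrence in m produces the
    factors m^2 - s^2 of Euler's sine product. *)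
Let J m s := \int[mu]_(x in `[0, pi / 2]) (cos (2 * s * x) * cos x ^+ m.*2).

Let pihalf_gt0 : 0 < pi / 2 :> R.
Proof. by rewrite divr_gt0 ?pi_gt0. Qed.

Let is_derive_scale (a x : R) : is_derive x 1 (fun x => a * x) a.
Proof. by apply: is_derive_eq; rewrite /cst/= -?[_ *: _]/(_ * _); ring. Qed.

Let is_derive_cosZ (a x : R) : is_derive x 1 (fun x => cos (a * x)) (- sin (a * x) * a).
Proof. exact: (@is_derive1_comp _ cos (fun x => a * x)). Qed.

Let is_derive_sinZ (a x : R) : is_derive x 1 (fun x => sin (a * x)) (cos (a * x) * a).
Proof. exact: (@is_derive1_comp _ sin (fun x => a * x)). Qed.

Let is_derive_cosX n x :
  is_derive x 1 (fun x => cos x ^+ n.+1) (n.+1%:R * cos x ^+ n * - sin x).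
Proof.
have h := @is_derive1_comp _ (horner ('X^(n.+1))) cos x _ _
  (is_derive_poly ('X^(n.+1)) (cos x)) (is_derive_cos x).
rewrite (_ : (fun x => _) = horner ('X^(n.+1)) \o cos); last first.
  by apply/funext => y /=; rewrite hornerXn.
by apply: is_derive_eq; rewrite derivXn hornerMn hornerXn/= mulr_natl.
Qed.

Let continuousJ m s x : {for x, continuous (fun x => cos (2 * s * x) * cos x ^+ m.*2)}.
Proof.
have c1 := is_derive_continuous (is_derive_cosZ (2 * s) x).
apply: cvgM; first exact: c1.
case: m => [|m]; first exact: cvg_cst.
have c2 := is_derive_continuous (is_derive_cosX m.*2.+1 x).
exact: c2.
Qed.

Let integrableJ m s :
  mu.-integrable `[0, pi / 2] (EFin \o (fun x => cos (2 * s * x) * cos x ^+ m.*2)).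
Proof.
by apply: within_continuous_integrable; apply: for_continuous_within => x _; exact: continuousJ.
Qed.

Let J0 s : 2 * s * J 0 s = sin (pi * s).
Proof.
rewrite /J -RintegralZl//.
rewrite (_ : \int[mu]_(x in _) _ = sin (2 * s * (pi / 2)) - sin (2 * s * 0)); last first.
  apply: (@Rintegral_FTC2 _ _ (fun x => sin (2 * s * x))) => //.
  - move=> x _; have h := is_derive_sinZ (2 * s) x.
    by apply: is_derive_eq; rewrite double0 expr0 mulr1 mulrC.
  - by move=> x _; apply: cvgMr; exact: (@continuousJ 0 s x).
by rewrite mulr0 sin0 subr0; congr sin; field.
Qed.

Let J00 : J 0 0 = pi / 2.
Proof.
rewrite -[RHS]subr0.
apply: (@Rintegral_FTC2 _ (fun x => cos (2 * 0 * x) * cos x ^+ 0.*2) (@idfun R)) => //.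
by move=> x _; apply: is_derive_eq; rewrite double0 expr0 mulr0 mul0r cos0 mulr1.
Qed.

(** Two integrations by parts performed at once: the integrand below is the derivative of [F], which
    vanishes at 0 and at pi/2. *)
Let JS m s : (m.+1%:R ^+ 2 - s ^+ 2) * J m.+1 s = m.+1%:R * (m.+1%:R - 2^-1) * J m s.
Proof.
set k := m.*2; set A : R := k.+2%:R ^+ 2 - 4 * s ^+ 2; set B : R := k.+2%:R * k.+1%:R.
have : \int[mu]_(x in `[0, pi / 2]) (A * (cos (2 * s * x) * cos x ^+ m.+1.*2) -
    B * (cos (2 * s * x) * cos x ^+ m.*2)) = 0.
  pose F x := k.+2%:R * (cos x ^+ k.+1 * (sin x * cos (2 * s * x))) -
    2 * s * (cos x ^+ k.+2 * sin (2 * s * x)).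
  have F0 : F (pi / 2) - F 0 = 0.
    by rewrite /F cos_pihalf sin0 !mulr0 sin0 !expr0n/= !(mul0r, mulr0, subr0).
  rewrite -[RHS]F0.
  apply: (@Rintegral_FTC2 _ (fun x => A * (cos (2 * s * x) * cos x ^+ m.+1.*2) -
    B * (cos (2 * s * x) * cos x ^+ m.*2)) F) => //.
    move=> x _.
    have s2 : sin x * sin x = 1 - cos x * cos x by rewrite -!expr2 sin2cos2.
    have h1 := is_derive_cosX k x; have h2 := is_derive_cosX k.+1 x.
    have h3 := is_derive_sin x.
    have h4 := is_derive_cosZ (2 * s) x; have h5 := is_derive_sinZ (2 * s) x.
    apply: is_derive_eq; rewrite /cst/= -![_ *: _]/(_ * _).
    rewrite doubleS -/k /A /B !exprS -[k.+2%:R]natr1 -[k.+1%:R]natr1.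
    set c := cos x in s2 *; set C := cos _; set S := sin (2 * s * x).
    transitivity ((k%:R + 1 + 1) * (C * c ^+ k * (c * c - (k%:R + 1) * (sin x * sin x))) -
      4 * s ^+ 2 * (C * (c * (c * c ^+ k)))); first by ring.
    by rewrite s2; ring.
  by move=> x _; apply: cvgB; apply: cvgMr; exact: continuousJ.
rewrite RintegralB//; try by apply: integrableZl_EFin => //; exact: integrableJ.
rewrite !RintegralZl//; try exact: integrableJ.
rewrite -!/(J _ _) /A /B => /eqP; rewrite subr_eq0 => /eqP h.
have k2 : k.+2%:R = 2 * m.+1%:R :> R by rewrite -natrM mul2n doubleS.
have k1 : k.+1%:R = 2 * m.+1%:R - 1 :> R by rewrite -k2 -[k.+2%:R]natr1 addrK.
rewrite k2 k1 in h; apply: (@mulfI _ 4) => //.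
by transitivity (((2 * m.+1%:R) ^+ 2 - 4 * s ^+ 2) * J m.+1 s); [ring|rewrite h; field].
Qed.

Let sin_sqr_le x : sin x ^+ 2 <= x ^+ 2.
Proof.
wlog x0 : x / 0 <= x => [hw|].
  have [|/ltW x0] := leP 0 x; first exact: hw.
  by have := hw (- x); rewrite oppr_ge0 sinN !sqrrN; exact.
have h1 : sin x <= x.
  have := @is_derive_ge0_le R (fun x => x - sin x) (fun x => 1 - cos x) 0 x x0.
  rewrite sin0 subr0 subr_ge0; apply.
  by move=> y _; rewrite subr_ge0 cos_le1.
have h2 : - x <= sin x.
  have := @is_derive_ge0_le R (fun x => x + sin x) (fun x => 1 + cos x) 0 x x0.
  rewrite sin0 addr0 => h; rewrite -subr_ge0 opprK addrC; apply: h.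
  by move=> y _; rewrite addrC -lerBlDr sub0r cos_geN1.
by rewrite -[leRHS]real_normK ?num_real// -[leLHS]real_normK ?num_real// ler_sqr ?nnegrE//
  [`|x|]ger0_norm// ler_norml h1 h2.
Qed.

Let mulx_cos_le x : 0 <= x <= pi / 2 -> x * cos x <= sin x.
Proof.
move=> /andP[x0 xp].
have := @is_derive_ge0_le R (fun x => sin x - x * cos x) (fun x => x * sin x) 0 x x0.
rewrite sin0 mul0r subr0 subr_ge0; apply.
- by move=> y _ /=; apply: is_derive_eq; rewrite -![_ *: _]/(_ * _); ring.
- move=> y /andP[y0 yx]; rewrite mulr_ge0// sin_ge0_pi// y0 (le_trans yx)// (le_trans xp)//.
  by rewrite ler_pdivrMr// ler_peMr ?pi_ge0// ler1n.
Qed.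

Let J_gt0 m : 0 < J m 0.
Proof.
elim: m => [|m IH]; first by rewrite J00.
have m0 : 0 < m.+1%:R :> R by [].
have := JS m 0; rewrite expr0n subr0 => h.
rewrite -(pmulr_rgt0 _ (exprn_gt0 2 m0)) h mulr_gt0// mulr_gt0//.
by rewrite subr_gt0 (lt_le_trans _ (_ : 1 <= _)) ?ler1n// invf_lt1// ltr1n.
Qed.

(** Since 1 - cos(2sx) = 2 sin(sx)^2 <= 2 s^2 x^2 and x cos x <= sin x, the difference of [J m.+1 0]
    and [J m.+1 s] is at most 2 s^2 times that of [J m 0] and [J m.+1 0], which the recurrence at s
    = 0 bounds by [J m.+1 0 / m.+1%:R]. *)
Let J_ratio_dist m s : `|1 - J m.+1 s / J m.+1 0| <= 2 * s ^+ 2 / m.+1%:R.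
Proof.
have J1 := J_gt0 m.+1; have J2 := J_gt0 m; have m0 : 0 < m.+1%:R :> R by [].
have m1 : 1 <= m.+1%:R :> R by rewrite ler1n.
rewrite -{1}(divff (lt0r_neq0 J1)) -mulrBl normrM normfV (gtr0_norm J1) ler_pdivrMr//.
have h : J m 0 - J m.+1 0 = 2^-1 / (m.+1%:R - 2^-1) * J m.+1 0.
  have := JS m 0; rewrite expr0n subr0 => e.
  have e' : m.+1%:R * J m.+1 0 = (m.+1%:R - 2^-1) * J m 0.
    by apply: (mulfI (lt0r_neq0 m0)); rewrite mulrA -expr2 e mulrA.
  have n0 : m.+1%:R - 2^-1 != 0 :> R by rewrite gt_eqF//; lra.
  apply: (mulfI n0); rewrite mulrBr -e'; field.
  by move: n0; set x := m.+1%:R; lra.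
have {}h : J m 0 - J m.+1 0 <= J m.+1 0 / m.+1%:R.
  rewrite h mulrC ler_wpM2l ?(ltW J1)// ler_pdivrMr; last by lra.
  by rewrite mulrBr mulVf ?gt_eqF// lerBrDl -lerBrDr ler_pdivrMl//; nra.
apply: (@le_trans _ _ (2 * s ^+ 2 * (J m 0 - J m.+1 0))); last first.
  rewrite [leRHS](_ : _ = 2 * s ^+ 2 * (J m.+1 0 / m.+1%:R)); last by ring.
  by apply: ler_wpM2l; [exact: mulr_ge0 (ler0n _ _) (sqr_ge0 _) | exact: h].
rewrite /J -RintegralB//; try exact: integrableJ.
rewrite -RintegralB//; try exact: integrableJ.
have ib : mu.-integrable `[0, pi / 2] (EFin \o (fun x =>
    cos (2 * 0 * x) * cos x ^+ m.+1.*2 - cos (2 * s * x) * cos x ^+ m.+1.*2)).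
  by apply: integrableB_EFin => //; exact: integrableJ.
have ib' : mu.-integrable `[0, pi / 2] (EFin \o (fun x =>
    cos (2 * 0 * x) * cos x ^+ m.*2 - cos (2 * 0 * x) * cos x ^+ m.+1.*2)).
  by apply: integrableB_EFin => //; exact: integrableJ.
rewrite -RintegralZl//; apply: (le_trans (le_normr_Rintegral _ ib)) => //.
apply: le_Rintegral => //.
- exact: (integrable_norm ib).
- exact: integrableZl_EFin.
move=> x /=; rewrite in_itv/= => xp; rewrite !mulr0 !mul0r cos0 !mul1r doubleS.
set c := cos x; have c2 := mulx_cos_le xp; set k := m.*2.
have /andP[x0 xp2] := xp.
have c0 : 0 <= c by apply: cos_ge0_pihalf; rewrite xp2 andbT; lra.
have -> : c ^+ k.+2 - cos (2 * s * x) * c ^+ k.+2 = (1 - cos (2 * s * x)) * c ^+ k.+2 by ring.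
have -> : cos (2 * s * x) = 1 - 2 * sin (s * x) ^+ 2.
  rewrite (_ : 2 * s * x = (s * x) *+ 2); last by ring.
  by rewrite cos_mulr2n cos2sin2; ring.
have -> : 1 - (1 - 2 * sin (s * x) ^+ 2) = 2 * sin (s * x) ^+ 2 by ring.
rewrite ger0_norm; last first.
  by apply: mulr_ge0; [apply: mulr_ge0 => //; exact: sqr_ge0|exact: exprn_ge0].
have -> : c ^+ k - c ^+ k.+2 = sin x ^+ 2 * c ^+ k by rewrite sin2cos2 -/c !exprS; ring.
apply: (@le_trans _ _ (2 * (s * x) ^+ 2 * c ^+ k.+2)).
  by rewrite ler_wpM2r ?exprn_ge0// ler_wpM2l.
have -> : 2 * (s * x) ^+ 2 * c ^+ k.+2 = 2 * s ^+ 2 * ((x * c) ^+ 2 * c ^+ k).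
  by rewrite !exprS; ring.
apply: ler_wpM2l; first exact: mulr_ge0 (ler0n _ _) (sqr_ge0 _).
apply: ler_wpM2r; first exact: exprn_ge0.
have xc0 : 0 <= x * c by exact: mulr_ge0.
by rewrite ler_sqr ?nnegrE// (le_trans xc0).
Qed.

Let J_ratio_cvg m s : J (m + n.+1) s / J (m + n.+1) 0 @[n --> \oo] --> (1 : R).
Proof.
have h0 : 2 * s ^+ 2 / n.+1%:R @[n --> \oo] --> (0 : R).
  by rewrite -(mulr0 (2 * s ^+ 2)); apply: cvgMr; exact: cvg_harmonic.
apply/cvgrPdist_le => e e0; move/cvgrPdist_le: h0 => /(_ e e0).
apply: filterS => n; have s0 : 0 <= 2 * s ^+ 2 := mulr_ge0 (ler0n _ _) (sqr_ge0 _).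
rewrite sub0r normrN ger0_norm ?divr_ge0// => h.
rewrite addnS; apply: (le_trans (J_ratio_dist _ s)); apply: le_trans h.
by apply: ler_wpM2l => //; rewrite lef_pV2 ?posrE// ler_nat ltnS leq_addl.
Qed.

Variable G : R -> R.
Hypothesis G_gt0 : forall s, 0 < s -> 0 < G s.
Hypothesis GS : forall s, 0 < s -> G (s + 1) = s * G s.
Hypothesis G1 : G 1 = 1.
Hypothesis GD_le : forall x s, 0 < x -> 0 <= s <= 1 -> G (x + s) <= x `^ s * G x.

Let p m s : R := \prod_(j < m) (j%:R - s).

(** Euler's product for the sine after m factors, with [J m s / J m 0] as the exact remainder; the
    Gamma values gather the factors j + s. *)
Let sin_product m s : - 1 < s ->
  - sin (pi * s) * G (1 + s) * G (m%:R + 1) ^+ 2 =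
  pi * p m.+1 s * (J m s / J m 0) * G (m%:R + 1 + s).
Proof.
move=> s1; elim: m => [|m IH].
  rewrite /p big_ord1 add0r G1 -J0 J00 sub0r.
  by move: (lt0r_neq0 (@pi_gt0 R)); move: (@pi R) => P P0; field.
have J1 := J_gt0 m.+1; have J2 := J_gt0 m; have m0 : 0 < m.+1%:R :> R by [].
rewrite -[m.+1%:R]natr1 in m0 *; set x : R := m%:R + 1 in IH m0 *.
have xs : 0 < x + s by rewrite /x; have : 0 <= m%:R :> R by []; lra.
rewrite (GS m0) (_ : x + 1 + s = x + s + 1) ?(GS xs); last by ring.
have -> : - sin (pi * s) * G (1 + s) * (x * G x) ^+ 2 =
  x ^+ 2 * (- sin (pi * s) * G (1 + s) * G x ^+ 2) by ring.
rewrite IH [p m.+2 s]/p big_ord_recr/= -/(p m.+1 s) -[m.+1%:R]natr1 -/x.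
have := JS m s; have := JS m 0; rewrite -[m.+1%:R]natr1 -/x expr0n subr0 => e1 e2.
have x2 : x - 2^-1 != 0.
  have : 0 <= m%:R :> R by [].
  by move=> h; rewrite gt_eqF// /x; lra.
have e : x ^+ 2 * J m s * J m.+1 0 = (x ^+ 2 - s ^+ 2) * J m.+1 s * J m 0.
  by rewrite e2 -mulrA [J m s * _]mulrC mulrA e1; ring.
move: (p m.+1 s) (@pi R) => P Pi.
have -> : x ^+ 2 * (Pi * P * (J m s / J m 0) * G (x + s)) =
  Pi * P * G (x + s) / (J m 0 * J m.+1 0) *
  (x ^+ 2 * J m s * J m.+1 0).
  by field; rewrite !gt_eqF.
by rewrite e; field; rewrite !gt_eqF.
Qed.

(** [sin_product] is applied at m + n + 1 and n tends to infinity: the cosine and Gamma quotients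
    both tend to 1, while the left-hand side is free of n. *)
Let reflectionS m s : - 1 < s -> s < m%:R + 1 ->
  - sin (pi * s) * G (1 + s) * G (m%:R + 1 - s) = pi * p m.+1 s.
Proof.
move=> s1 sm.
pose q n : R := \prod_(i < n) (m%:R + 1 + i%:R - s).
have q0 n : 0 < q n.
  by apply: prodr_gt0 => i _; have : 0 <= i%:R :> R by []; lra.
have pq n : p (m + n).+1 s = p m.+1 s * q n.
  elim: n => [|n IH]; first by rewrite addn0 /q big_ord0 mulr1.
  rewrite addnS [p (m + n).+2 s]/p big_ord_recr/= -/(p (m + n).+1 s) IH.
  rewrite [q n.+1]/q big_ord_recr/= -/(q n) -[(m + n).+1%:R]natr1 natrD; ring.
have Gq n : G ((m + n)%:R + 1 - s) = q n * G (m%:R + 1 - s).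
  elim: n => [|n IH]; first by rewrite addn0 /q big_ord0 mul1r.
  rewrite addnS -[(m + n).+1%:R]natr1 (_ : _ - s = (m + n)%:R + 1 - s + 1); last by ring.
  rewrite GS; last by rewrite natrD; have : 0 <= n%:R :> R by []; lra.
  by rewrite IH [q n.+1]/q big_ord_recr/= -/(q n) natrD; ring.
have e n : - sin (pi * s) * G (1 + s) * G (m%:R + 1 - s) =
    pi * p m.+1 s * (J (m + n.+1) s / J (m + n.+1) 0 *
    (G ((m + n.+1)%:R + 1 + s) * G ((m + n.+1)%:R + 1 - s) / G ((m + n.+1)%:R + 1) ^+ 2)).
  have := sin_product (m + n.+1) s1; rewrite pq Gq => h.
  have GM : 0 < G ((m + n.+1)%:R + 1) by apply: G_gt0.
  have qn := q0 n.+1.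
  rewrite [LHS](_ : _ = (- sin (pi * s) * G (1 + s) *
    G ((m + n.+1)%:R + 1) ^+ 2) * G (m%:R + 1 - s) / G ((m + n.+1)%:R + 1) ^+ 2); last first.
    by field; rewrite gt_eqF.
  by rewrite h; field; rewrite !gt_eqF ?J_gt0.
have h1 : pi * p m.+1 s * (J (m + n.+1) s / J (m + n.+1) 0 *
    (G ((m + n.+1)%:R + 1 + s) * G ((m + n.+1)%:R + 1 - s) /
     G ((m + n.+1)%:R + 1) ^+ 2)) @[n --> \oo] --> pi * p m.+1 s * (1 * 1).
  apply: cvgMr; apply: cvgM; first exact: J_ratio_cvg.
  exact: (Gamma_like_symmetric_cvg G_gt0 GS GD_le).
move: h1; rewrite -(funext e) !mulr1 => /cvg_lim <- //.
by rewrite lim_cst.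
Qed.

(** Euler's formula Gamma(-s) Gamma(1+s) sin(pi s) = -pi, multiplied by the product of the j - s,
    which shifts -s to the positive argument m - s where [G] is known. *)
Lemma Gamma_like_reflection m s : - 1 < s -> s < m%:R ->
  G (m%:R - s) * G (1 + s) * sin (pi * s) = - pi * \prod_(j < m) (j%:R - s).
Proof.
move=> s1 sm; have sm1 : s < m%:R + 1 by lra.
have ms : 0 < m%:R - s by lra.
have := reflectionS s1 sm1; rewrite /p big_ord_recr/=.
rewrite (_ : m%:R + 1 - s = m%:R - s + 1); last by ring.
rewrite GS// => h; apply: (mulIf (lt0r_neq0 ms)).
by rewrite -[RHS]mulrA mulNr -h; ring.
Qed.

Lemma Gamma_like_half : G 2^-1 ^+ 2 = pi.
Proof.
have h := @Gamma_like_reflection 1 2^-1; rewrite big_ord1 in h.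
have : G (1 - 2^-1) * G (1 + 2^-1) * sin (pi / 2) = - pi * (0 - 2^-1) by apply: h; lra.
rewrite sin_pihalf mulr1 (_ : 1 - 2^-1 = 2^-1); last by field.
rewrite addrC GS; last by lra.
move=> h2; rewrite [LHS](_ : _ = 2 * (G 2^-1 * (2^-1 * G 2^-1))); last by field.
by rewrite h2; move: (@pi R) => P; field.
Qed.

End sine_product.

(** * Legendre polynomials *)

Section legendre_algebra.
Context {R : realType}.
Implicit Types (p q : {poly R}) (n m j : nat).

Let W : {poly R} := 'X^2 - 1.

Let derivW : W^`() = 2 *: 'X.
Proof. by rewrite /W derivB derivXn derivC subr0 scaler_nat. Qed.

Lemma derivnXM n p :
  ('X * p)^`(n.+1) = 'X * p^`(n.+1) + n.+1%:R *: p^`(n).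
Proof.
elim: n => [|n IH]; first by rewrite derivn1 derivM derivX mul1r scale1r derivn0 addrC.
rewrite derivnS IH derivD derivM derivX mul1r derivZ -!derivnS.
by rewrite -natr1 scalerDl scale1r -!mul_polyC; ring.
Qed.

Let derivWXn n : (W ^+ n.+1)^`() = (2 * n.+1%:R) *: ('X * W ^+ n).
Proof.
by rewrite deriv_exp derivW/= -scaler_nat -scalerAl scalerA mulrC.
Qed.

(** The relation W (W^n)' = 2n X W^n differentiated j times. At [j = 0] the coefficient of the term
    with [j.-1] vanishes; at [j = n] that of the first term does, which yields Legendre's
    equation. *)
Let W_derivn n j : W * (W ^+ n)^`(j.+1) =
  (2 * (n%:R - j%:R)) *: ('X * (W ^+ n)^`(j)) +
  (j%:R * (2 * n%:R - j%:R + 1)) *: (W ^+ n)^`(j.-1).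
Proof.
elim: j => [|j IH].
  rewrite derivn1 mul0r scale0r addr0 derivn0 subr0.
  case: n => [|n]; first by rewrite expr0 derivC mulr0 mulr0 scale0r.
  by rewrite derivWXn -scalerAr mulrCA -exprS.
have := congr1 (@deriv R) IH; rewrite derivM derivW -derivnS derivD !derivZ derivM derivX.
rewrite mul1r -derivnS => /(canRL (addKr _)) ->/=.
have -> : (j%:R * (2 * n%:R - j%:R + 1)) *: ((W ^+ n)^`(j.-1))^`() =
          (j%:R * (2 * n%:R - j%:R + 1)) *: (W ^+ n)^`(j).
  by case: j {IH} => [|j]; rewrite ?mul0r ?scale0r// -derivnS.
rewrite -!mul_polyC -natr1 !polyCM !polyCD !polyCN.
by rewrite ?polyCM ?polyCD ?polyCN; ring.
Qed.

Let legendreE n : legendre n = (2 ^+ n * n`!%:R)^-1 *: (W ^+ n)^`(n).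
Proof. by []. Qed.

Lemma legendre0 : legendre 0 = 1 :> {poly R}.
Proof. by rewrite legendreE expr0 derivn0 expr0 fact0 mulr1 invr1 scale1r. Qed.

Lemma deriv_legendreS n :
  (legendre n.+1)^`() = 'X * (legendre n)^`() + n.+1%:R *: legendre n :> {poly R}.
Proof.
rewrite !legendreE !derivZ -!derivnS derivSn derivWXn derivnZ scalerA derivnXM.
rewrite (_ : (2 ^+ n.+1 * (n.+1)`!%:R)^-1 * (2 * n.+1%:R) = (2 ^+ n * n`!%:R)^-1); last first.
  rewrite factS natrM exprS; field.
  by rewrite !(gt_eqF, exprn_gt0, ltr0n, fact_gt0)// nat1r ltr0n.
by rewrite scalerDr -scalerAr !scalerA [n.+1%:R * _]mulrC.
Qed.

Let W_deriv_legendre n : W * (legendre n)^`() =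
  ((2 ^+ n * n`!%:R)^-1 * (n%:R * n.+1%:R)) *: (W ^+ n)^`(n.-1).
Proof.
rewrite legendreE derivZ -derivnS -scalerAr W_derivn subrr mulr0 scale0r add0r scalerA.
by rewrite -natr1; congr (_ *: _); ring.
Qed.

Lemma legendre_ode n :
  (('X^2 - 1) * (legendre n)^`())^`() = (n%:R * n.+1%:R) *: legendre n :> {poly R}.
Proof.
rewrite -/W W_deriv_legendre derivZ [in RHS]legendreE scalerA [_ * (n%:R * _)]mulrC.
by case: n => [|n]; rewrite ?mul0r ?scale0r// -derivnS.
Qed.

Lemma legendreS n : n.+1%:R *: legendre n.+1 =
  n.+1%:R *: ('X * legendre n) + ('X^2 - 1) * (legendre n)^`() :> {poly R}.
Proof.
rewrite -/W W_deriv_legendre; case: n => [|n].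
  rewrite legendre0 mul0r mulr0 scale0r addr0 mulr1 !scale1r legendreE derivn1 !expr1.
  by rewrite derivW scalerA (_ : 1`! = 1%N)// mulr1 mulVf ?scale1r.
rewrite !legendreE [in LHS]derivSn derivWXn derivnZ derivnXM [_^-1 *: (_ *: _)]scalerA.
rewrite (_ : (2 ^+ n.+2 * (n.+2)`!%:R)^-1 * (2 * n.+2%:R) = (2 ^+ n.+1 * (n.+1)`!%:R)^-1); last first.
  rewrite factS natrM [2 ^+ n.+2]exprS; field.
  by rewrite !(gt_eqF, exprn_gt0, ltr0n, fact_gt0)// nat1r ltr0n.
set c := (2 ^+ n.+1 * _)^-1; rewrite /= -!mul_polyC !polyCM; ring.
Qed.

Lemma deriv_legendre_pred n :
  'X * (legendre n.+1)^`() - (legendre n)^`() = n.+1%:R *: legendre n.+1 :> {poly R}.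
Proof.
rewrite legendreS deriv_legendreS mulrDr -scalerAr mulrA -expr2.
by rewrite mulrBl mul1r [RHS]addrC addrAC.
Qed.

Lemma legendre1 n : (legendre n).[1] = 1 :> R.
Proof.
elim: n => [|n IH]; first by rewrite legendre0 hornerC.
move: (legendreS n) IH; move: (legendre n) (legendre n.+1) => p q.
move=> /(congr1 (horner^~ 1)); rewrite !hornerE => + p1; rewrite p1.
rewrite ?expr1n subrr ?mul0r ?addr0 => h.
apply: (@mulfI _ n.+1%:R); first by rewrite pnatr_eq0.
by rewrite h /= !mulr1.
Qed.

Lemma legendreN n x : (legendre n).[- x] = (- 1) ^+ n * (legendre n).[x] :> R.
Proof.
suff h : legendre n \Po (- 'X) = (- 1) ^+ n *: legendre n :> {poly R}.
  move: h; move: (legendre n) => p /(congr1 (horner^~ x)).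
  by rewrite horner_comp !hornerE.
elim: n => [|n IH]; first by rewrite legendre0 comp_polyC expr0 scale1r.
have n0 : n.+1%:R != 0 :> R by rewrite pnatr_eq0.
apply: (scalerI n0); rewrite -comp_polyZ legendreS scalerA [n.+1%:R * _]mulrC -[RHS]scalerA legendreS.
rewrite comp_polyD comp_polyZ !comp_polyM comp_polyX IH.
have -> : (legendre n)^`() \Po - 'X = (- 1) ^+ n.+1 *: (legendre n)^`() :> {poly R}.
  move: IH; move: (legendre n) => p /(congr1 (@deriv R)).
  rewrite deriv_comp derivN derivX mulrN1 derivZ => /eqP.
  by rewrite eqr_oppLR => /eqP ->; rewrite exprS mulN1r scaleNr.
have -> : ('X^2 - 1) \Po - 'X = 'X^2 - 1 :> {poly R}.
  by rewrite comp_polyB expr2 comp_polyM comp_polyX comp_polyC mulrNN.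
rewrite [(- 1) ^+ n.+1]exprS -!mul_polyC !polyCM !polyCN; ring.
Qed.

Let legendre_coefs n :
  (size (legendre n : {poly R}) <= n.+1)%N /\ 0 < (legendre n : {poly R})`_n.
Proof.
elim: n => [|n [sz c0]]; first by rewrite legendre0 size_poly1 coef1.
have n0 : n.+1%:R != 0 :> R by rewrite pnatr_eq0.
have cE i : (n <= i)%N -> n.+1%:R * (legendre n.+1)`_i.+1 =
    n.+1%:R * (legendre n)`_i + i%:R * (legendre n)`_i :> R.
  move=> ni; have := congr1 (fun p : {poly R} => p`_i.+1) (legendreS n).
  rewrite coefZ coefD coefZ coefXM/= mulrBl mul1r coefB coefXnM !coef_deriv.
  have -> : (legendre n)`_i.+2 = 0 :> R.
    by rewrite nth_default// (leq_trans sz)// ltnS ltnW.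
  rewrite mul0rn subr0 => ->; congr (_ + _).
  case: i {ni} => [|i]; first by rewrite mul0r.
  by rewrite ltnS/= subn2/= mulr_natl.
split.
  apply/leq_sizeP => -[//|i] ni; apply: (mulfI n0); rewrite mulr0 cE; last exact: ltnW.
  by rewrite nth_default ?mulr0 ?addr0// (leq_trans sz).
have := cE n (leqnn n) => h.
have : 0 < n.+1%:R * (legendre n.+1)`_n.+1 :> R.
  by rewrite h -mulrDl mulr_gt0// ltr_wpDr.
by rewrite (pmulr_rgt0 _ (ltr0Sn R n)).
Qed.

Lemma size_legendre n : size (legendre n : {poly R}) = n.+1.
Proof.
have [sz c0] := legendre_coefs n; apply/eqP; rewrite eqn_leq sz/=.
by rewrite ltnNge; apply/negP => /leq_sizeP /(_ n (leqnn n)) h; rewrite h ltxx in c0.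
Qed.

Lemma size_deriv_legendre n : (size ((legendre n)^`() : {poly R}) <= n)%N.
Proof.
apply/leq_sizeP => i ni; rewrite coef_deriv.
have -> : (legendre n)`_i.+1 = 0 :> R by apply: nth_default; rewrite size_legendre.
by rewrite mul0rn.
Qed.

Lemma legendre_span n p : (size p <= n)%N ->
  exists c : nat -> R, p = \sum_(i < n) c i *: legendre i.
Proof.
elim: n p => [|n IH] p sp.
  by exists (fun _ => 0); rewrite big_ord0; apply/eqP; rewrite -size_poly_leq0.
have [_ l0] := legendre_coefs n; set l := (legendre n)`_n in l0.
have [|c pE] := IH (p - (p`_n / l) *: legendre n).
  apply/leq_sizeP => i; rewrite leq_eqVlt => /predU1P[<-|ni].
    by rewrite coefB coefZ divfK ?subrr// gt_eqF.
  rewrite coefB coefZ (nth_default _ (leq_trans sp ni)).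
  have -> : (legendre n)`_i = 0 :> R by apply: nth_default; rewrite size_legendre.
  by rewrite mulr0 subrr.
exists (fun i => if (i < n)%N then c i else p`_n / l).
rewrite big_ord_recr/= ltnn; apply/eqP; rewrite -subr_eq; apply/eqP; rewrite pE.
by apply: eq_bigr => i _; rewrite ltn_ord.
Qed.

End legendre_algebra.

(** * Orthogonality of the Legendre polynomials *)

Section legendre_orthogonality.
Context {R : realType}.
Notation mu := (@lebesgue_measure R).
Implicit Types (p q : {poly R}) (n m : nat) (a b : R).

Lemma continuous_horner p : continuous (fun x => p.[x]).
Proof.
move=> x; have [d _] := is_derive_poly p x.
exact/differentiable_continuous/derivable1_diffP.
Qed.

Lemma integrable_horner p a b : mu.-integrable `[a, b] (EFin \o horner p).
Proof.
apply: within_continuous_integrable; apply: for_continuous_within => x _.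
exact: continuous_horner.
Qed.

Lemma Rintegral_deriv_poly p a b : a < b ->
  \int[mu]_(x in `[a, b]) p^`().[x] = p.[b] - p.[a].
Proof.
move=> ab; apply: Rintegral_FTC2 => // x _; exact: continuous_horner.
Qed.

Let dot p q := \int[mu]_(x in `[-1, 1]) (p.[x] * q.[x]).

Let dotE p q : dot p q = \int[mu]_(x in `[-1, 1]) (p * q).[x].
Proof. by apply: eq_Rintegral => x _; rewrite hornerM. Qed.

Let dotC p q : dot p q = dot q p.
Proof. by rewrite !dotE mulrC. Qed.

Let dotDl p q r : dot (p + q) r = dot p r + dot q r.
Proof.
rewrite !dotE -RintegralD//; try exact: integrable_horner.
by apply: eq_Rintegral => x _; rewrite mulrDl hornerD.
Qed.

Let dotZl c p r : dot (c *: p) r = c * dot p r.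
Proof.
rewrite !dotE -RintegralZl//; try exact: integrable_horner.
by apply: eq_Rintegral => x _; rewrite -scalerAl hornerZ.
Qed.

(** Sturm-Liouville argument: X^2 - 1 times the Wronskian vanishes at both ends, and its derivative
    is P_n P_m times the difference of the eigenvalues n (n+1) and m (m+1). *)
Let legendre_orth n m : n != m -> dot (legendre n) (legendre m) = 0.
Proof.
move=> nm; set W : {poly R} := 'X^2 - 1.
have : \int[mu]_(x in `[-1, 1])
    (W * ((legendre n)^`() * legendre m - legendre n * (legendre m)^`()))^`().[x] = 0.
  by rewrite Rintegral_deriv_poly// !hornerE/= sqrrN !expr1n subrr !mul0r subrr.
have -> : (W * ((legendre n)^`() * legendre m - legendre n * (legendre m)^`()))^`() =
    (n%:R * n.+1%:R - m%:R * m.+1%:R) *: (legendre n * legendre m).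
  move: (@legendre_ode R n) (@legendre_ode R m); rewrite -/W.
  move: (legendre n) (legendre m) => p q.
  have [A AE] : exists A, A = W * p^`() by exists (W * p^`()).
  have [B BE] : exists B, B = W * q^`() by exists (W * q^`()).
  rewrite (_ : W * (p^`() * q - p * q^`()) = A * q - p * B); last by rewrite AE BE; ring.
  rewrite -AE -BE derivB !derivM => -> ->; rewrite AE BE.
  by rewrite -!mul_polyC polyCB; ring.
move=> h.
have : (n%:R * n.+1%:R - m%:R * m.+1%:R) * dot (legendre n) (legendre m) = 0.
  by rewrite -dotZl dotE -scalerAl.
move=> /eqP; rewrite mulf_eq0 => /orP[|/eqP//].
rewrite -!natrM subr_eq0 eqr_nat => /eqP nmE; exfalso; move: nm.
rewrite neq_ltn => /orP[] nm.
- by move: nmE => /eqP; rewrite ltn_eqF// ltn_mul.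
- by move: nmE => /eqP; rewrite gtn_eqF// ltn_mul.
Qed.

Lemma legendre_orth_lower n q : (size q <= n)%N ->
  \int[mu]_(x in `[-1, 1]) (q.[x] * (legendre n).[x]) = 0.
Proof.
move=> /legendre_span[c ->]; rewrite -/(dot _ _).
have : forall i : 'I_n, dot (legendre i) (legendre n) = 0.
  by move=> i; apply: legendre_orth; rewrite ltn_eqF.
elim/big_ind : (\sum_(i < n) _) => [_|p q' hp hq h|i _ h].
- by rewrite dotE mul0r; under eq_Rintegral do rewrite horner0; rewrite Rintegral_cst// mul0r.
- by rewrite dotDl hp// hq// addr0.
- by rewrite dotZl h mulr0.
Qed.

Let dot_lower n q : (size q <= n)%N -> dot q (legendre n) = 0.
Proof. exact: legendre_orth_lower. Qed.

(** For the norm, (2n+3) P_(n+1) is P'_(n+2) - P'_n. Only P'_(n+2) contributes, and adding P_(n+2)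
    P'_(n+1), whose integral is 0, turns its product with P_(n+1) into the derivative of an odd
    polynomial equal to 1 at 1. *)
Lemma legendre_orthogonal n m :
  \int[mu]_(x in `[-1, 1]) ((legendre n).[x] * (legendre m).[x]) =
  (2 / (2 * n%:R + 1)) *+ (n == m).
Proof.
have [<-|nm] := eqVneq n m; last by rewrite mulr0n; exact: legendre_orth.
rewrite mulr1n -/(dot _ _); case: n => [|n].
  rewrite legendre0 dotE mulr1 -derivX Rintegral_deriv_poly// !hornerX.
  by field.
have n0 : 2 * n.+1%:R + 1 != 0 :> R by rewrite gt_eqF// ltr_wpDl.
apply: (mulIf n0); rewrite divfK// mulrC -dotZl.
have -> : (2 * n.+1%:R + 1) *: legendre n.+1 = (legendre n.+2)^`() - (legendre n)^`() :> {poly R}.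
  rewrite deriv_legendreS addrAC deriv_legendre_pred -scalerDl; congr (_ *: _).
  by rewrite -[n.+2%:R]natr1; ring.
rewrite -scaleN1r dotDl dotZl.
rewrite (dot_lower (q := (legendre n)^`())); last first.
  by rewrite (leq_trans (size_deriv_legendre _)).
rewrite mulr0 addr0.
have e : dot (legendre n.+2)^`() (legendre n.+1) =
    \int[mu]_(x in `[-1, 1]) (legendre n.+2 * legendre n.+1)^`().[x].
  rewrite derivM; under [RHS]eq_Rintegral do rewrite hornerD.
  rewrite RintegralD//; try exact: integrable_horner.
  rewrite -dotE -[X in _ = _ + X]dotE [X in _ = _ + X]dotC.
  rewrite [X in _ + X]dot_lower ?addr0//.
  by rewrite (leq_trans (size_deriv_legendre _)).
rewrite e Rintegral_deriv_poly// !hornerM !legendreN !legendre1 !mulr1.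
by rewrite [(-1) ^+ n.+2]exprS -mulrA -exprD addnn -mul2n exprM sqrrN !expr1n; ring.
Qed.

End legendre_orthogonality.

(** * Fractional integrals of Legendre polynomials *)

Section frac_poly.
Context {R : realType}.
Implicit Types (p q : {poly R}) (n m : nat) (s t : R).

Variable G : R -> R.
Hypothesis G_gt0 : forall s, 0 < s -> 0 < G s.
Hypothesis GS : forall s, 0 < s -> G (s + 1) = s * G s.

Let G_neq0 s : 0 < s -> G s != 0.
Proof. by move=> /G_gt0 /lt0r_neq0. Qed.

Let term s t p j : R := (- 1) ^+ j * p^`(j).[1] * (1 - t) `^ (j%:R + s) / G (j%:R + s + 1).

(* The right-sided Riemann-Liouville integral of order [s] based at 1 of a
   polynomial, expanded in powers of [1 - t]. *)
Definition frac_poly s p t : R := \sum_(j < size p) term s t p j.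

Let frac_polyE n s p t : (size p <= n)%N -> frac_poly s p t = \sum_(j < n) term s t p j.
Proof.
move=> pn; rewrite /frac_poly -!(big_mkord xpredT (term s t p)).
rewrite [RHS](big_cat_nat (n := size p))//= [X in _ = _ + X]big_nat_cond [X in _ = _ + X]big1 ?addr0//.
move=> i /andP[/andP[pi _] _]; rewrite /term derivn_poly0// horner0.
by rewrite mulr0 !mul0r.
Qed.

Lemma frac_polyD s p q t : frac_poly s (p + q) t = frac_poly s p t + frac_poly s q t.
Proof.
set n := maxn (size p) (size q).
rewrite (frac_polyE (n := n)) ?size_polyD// (@frac_polyE n _ p) ?leq_maxl//.
rewrite (@frac_polyE n _ q) ?leq_maxr// -big_split/=; apply: eq_bigr => j _.
by rewrite /term derivnD hornerD mulrDr !mulrDl.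
Qed.

Lemma frac_polyZ s c p t : frac_poly s (c *: p) t = c * frac_poly s p t.
Proof.
rewrite (frac_polyE (n := size p)) ?size_scale_leq// mulr_sumr; apply: eq_bigr => j _.
by rewrite /term derivnZ hornerZ !mulrA [c * _]mulrC.
Qed.

Lemma frac_polyB s p q t : frac_poly s (p - q) t = frac_poly s p t - frac_poly s q t.
Proof. by rewrite -scaleN1r frac_polyD frac_polyZ mulN1r. Qed.

Lemma frac_polyC s c t : frac_poly s c%:P t = c * ((1 - t) `^ s / G (s + 1)).
Proof.
rewrite (frac_polyE (n := 1)) ?size_polyC_leq1// big_ord1 /term derivn0 hornerC.
by rewrite expr0 mul1r add0r mulrA.
Qed.

Let jpos (j : nat) s : - 1 < s -> 0 < j%:R + s + 1.
Proof. by move=> s0; have : 0 <= j%:R :> R by []; lra. Qed.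

Let GSj (j : nat) s : - 1 < s -> G (j%:R + (s + 1) + 1) = (j%:R + s + 1) * G (j%:R + s + 1).
Proof. by move=> s1; rewrite -GS ?jpos// !addrA. Qed.

Lemma is_derive_powR_1B (a t : R) : t < 1 ->
  is_derive t 1 (fun t => (1 - t) `^ a) (- (a * (1 - t) `^ (a - 1))).
Proof.
move=> t1; have y0 : 0 < 1 - t by lra.
have h1 := is_derive1_powR a y0.
have h2 : is_derive t 1 (fun t : R => 1 - t) (- 1).
  by apply: is_derive_eq; rewrite /cst/=; ring.
by have := @is_derive1_comp _ (@powR R ^~ a) (fun t => 1 - t) t _ _ h1 h2;
  rewrite mulrN1.
Qed.

Lemma is_derive_frac_poly s p t : - 1 < s -> t < 1 ->
  is_derive t 1 (frac_poly (s + 1) p) (- frac_poly s p t).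
Proof.
move=> s1 t1; rewrite /frac_poly -sumrN.
have h (j : 'I_(size p)) : is_derive t 1 (fun t => term (s + 1) t p j) (- term s t p j).
  have d := @is_derive_powR_1B (j%:R + (s + 1)) t t1.
  pose c := (- 1) ^+ j * p^`(j).[1] / G (j%:R + (s + 1) + 1).
  rewrite (_ : (fun t => _) = c \*: (fun t => (1 - t) `^ (j%:R + (s + 1)))); last first.
    by apply/funext => y; rewrite /term /c /= -[_ *: _]/(_ * _); ring.
  apply: is_derive_eq; rewrite -[_ *: _]/(_ * _) /c /term GSj//.
  rewrite (_ : j%:R + (s + 1) - 1 = j%:R + s); last by ring.
  have j0 := jpos j s1; have g0 := G_neq0 j0.
  field; rewrite g0/=; apply: lt0r_neq0; lra.
have := @is_derive_sum _ _ _ _ (fun j : 'I_(size p) => fun t => term (s + 1) t p j) t 1 _ h.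
by rewrite fct_sumE.
Qed.

(** Term j for p' is minus term j + 1 for p; term 0 is the boundary value at 1 of an integration by
    parts. *)
Lemma frac_poly_deriv s p t :
  frac_poly (s + 1) p^`() t = - frac_poly s p t + p.[1] * ((1 - t) `^ s / G (s + 1)).
Proof.
have [/eqP|p0] := posnP (size p).
  rewrite size_poly_eq0 => /eqP ->.
  by rewrite deriv0 horner0 mul0r addr0 /frac_poly size_poly0 !big_ord0 oppr0.
rewrite (frac_polyE (n := (size p).-1)); last first.
  by apply/leq_sizeP => j pj; rewrite coef_deriv nth_default ?mul0rn// -(prednK p0).
rewrite (@frac_polyE (size p).-1.+1 s p t); last by rewrite prednK.
rewrite big_ord_recl.
rewrite {2}/term derivn0 expr0 mul1r add0r opprD addrAC -mulrA addNr add0r.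
rewrite -sumrN; apply: eq_bigr => j _; rewrite /term lift0 -derivSn exprS.
rewrite (_ : j.+1%:R + s = j%:R + (s + 1)); last by rewrite -natr1; ring.
ring.
Qed.

(** In terms of integrals this is the splitting y = t + (y - t) of the factor X; the part y - t
    raises the order by 1 and brings the factor s. *)
Lemma frac_polyXM s p t : - 1 < s -> t < 1 ->
  frac_poly s ('X * p) t = t * frac_poly s p t + s * frac_poly (s + 1) p t.
Proof.
move=> s1 t1; have y0 : 0 < 1 - t by lra.
rewrite (frac_polyE (n := (size p).+1)); last first.
  by rewrite mulrC (leq_trans (size_polyMleq _ _))// size_polyX addn2.
have -> : t * frac_poly s p t = frac_poly s p t - (1 - t) * frac_poly s p t by ring.
rewrite {1}(@frac_polyE (size p).+1 s p t)// !big_ord_recl -!addrA.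
congr (_ + _).
  by rewrite /term !derivn0 hornerM hornerX mul1r.
rewrite [in RHS]addrA; set T := \sum_(i < _) term s t p _.
have -> : \sum_(i < size p) term s t ('X * p) (lift ord0 i) =
  T - \sum_(j < size p) (- 1) ^+ j * j.+1%:R * p^`(j).[1] * (1 - t) `^ (j%:R + s + 1) /
     G (j%:R + (s + 1) + 1).
  rewrite /T -sumrB; apply: eq_bigr => j _; rewrite /term lift0 derivnXM.
  rewrite hornerD hornerM hornerX mul1r hornerZ exprS -[j.+1%:R]natr1.
  rewrite (_ : j%:R + 1 + s = j%:R + s + 1); last by ring.
  rewrite (_ : j%:R + s + 1 + 1 = j%:R + (s + 1) + 1); last by ring.
  ring.
rewrite -!addrA; congr (_ + _); rewrite /frac_poly !mulr_sumr -!sumrN -big_split/=.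
apply: eq_bigr => j _; rewrite /term GSj// addrA.
rewrite [(1 - t) `^ (j%:R + s + 1)]powRD_gt0// powRr1 ?(ltW y0)// -[j.+1%:R]natr1.
have j0 := jpos j s1; have g0 := G_neq0 j0.
field; rewrite g0/=; apply: lt0r_neq0; lra.
Qed.

End frac_poly.

(** * An algebraic inequality for Gamma quotients *)

Section ratio_inequality.
Context {F : realFieldType}.

Let ler_sqr_pos (a b : F) : 0 <= b -> a ^+ 2 <= b ^+ 2 -> a <= b.
Proof.
move=> b0 ab; have [a0|/ltW a0] := leP a 0; first exact: le_trans b0.
by rewrite -ler_sqr.
Qed.

(* [g, h, p, q] stand for the values of Gamma at [X], [X + 1/2], [Z], [Z + 1/2]. *)
Lemma Gamma_ratio_bounds (X Z g h p q : F) : 0 < X -> X + 1 <= Z ->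
  0 < g -> 0 < h -> 0 < p -> 0 < q ->
  h ^+ 2 <= X * g ^+ 2 -> q ^+ 2 <= Z * p ^+ 2 ->
  (X * g) ^+ 2 <= (X + 2^-1) * h ^+ 2 -> (Z - 2^-1) * p ^+ 2 <= q ^+ 2 ->
  ((X + Z) / 2 + 4^-1) * (h ^+ 2 / (Z * p) ^+ 2) <= g * h / (p * q) /\
  ((X + Z) / 2 + 4^-1) * ((X * g) ^+ 2 / ((X + 2^-1) * Z * q ^+ 2)) <= g * h / (p * q).
Proof.
move=> X0 XZ g0 h0 p0 q0 hg qp gh pq; set w := _ / 2 + _.
have w0 : 0 < w by rewrite /w; lra.
have wZ : w <= Z by rewrite /w; lra.
have Z0 : 0 < Z by lra.
have x0 : 0 < X + 2^-1 by lra.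
have [Xn gn hn pn qn] : [/\ 0 <= X, 0 <= g, 0 <= h, 0 <= p & 0 <= q] by split; exact: ltW.
have [wn Zn xn] : [/\ 0 <= w, 0 <= Z & 0 <= X + 2^-1] by split; exact: ltW.
have w2 : w ^+ 2 <= Z ^+ 2 by rewrite ler_sqr ?nnegrE.
have sq0 (a : F) : 0 <= a ^+ 2 by exact: sqr_ge0.
split.
  have h1 : h * q * w <= g * p * Z ^+ 2.
    apply: ler_sqr_pos; first by rewrite !mulr_ge0 ?sqr_ge0//.
    apply: (@le_trans _ _ (X * g ^+ 2 * (Z * p ^+ 2) * Z ^+ 2)).
      by rewrite !exprMn ler_pM ?mulr_ge0 ?sqr_ge0// ler_pM ?sqr_ge0.
    rewrite [leLHS](_ : _ = g ^+ 2 * p ^+ 2 * Z ^+ 3 * X); last by ring.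
    rewrite [leRHS](_ : _ = g ^+ 2 * p ^+ 2 * Z ^+ 3 * Z); last by ring.
    apply: ler_wpM2l; last by lra.
    by rewrite mulr_ge0 ?exprn_ge0// mulr_ge0 ?sqr_ge0.
  have e : g * h / (p * q) - w * (h ^+ 2 / (Z * p) ^+ 2) =
      h * (g * p * Z ^+ 2 - h * q * w) / (Z ^+ 2 * p ^+ 2 * q).
    by field; rewrite !gt_eqF.
  rewrite -subr_ge0 e divr_ge0//.
    by rewrite mulr_ge0 ?subr_ge0//.
  by rewrite !mulr_ge0 ?sqr_ge0//.
have h1 : X ^+ 2 * g * p * w <= h * q * (X + 2^-1) * Z.
  apply: ler_sqr_pos; first by rewrite !mulr_ge0//.
  have Zh : 0 < Z - 2^-1 by lra.
  rewrite -(ler_pM2l Zh).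
  apply: (@le_trans _ _ (X ^+ 2 * ((X + 2^-1) * h ^+ 2) * q ^+ 2 * Z ^+ 2)).
    rewrite [leLHS](_ : _ = X ^+ 2 * (X * g) ^+ 2 * ((Z - 2^-1) * p ^+ 2) * w ^+ 2); last by ring.
    rewrite ler_pM ?mulr_ge0 ?sqr_ge0 ?(ltW Zh)//.
    rewrite ler_pM ?mulr_ge0 ?sqr_ge0 ?(ltW Zh)//.
    by rewrite ler_wpM2l ?sqr_ge0.
  rewrite [leLHS](_ : _ = h ^+ 2 * q ^+ 2 * Z ^+ 2 * (X + 2^-1) * X ^+ 2); last by ring.
  rewrite [leRHS](_ : _ = h ^+ 2 * q ^+ 2 * Z ^+ 2 * (X + 2^-1) * ((X + 2^-1) * (Z - 2^-1))); last by ring.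
  apply: ler_wpM2l; first by rewrite !mulr_ge0 ?sqr_ge0//.
  by rewrite expr2; apply: ler_pM; lra.
have e : g * h / (p * q) - w * ((X * g) ^+ 2 / ((X + 2^-1) * Z * q ^+ 2)) =
    g * (h * q * (X + 2^-1) * Z - X ^+ 2 * g * p * w) / ((X + 2^-1) * Z * p * q ^+ 2).
  by field; rewrite !gt_eqF//; lra.
rewrite -subr_ge0 e divr_ge0//.
  by rewrite mulr_ge0 ?subr_ge0//.
by rewrite !mulr_ge0 ?sqr_ge0//.
Qed.

End ratio_inequality.

(** * Sonin's bound and the values at 0 *)

Section frac_legendre.
Context {R : realType}.
Implicit Types (n m : nat) (s t : R).

Variable G : R -> R.
Hypothesis G_gt0 : forall s, 0 < s -> 0 < G s.
Hypothesis GS : forall s, 0 < s -> G (s + 1) = s * G s.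
Hypothesis G1 : G 1 = 1.
Hypothesis GD_le : forall x s : R, 0 < x -> 0 <= s <= 1 -> G (x + s) <= x `^ s * G x.
Hypothesis Ghalf_le : forall x, 0 < x -> G (x + 2^-1) ^+ 2 <= x * G x ^+ 2.

Notation FP := (frac_poly G).
Notation L n := (legendre n : {poly R}).

Let G_neq0 s : 0 < s -> G s != 0.
Proof. by move=> /G_gt0 /lt0r_neq0. Qed.

Let powRS s t : t < 1 -> (1 - t) `^ (s + 1) = (1 - t) * (1 - t) `^ s.
Proof. by move=> t1; rewrite powRD_gt0 ?subr_gt0// powRr1 1?mulrC// subr_ge0 ltW. Qed.

(** A fractional integral of order s + 1 is applied to X P'_(n+1) - P'_n = (n+1) P_(n+1); the
    boundary terms cancel because all P_n equal 1 at 1. The next lemma treats P'_(n+1) = X P'_n +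
    (n+1) P_n in the same way. *)
Let frac_legendre_pred n s t : - 1 < s -> t < 1 ->
  (n.+1%:R + s + 1) * FP (s + 1) (L n.+1) t = - t * FP s (L n.+1) t + FP s (L n) t.
Proof.
move=> s1 t1; have s2 : - 1 < s + 1 by lra.
have := congr1 (fun p => FP (s + 1) p t) (@deriv_legendre_pred R n).
have := @legendre1 R n.+1; have := @legendre1 R n.
move: (legendre n) (legendre n.+1) => p q p1 q1.
rewrite frac_polyB frac_polyZ frac_polyXM// !frac_poly_deriv// p1 q1 !mul1r.
have g0 : G (s + 1) != 0 by apply: G_neq0; lra.
have s0 : s + 1 != 0 by rewrite gt_eqF//; lra.
rewrite [G (s + 1 + 1)]GS ?powRS//; last by lra.
move: (FP s p t) (FP s q t) (FP (s + 1) q t) ((1 - t) `^ s) => a b c d h.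
have -> : (n.+1%:R + s + 1) * c = n.+1%:R * c + (s + 1) * c by ring.
by rewrite -h; field; rewrite g0 s0.
Qed.

Let frac_legendre_succ n s t : - 1 < s -> t < 1 ->
  (n%:R - s) * FP (s + 1) (L n) t = t * FP s (L n) t - FP s (L n.+1) t.
Proof.
move=> s1 t1; have s2 : - 1 < s + 1 by lra.
have := congr1 (fun p => FP (s + 1) p t) (@deriv_legendreS R n).
have := @legendre1 R n.+1; have := @legendre1 R n.
move: (legendre n) (legendre n.+1) => p q p1 q1.
rewrite frac_polyD frac_polyZ frac_polyXM// !frac_poly_deriv// p1 q1 !mul1r.
have g0 : G (s + 1) != 0 by apply: G_neq0; lra.
have s0 : s + 1 != 0 by rewrite gt_eqF//; lra.
rewrite [G (s + 1 + 1)]GS ?powRS//; last by lra.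
rewrite -natr1.
move: (FP s p t) (FP s q t) (FP (s + 1) p t) ((1 - t) `^ s) => a b c d h.
have -> : b = - (- b + d / G (s + 1)) + d / G (s + 1) by ring.
by rewrite h; field; rewrite g0 s0.
Qed.

Variable mu : R.
Hypothesis mu_gt0 : 0 < mu.

Let Q n t := FP (mu + 1) (L n) t.

(** Legendre's equation integrated to order mu + 1. As Q' = -I^mu P_n and Q'' = I^(mu-1) P_n, it
    reads (1-t^2) Q'' + 2 mu t Q' + (n-mu)(n+mu+1) Q = 0. *)
Let frac_legendre_ode n t : t < 1 ->
  (1 - t ^+ 2) * FP (mu - 1) (L n) t - 2 * mu * t * FP mu (L n) t +
  (n%:R - mu) * (n%:R + mu + 1) * Q n t = 0.
Proof.
have mu0 := mu_gt0.
move=> t1; have m1 : - 1 < mu by lra. have m2 : - 1 < mu + 1 by lra.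
have := congr1 (fun p => FP (mu + 1) p t) (@legendre_ode R n).
have := @legendre1 R n; rewrite /Q; move: (legendre n) => p p1.
have w1 : (('X^2 - 1) * p^`()).[1] = 0.
  by rewrite hornerM (_ : ('X^2 - 1).[1] = 0) ?mul0r// !hornerE ?expr1n subrr.
rewrite frac_poly_deriv w1 mul0r addr0 frac_polyZ.
rewrite (_ : ('X^2 - 1) * p^`() = 'X * ('X * p^`()) - p^`()); last by ring.
rewrite frac_polyB !frac_polyXM// !frac_poly_deriv// p1.
have h0 : FP mu p^`() t = - FP (mu - 1) p t + (1 - t) `^ (mu - 1) / G mu.
  have := frac_poly_deriv G (mu - 1) p t; rewrite !(subrK 1) p1 mul1r; exact.
rewrite h0 [G (mu + 1 + 1)]GS; last by lra.
rewrite [G (mu + 1)]GS; last by lra.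
have ep : (1 - t) `^ mu = (1 - t) * (1 - t) `^ (mu - 1) by rewrite -powRS// subrK.
rewrite powRS// !ep.
have g0 : G mu != 0 by apply: G_neq0.
have s0 : mu + 1 != 0 by rewrite gt_eqF//; lra.
have s3 : mu != 0 by rewrite gt_eqF.
rewrite -natr1.
move: (FP (mu - 1) p t) (FP mu p t) (FP (mu + 1) p t) ((1 - t) `^ (mu - 1)) => a b c d h.
have -> : (n%:R - mu) * (n%:R + mu + 1) * c = n%:R * (n%:R + 1) * c - mu * (mu + 1) * c by ring.
by rewrite -h; field; rewrite g0 s0 s3.
Qed.

Let is_deriveQ n t : t < 1 -> is_derive t 1 (Q n) (- FP mu (L n) t).
Proof. by have mu0 := mu_gt0; move=> t1; apply: is_derive_frac_poly => //; lra. Qed.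

Let is_deriveQ1 n t : t < 1 -> is_derive t 1 (FP mu (L n)) (- FP (mu - 1) (L n) t).
Proof.
have mu0 := mu_gt0.
move=> t1; have := @is_derive_frac_poly R G G_gt0 GS (mu - 1) (legendre n) t.
by rewrite subrK; apply => //; lra.
Qed.

(* Sonin's function: its derivative has the sign of [- t], so it is maximal at 0. *)
Let S n t := Q n t ^+ 2 +
  (1 - t ^+ 2) * FP mu (L n) t ^+ 2 / ((n%:R - mu) * (n%:R + mu + 1)).

Let is_deriveS n t : mu < n%:R -> t < 1 -> is_derive t 1 (S n)
  (- (2 + 4 * mu) * t * FP mu (L n) t ^+ 2 / ((n%:R - mu) * (n%:R + mu + 1))).
Proof.
have mu0 := mu_gt0.
move=> mun t1; have d1 := is_deriveQ n t1; have d2 := is_deriveQ1 n t1.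
have ode := frac_legendre_ode n t1; rewrite /S.
move: d1 d2 ode; move: (Q n) (FP mu (L n)) (FP (mu - 1) (L n)) => q q1 q2 d1 d2 ode.
set c := (n%:R - mu) * (n%:R + mu + 1) in ode *.
have c0 : c != 0 by rewrite gt_eqF// mulr_gt0//; lra.
rewrite (_ : (fun t => _) = (fun t => q t * q t + c^-1 * ((1 - t * t) * (q1 t * q1 t)))); last first.
  by apply/funext => y; rewrite !expr2 mulrC; congr (_ + _); rewrite mulrC.
apply: is_derive_eq; rewrite /cst/= -?[_ *: _]/(_ * _).
have e : (1 - t ^+ 2) * q2 t = 2 * mu * t * q1 t - c * q t by lra.
transitivity (- 2 * q t * q1 t - 2 * t * q1 t ^+ 2 / c - 2 * q1 t * ((1 - t ^+ 2) * q2 t) / c).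
  by field.
by rewrite e; field.
Qed.

Let S_le0 n t : mu < n%:R -> -1 <= t -> t < 1 -> S n t <= S n 0.
Proof.
have mu0 := mu_gt0.
move=> mun t0 t1.
have c0 : 0 < (n%:R - mu) * (n%:R + mu + 1) by rewrite mulr_gt0//; lra.
have [tn|/ltW tp] := leP t 0.
  apply: (@is_derive_ge0_le R (S n) (fun t => - (2 + 4 * mu) * t * FP mu (L n) t ^+ 2 /
    ((n%:R - mu) * (n%:R + mu + 1)))) => // y /andP[y0 y1].
    by apply: is_deriveS => //; lra.
  rewrite divr_ge0 ?(ltW c0)// mulr_ge0 ?sqr_ge0// mulr_le0//; lra.
rewrite -lerN2.
apply: (@is_derive_ge0_le R (fun t => - S n t) (fun t => - (- (2 + 4 * mu) * t * FP mu (L n) t ^+ 2 /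
    ((n%:R - mu) * (n%:R + mu + 1))))) => // y /andP[y0 y1].
  have h : is_derive y 1 (S n) (- (2 + 4 * mu) * y * FP mu (L n) y ^+ 2 /
    ((n%:R - mu) * (n%:R + mu + 1))) by apply: is_deriveS => //; lra.
  exact: is_deriveN.
rewrite -!mulNr opprK divr_ge0 ?(ltW c0)// mulr_ge0 ?sqr_ge0// mulr_ge0//; lra.
Qed.

Let Q_sqr_le n t : mu < n%:R -> -1 <= t <= 1 -> Q n t ^+ 2 <= S n 0.
Proof.
have mu0 := mu_gt0.
move=> mun /andP[t0]; have c0 : 0 < (n%:R - mu) * (n%:R + mu + 1).
  by rewrite mulr_gt0//; lra.
(* The derivative of Sonin's function is available for t < 1 only; at t = 1 the function [Q n]
   vanishes. *)
rewrite le_eqVlt => /predU1P[->|t1].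
  have -> : Q n 1 = 0.
    rewrite /Q /frac_poly big1// => j _.
    rewrite subrr powR0 ?mulr0 ?mul0r// gt_eqF//.
    by have : 0 <= (j : nat)%:R :> R by []; lra.
  rewrite expr0n/= /S addr_ge0 ?sqr_ge0// divr_ge0 ?(ltW c0)// mulr_ge0 ?sqr_ge0//.
  by rewrite expr0n subr0.
apply: le_trans (S_le0 mun t0 t1); rewrite /S lerDl divr_ge0 ?(ltW c0)// mulr_ge0 ?sqr_ge0//.
by rewrite subr_ge0 expr2; nra.
Qed.

Let x n := Q n 0.

(** At t = 0 both contiguity relations lose a term, and they link the integral of order mu of
    P_(n+1) to [x n] and to [x n.+2]. *)
Let xSS n : (n%:R + mu + 3) * x n.+2 = (mu - n%:R) * x n.
Proof.
have mu0 := mu_gt0.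
have m1 : - 1 < mu by lra.
have := @frac_legendre_pred n.+1 mu 0 m1 ltr01; have := @frac_legendre_succ n mu 0 m1 ltr01.
rewrite -/(x n) -/(x n.+2) oppr0 !mul0r !add0r => e1 e2.
rewrite (_ : n%:R + mu + 3 = n.+2%:R + mu + 1); last by rewrite -[n.+2%:R]natr1 -[n.+1%:R]natr1; ring.
by rewrite e2 -[LHS]opprK -e1 -[FP (mu + 1) (L n) 0]/(x n); ring.
Qed.

Let x0 : x 0 = (G (mu + 2))^-1.
Proof.
have mu0 := mu_gt0.
by rewrite /x /Q legendre0 frac_polyC subr0 powR1 !mul1r; congr (G _)^-1; ring.
Qed.

Let x1 : (mu + 2) * x 1 = (G (mu + 1))^-1.
Proof.
have mu0 := mu_gt0.
have m1 : - 1 < mu by lra.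
have := @frac_legendre_pred 0 mu 0 m1 ltr01.
rewrite oppr0 mul0r add0r legendre0 frac_polyC subr0 powR1 !mul1r => <-.
by rewrite -[FP (mu + 1) (L 1) 0]/(x 1); congr (_ * _); ring.
Qed.

(** [xSS] iterated along the indices of parity [e]; the denominators of the recurrence assemble into
    a quotient of Gamma values. *)
Let chain (e : bool) m : x (m.*2 + e) * G (m%:R + (mu + e%:R + 3) / 2) =
  x e * G ((mu + e%:R + 3) / 2) * \prod_(j < m) ((mu - e%:R) / 2 - j%:R).
Proof.
have mu0 := mu_gt0.
have e0 : 0 <= e%:R :> R by [].
elim: m => [|m IH]; first by rewrite big_ord0 mulr1 add0r.
rewrite big_ord_recr/= mulrA -IH.
rewrite (_ : m.+1%:R + _ = m%:R + (mu + e%:R + 3) / 2 + 1); last by rewrite -natr1; ring.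
have m0 : 0 <= m%:R :> R by [].
rewrite GS; last by rewrite addrC ltr_wpDr// divr_gt0//; lra.
have := xSS (m.*2 + e); rewrite doubleS !addSn natrD -mul2n natrM => h.
set y := x _.+2 in h *.
have -> : y * ((m%:R + (mu + e%:R + 3) / 2) * G (m%:R + (mu + e%:R + 3) / 2)) =
  (2 * m%:R + e%:R + mu + 3) * y / 2 * G (m%:R + (mu + e%:R + 3) / 2) by field.
by rewrite h mul2n; field.
Qed.

(** The duplication formula and Gamma(1/2)^2 = pi give both starting values the same normalised
    size, so even and odd indices end up in one formula. *)
Let amp_base (e : bool) :
  4 `^ (mu + 1) * (x e * G ((mu + e%:R + 3) / 2) * G (1 + (mu - e%:R) / 2)) ^+ 2 = pi.
Proof.
have mu0 := mu_gt0.
rewrite -(Gamma_like_half G_gt0 GS G1 GD_le).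
have c0 : 0 < 4 :> R by [].
set c : R := 4 in c0 *.
case: e; rewrite /= ?mulr1n ?mulr0n.
  have z0 : 0 < (mu + 1) / 2 by rewrite divr_gt0//; lra.
  have := Gamma_like_duplication G_gt0 GS G1 GD_le z0; rewrite -/c.
  rewrite (_ : (mu + 1) / 2 + 2^-1 = (mu + 2) / 2); last by field.
  rewrite (_ : 2 * ((mu + 1) / 2) = mu + 1); last by field.
  rewrite (_ : (mu + 1 + 3) / 2 = (mu + 2) / 2 + 1); last by field.
  rewrite (_ : 1 + (mu - 1) / 2 = (mu + 1) / 2); last by field.
  rewrite [G ((mu + 2) / 2 + 1)]GS; last by rewrite divr_gt0//; lra.
  rewrite (_ : c `^ (mu + 1) = c `^ ((mu + 1) / 2) ^+ 2); last first.
    by rewrite expr2 -powRD_gt0//; congr (_ `^ _); field.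
  have g0 : G (mu + 1) != 0 by apply: G_neq0; lra.
  have m2 : mu + 2 != 0 by rewrite gt_eqF//; lra.
  have -> : x 1 = (G (mu + 1))^-1 / (mu + 2) by rewrite -x1; field.
  move=> h; rewrite -exprMn; congr (_ ^+ 2).
  transitivity ((c `^ ((mu + 1) / 2) * (G ((mu + 1) / 2) * G ((mu + 2) / 2))) / (2 * G (mu + 1))).
    by field; rewrite g0 m2.
  by rewrite h; field.
have z0 : 0 < (mu + 2) / 2 by rewrite divr_gt0//; lra.
have := Gamma_like_duplication G_gt0 GS G1 GD_le z0; rewrite -/c.
rewrite (_ : (mu + 2) / 2 + 2^-1 = (mu + 3) / 2); last by field.
rewrite (_ : 2 * ((mu + 2) / 2) = mu + 2); last by field.
rewrite addr0 subr0 (_ : 1 + mu / 2 = (mu + 2) / 2); last by field.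
have g0 : G (mu + 2) != 0 by apply: G_neq0; lra.
rewrite x0 => h.
have ce : c `^ ((mu + 2) / 2) ^+ 2 = c `^ (mu + 1) * 4.
  rewrite expr2 -powRD_gt0// (_ : (mu + 2) / 2 + (mu + 2) / 2 = mu + 1 + 1); last by field.
  by rewrite powRD_gt0// powRr1 ?(ltW c0).
have -> : c `^ (mu + 1) = (c `^ ((mu + 2) / 2) / 2) ^+ 2 by rewrite exprMn ce; field.
rewrite -exprMn; congr (_ ^+ 2).
transitivity ((c `^ ((mu + 2) / 2) * (G ((mu + 2) / 2) * G ((mu + 3) / 2))) / (2 * G (mu + 2))).
  by field.
by rewrite h; field.
Qed.

Let sin_sqr_reflect m (y : R) : sin (pi * (m%:R - y)) ^+ 2 = sin (pi * y) ^+ 2.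
Proof.
have mu0 := mu_gt0.
elim: m => [|m IH]; first by rewrite sub0r mulrN sinN sqrrN.
rewrite -IH (_ : pi * (m.+1%:R - y) = pi * (m%:R - y) + pi); last by rewrite -natr1; ring.
by rewrite sinDpi sqrrN.
Qed.

(** In the product left by [chain] the reflection formula produces the sine; squaring removes the
    sign, which depends on n. *)
Let amplitude n : mu < n%:R ->
  pi * 4 `^ (mu + 1) * (x n * G ((n%:R + mu + 3) / 2)) ^+ 2 =
  (sin (pi * ((n%:R - mu) / 2)) * G ((n%:R - mu) / 2)) ^+ 2.
Proof.
have mu0 := mu_gt0.
set e := odd n; set m := n./2 => mun.
have nE : n = (m.*2 + e)%N by rewrite addnC odd_double_half.
have nR : n%:R = 2 * m%:R + e%:R :> R by rewrite {1}nE natrD -mul2n natrM.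
have [e0 e1] : 0 <= (e%:R : R) /\ (e%:R : R) <= 1 by rewrite ler0n lern1; case: (e).
have s1 : - 1 < (mu - e%:R) / 2 by lra.
have s2 : (mu - e%:R) / 2 < m%:R by rewrite nR in mun; lra.
have := Gamma_like_reflection G_gt0 GS G1 GD_le s1 s2.
have := amp_base e; have := chain e m.
rewrite -nE (_ : (n%:R + mu + 3) / 2 = m%:R + (mu + e%:R + 3) / 2); last by rewrite nR; field.
rewrite (_ : (n%:R - mu) / 2 = m%:R - (mu - e%:R) / 2); last by rewrite nR; field.
set s := (mu - e%:R) / 2 in s1 s2 *; set a := (mu + e%:R + 3) / 2.
move=> -> h1 h2; rewrite exprMn [in RHS]exprMn sin_sqr_reflect.
rewrite (_ : (\prod_(j < m) (s - j%:R)) ^+ 2 = (\prod_(j < m) (j%:R - s)) ^+ 2); last first.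
  by rewrite -!prodrXl; apply: eq_bigr => j _; rewrite -sqrrN opprB.
move: h1 h2; have := lt0r_neq0 (@pi_gt0 R).
move: (\prod_(j < m) _) (sin _) (G (m%:R - s)) (G (1 + s)) (x e * G a) (4 `^ (mu + 1)).
move: (@pi R) => Pi P sn g1 g2 y c Pi0 h1 h2.
have -> : P = - (g1 * g2 * sn) / Pi by rewrite h2; field.
rewrite -{1}h1; transitivity (c * (y * g2) ^+ 2 * c * y ^+ 2 * g2 ^+ 2 * g1 ^+ 2 * sn ^+ 2 / Pi ^+ 2).
  by field.
have -> : c * (y * g2) ^+ 2 * c * y ^+ 2 * g2 ^+ 2 * g1 ^+ 2 * sn ^+ 2 / Pi ^+ 2 =
  (c * (y * g2) ^+ 2) ^+ 2 * g1 ^+ 2 * sn ^+ 2 / Pi ^+ 2 by ring.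
by rewrite h1; field.
Qed.

(** At 0 the derivative of [Q n] is a multiple of [x n.-1], so Sonin's function there combines the
    squares of two consecutive [x]. By [amplitude] these carry cos(pi X)^2 and sin(pi X)^2 with X =
    (n - mu - 1)/2, and the bound is a convex combination of those in [Gamma_ratio_bounds]. *)
Lemma frac_legendre_sqr_le n t : mu + 1 < n%:R -> -1 <= t <= 1 ->
  (2 * n%:R + 1) / 2 * frac_poly G (mu + 1) (legendre n) t ^+ 2 <=
  2 / pi * (G (n%:R - mu - 1) / G (n%:R + mu + 1)).
Proof.
have mu0 := mu_gt0.
case: n => [|k] mun t1; first by lra.
have mun1 : mu < k.+1%:R by lra.
have munk : mu < k%:R by rewrite -natr1 in mun; lra.
apply: (@le_trans _ _ ((2 * k.+1%:R + 1) / 2 * S k.+1 0)).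
  apply: ler_wpM2l; last exact: Q_sqr_le.
  by rewrite divr_ge0// addr_ge0// mulr_ge0.
have m1 : - 1 < mu by lra.
have e1 : FP mu (L k.+1) 0 = - (k%:R - mu) * x k.
  by have := @frac_legendre_succ k mu 0 m1 ltr01; rewrite mul0r add0r -[FP (mu + 1) (L k) 0]/(x k) => h; lra.
rewrite /S -/(x k.+1) e1 expr0n subr0 mul1r.
have aN := amplitude mun1; have ak := amplitude munk.
(* X + Z = n and Z - X = mu + 1; duplication at X and at Z turns the four Gamma values into
   Gamma(2X) / Gamma(2Z), and the powers of 4 cancel against that in [amplitude]. *)
pose X := (k.+1%:R - mu - 1) / 2; pose Z := (k.+1%:R + mu + 1) / 2.
have kE : k.+1%:R = k%:R + 1 :> R by rewrite natr1.
have X0 : 0 < X by rewrite /X; lra.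
have XZ : X + 1 <= Z by rewrite /X /Z; lra.
have Z0 : 0 < Z by lra.
have Zh0 : 0 < Z - 2^-1 by lra.
rewrite (_ : (k.+1%:R + mu + 3) / 2 = Z + 1) in aN; last by rewrite /Z; field.
rewrite (_ : (k.+1%:R - mu) / 2 = X + 2^-1) in aN; last by rewrite /X; field.
rewrite (_ : (k%:R + mu + 3) / 2 = Z + 2^-1) in ak; last by rewrite /Z kE; field.
rewrite (_ : (k%:R - mu) / 2 = X) in ak; last by rewrite /X kE; field.
have sc : sin (pi * (X + 2^-1)) ^+ 2 = 1 - sin (pi * X) ^+ 2.
  by rewrite mulrDr sinDpihalf cos2sin2.
have gX := Ghalf_le X0; have gZ := Ghalf_le Z0.
have gX2 : (X * G X) ^+ 2 <= (X + 2^-1) * G (X + 2^-1) ^+ 2.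
  rewrite -GS// (_ : X + 1 = X + 2^-1 + 2^-1); last by field.
  by apply: Ghalf_le; lra.
have gZ2 : (Z - 2^-1) * G Z ^+ 2 <= G (Z + 2^-1) ^+ 2.
  rewrite (_ : Z + 2^-1 = Z - 2^-1 + 1); last by field.
  rewrite GS// exprMn expr2 -mulrA ler_pM2l//.
  by have := Ghalf_le Zh0; rewrite subrK.
have Xh0 : 0 < X + 2^-1 by lra.
have Zh1 : 0 < Z + 2^-1 by lra.
have [b1 b2] := Gamma_ratio_bounds X0 XZ (G_gt0 X0) (G_gt0 Xh0) (G_gt0 Z0) (G_gt0 Zh1)
  gX gZ gX2 gZ2.
have dX := Gamma_like_duplication G_gt0 GS G1 GD_le X0.
have dZ := Gamma_like_duplication G_gt0 GS G1 GD_le Z0.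
have c0 : 0 < 4 `^ (mu + 1) :> R by exact: powR_gt0.
have cX0 : 0 < 4 `^ X :> R by exact: powR_gt0.
have cZ : 4 `^ Z = 4 `^ X * 4 `^ (mu + 1) :> R.
  by rewrite -powRD_gt0//; congr (_ `^ _); rewrite /X /Z kE; field.
rewrite cZ in dZ.
have Gh0 : 0 < G 2^-1 by apply: G_gt0.
have -> : k.+1%:R - mu - 1 = 2 * X by rewrite /X; field.
have -> : k.+1%:R + mu + 1 = 2 * Z by rewrite /Z; field.
have -> : k.+1%:R - mu = 2 * (X + 2^-1) by rewrite /X; field.
have -> : k%:R - mu = 2 * X by rewrite /X kE; field.
have -> : (2 * k.+1%:R + 1) / 2 = 2 * ((X + Z) / 2 + 4^-1) by rewrite /X /Z; field.
have G2X0 : 0 < G (2 * X) by apply: G_gt0; lra.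
have G2Z0 : 0 < G (2 * Z) by apply: G_gt0; lra.
rewrite GS// in aN; rewrite exprMn in aN; rewrite [in RHS]exprMn sc in aN.
rewrite exprMn in ak; rewrite [in RHS]exprMn in ak.
have s01 : 0 <= sin (pi * X) ^+ 2 <= 1.
  by rewrite sqr_ge0/= sin2cos2 lerBlDr lerDl sqr_ge0.
have pi0 := @pi_gt0 R.
move: b1 b2 dX dZ c0 cX0 Gh0 G2X0 G2Z0 aN ak s01 pi0 (G_gt0 X0) (G_gt0 Xh0) (G_gt0 Z0) (G_gt0 Zh1).
move: (x k.+1) (x k) (sin (pi * X) ^+ 2) (G X) (G (X + 2^-1)) (G Z) (G (Z + 2^-1)) (G (2 * X)) (G (2 * Z)).
move: (4 `^ (mu + 1)) (4 `^ X) (G 2^-1); move: (@pi R) => Pi c cX r xn xk s2 g h p q g2 p2.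
set w := _ / 2 + _.
move=> b1 b2 dX dZ c0 cX0 r0 g20 p20 aN ak /andP[s20 s21] Pi0 g0 h0 p0 q0.
have D : g2 / p2 = g * h / (p * q) / c.
  have -> : g2 = cX * (g * h) / (2 * r) by rewrite dX; field; rewrite gt_eqF.
  have -> : p2 = cX * c * (p * q) / (2 * r) by rewrite dZ; field; rewrite gt_eqF.
  by field; rewrite !gt_eqF.
have uE : xn ^+ 2 = (1 - s2) * (h ^+ 2 / (Z * p) ^+ 2) / (Pi * c).
  rewrite (_ : xn ^+ 2 = Pi * c * (xn ^+ 2 * (Z * p) ^+ 2) / (Pi * c * (Z * p) ^+ 2)); last first.
    by field; rewrite !gt_eqF.
  by rewrite aN; field; rewrite !gt_eqF.
have vE : xk ^+ 2 = s2 * (g ^+ 2 / q ^+ 2) / (Pi * c).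
  rewrite (_ : xk ^+ 2 = Pi * c * (xk ^+ 2 * q ^+ 2) / (Pi * c * q ^+ 2)); last first.
    by field; rewrite !gt_eqF.
  by rewrite ak; field; rewrite !gt_eqF.
rewrite D [leLHS](_ : _ = 2 / (Pi * c) * ((1 - s2) * (w * (h ^+ 2 / (Z * p) ^+ 2)) +
  s2 * (w * ((X * g) ^+ 2 / ((X + 2^-1) * Z * q ^+ 2))))); last first.
  rewrite exprMn sqrrN exprMn vE uE; field.
  by rewrite !gt_eqF//; lra.
rewrite [leRHS](_ : _ = 2 / (Pi * c) * (g * h / (p * q))); last by field; rewrite !gt_eqF.
have k0 : 0 <= 2 / (Pi * c) by rewrite divr_ge0// ltW// mulr_gt0.
apply: ler_wpM2l => //.
rewrite (_ : g * h / (p * q) = (1 - s2) * (g * h / (p * q)) + s2 * (g * h / (p * q))); last by ring.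
by apply: lerD; apply: ler_wpM2l => //; lra.
Qed.

End frac_legendre.

(** * Absolute continuity and bounded variation *)

Section abs_continuous_variation.
Context {R : realType}.
Implicit Types (a b c d e : R) (f : R -> R) (p q : R * R) (l s : seq R) (L M : seq (R * R)).

Definition separated p q : bool := (p.2 <= q.1) || (q.2 <= p.1).

(* [disjoint_itvs a b L] : [L] lists the end points of non-overlapping
   subintervals of [a, b]. *)
Definition disjoint_itvs a b L : bool :=
  all (fun p => [&& a <= p.1, p.1 <= p.2 & p.2 <= b]) L && pairwise separated L.

Definition total_length L : R := \sum_(p <- L) (p.2 - p.1).

(** Lists of intervals can be concatenated and refined, and the weak inequality passes to suprema;
    both serve to go from increments to variations. *)
Lemma abs_continuous_list a b f e : abs_continuous a b f -> 0 < e ->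
  exists2 d, 0 < d & forall L, disjoint_itvs a b L -> total_length L < d ->
    \sum_(p <- L) `|f p.2 - f p.1| <= e.
Proof.
move=> fac e0; have [d d0 H] := fac e e0; exists d => // L /andP[/allP Lab Lsep].
rewrite /total_length !(big_nth (0, 0)) !big_mkord => Ld; apply/ltW/H => //.
  by move=> i; have := Lab (nth (0, 0) L i); rewrite mem_nth// => /(_ isT)/and3P[].
suff sep (i j : 'I_(size L)) : (i < j)%N ->
    ~ (`](nth (0, 0) L i).1, (nth (0, 0) L i).2[%classic `&`
       `](nth (0, 0) L j).1, (nth (0, 0) L j).2[%classic !=set0).
  move=> i j _ _ ij; have [h|h|h] := ltngtP (val i) (val j).
  - by case: (sep i j h).
  - by case: (sep j i h); rewrite setIC.
  - exact: val_inj.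
move=> ij [z [/=]]; rewrite !in_itv/= => /andP[z1 z2] /andP[z3 z4].
have /(pairwiseP (0, 0)) h := Lsep.
have := h _ _ (ltn_ord i) (ltn_ord j) ij; rewrite /separated => /orP[] hh.
  by have := lt_le_trans z2 (le_trans hh (ltW z3)); rewrite ltxx.
by have := lt_le_trans z4 (le_trans hh (ltW z1)); rewrite ltxx.
Qed.

Let zip_partition c d f s : itv_partition c d s ->
  [/\ all (fun p => [&& c <= p.1, p.1 <= p.2 & p.2 <= d]) (zip (c :: s) s),
     pairwise separated (zip (c :: s) s), total_length (zip (c :: s) s) = d - c &
     \sum_(p <- zip (c :: s) s) `|f p.2 - f p.1| = variation c d f s].
Proof.
move=> cds; have vE := variation_zip f cds.
suff [h1 h2 h3 h4] : [/\ all (fun p => [&& c <= p.1, p.1 <= p.2 & p.2 <= d]) (zip (c :: s) s),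
     pairwise separated (zip (c :: s) s), total_length (zip (c :: s) s) = d - c &
     \sum_(p <- zip (c :: s) s) `|f p.2 - f p.1| =
     \sum_(x <- zip s (c :: s)) `|f x.1 - f x.2|] by split => //; rewrite h4 vE.
rewrite /total_length {vE}; elim: s c cds => [|h t IH] c cds.
  by rewrite (itv_partition_nil cds) !big_nil subrr.
have hdt := itv_partition_cons cds; have hd := itv_partition_le hdt.
have ch : c <= h by case: cds => /= /andP[/ltW].
have [h1 h2 h3 h4] := IH _ hdt.
have -> : zip (c :: h :: t) (h :: t) = (c, h) :: zip (h :: t) t by [].
have -> : zip (h :: t) (c :: h :: t) = (h, c) :: zip t (h :: t) by [].
move: h1 h2 h3 h4; move: (zip (h :: t) t) (zip t (h :: t)) => A B h1 h2 h3 h4.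
rewrite !big_cons h3 h4; split.
- rewrite /= lexx ch hd/=.
  by apply/allP => p /(allP h1) /and3P[p1 -> ->]; rewrite (le_trans ch p1).
- rewrite /= h2 andbT.
  by apply/allP => p /(allP h1) /and3P[p1 _ _]; rewrite /separated /= p1.
- by rewrite /=; ring.
- by [].
Qed.

(** The variation is at most 1 on every subinterval shorter than the [d] belonging to the bound 1,
    and finitely many such subintervals cover [a, b]. *)
Lemma abs_continuous_bounded_variation a b f : a < b -> abs_continuous a b f ->
  bounded_variation a b f.
Proof.
move=> ab fac; have [d d0 H] := abs_continuous_list fac ltr01.
have small x y : a <= x -> x <= y -> y <= b -> y - x < d ->
    total_variation x y f \is a fin_num.
  move=> ax xy yb xyd; rewrite ge0_fin_numE ?total_variation_ge0//.
  apply: (@le_lt_trans _ _ 1%E); last exact: ltry.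
  apply: ge_ereal_sup => _ [_ [s sxy <-] <-]; rewrite lee_fin.
  have [h1 h2 h3 <-] := zip_partition f sxy.
  apply: H; last by rewrite h3.
  rewrite /disjoint_itvs h2 andbT; apply/allP => p /(allP h1) /and3P[p1 -> p2].
  by rewrite (le_trans ax p1) (le_trans p2 yb).
pose n := Num.truncn ((b - a) / d); pose D := (b - a) / n.+1%:R.
have D0 : 0 < D by rewrite divr_gt0 ?subr_gt0.
have Dd : D < d.
  by rewrite ltr_pdivrMr// mulrC -ltr_pdivrMr// truncnS_gt.
pose X i := a + i%:R * D.
have Xn : X n.+1 = b by rewrite /X /D mulrC divfK// addrC subrK.
have X0 : X 0%N = a by rewrite /X mul0r addr0.
have XS i : X i.+1 = X i + D by rewrite /X -natr1 mulrDl mul1r addrA.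
have Xm i j : (i <= j)%N -> X i <= X j.
  by move=> ij; rewrite lerD2l ler_wpM2r ?ler_nat// ltW.
have Xa i : a <= X i by rewrite -{1}X0 Xm.
apply/bounded_variationP; first exact: ltW.
suff main i : (i <= n.+1)%N -> total_variation a (X i) f \is a fin_num.
  by rewrite -Xn; exact: main.
elim: i => [_|i IH ni]; first by rewrite X0 total_variationxx.
rewrite (total_variationD f (Xa i) (Xm _ _ (leqnSn i))) fin_numD (IH (ltnW ni)) andTb.
apply: small => //; [exact: Xm|by rewrite -Xn Xm|].
by rewrite XS addrAC subrr add0r.
Qed.

Let sub_bounded_variation a b x y f : bounded_variation a b f ->
  a <= x -> x <= y -> y <= b -> bounded_variation x y f.
Proof.
move=> bv ax xy yb; apply: (bounded_variationl xy yb).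
by apply: (bounded_variationr ax (le_trans xy yb)).
Qed.

Let separatedC p q : separated p q = separated q p.
Proof. by rewrite /separated orbC. Qed.

Let separated_sub p q q' : q.1 <= q'.1 -> q'.2 <= q.2 -> separated p q -> separated p q'.
Proof.
move=> h1 h2 /orP[h|h]; rewrite /separated; first by rewrite (le_trans h h1).
by rewrite (le_trans h2 h) orbT.
Qed.

(* The variation of an absolutely continuous function is absolutely continuous:
   the intervals of [L] are refined one after the other. *)
Lemma abs_continuous_total_variation a b f e : a < b -> abs_continuous a b f -> 0 < e ->
  exists2 d, 0 < d & forall L, disjoint_itvs a b L -> total_length L < d ->
    \sum_(p <- L) fine (total_variation p.1 p.2 f) <= e.
Proof.
move=> ab fac e0; have [d d0 H] := abs_continuous_list fac e0; exists d => // L.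
have bv := abs_continuous_bounded_variation ab fac.
suff main M : disjoint_itvs a b (M ++ L) -> total_length (M ++ L) < d ->
    \sum_(p <- M) `|f p.2 - f p.1| + \sum_(p <- L) fine (total_variation p.1 p.2 f) <= e.
  by move=> dL Ld; have := main [::] dL Ld; rewrite big_nil add0r.
elim: L M => [|p L IH] M; first by rewrite cats0 big_nil addr0; exact: H.
rewrite /disjoint_itvs all_cat pairwise_cat => /andP[/andP[aM]].
rewrite [all _ (p :: L)]/= => /andP[/and3P[ap pp pb] aL] /and3P[/allrelP rML pM].
rewrite [pairwise _ (p :: L)]/= => /andP[/allP rpL pL] len.
set B := \sum_(q <- L) fine (total_variation q.1 q.2 f) in IH *.
set A := \sum_(q <- M) _.
rewrite big_cons -/B -lerBrDl -lerBrDr.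
rewrite -lee_fin fineK; last first.
  by apply/bounded_variationP => //; apply: (sub_bounded_variation bv).
apply: ge_ereal_sup => _ [_ [s sp <-] <-]; rewrite lee_fin.
have [h1 h2 h3 <-] := zip_partition f sp; move: h1 h2 h3.
move: (zip _ _) => Z /allP h1 h2 h3; rewrite lerBrDr lerBrDl addrA.
have := IH (M ++ Z); rewrite big_cat; apply.
  rewrite /disjoint_itvs !all_cat aM aL andbT/=; apply/andP; split.
    apply/allP => q /h1 /and3P[q1 -> q2].
    by rewrite (le_trans ap q1) (le_trans q2 pb).
  rewrite !pairwise_cat pM h2 pL !andbT/=; apply/andP; split.
    apply/allrelP => x q; rewrite mem_cat => /orP[xM|xZ] qL.
      by apply: rML => //; rewrite inE qL orbT.
    have /and3P[x1 _ x2] := h1 _ xZ.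
    by rewrite separatedC; apply: (separated_sub x1 x2); rewrite separatedC; exact: rpL.
  apply/allrelP => x q xM qZ; have /and3P[q1 _ q2] := h1 _ qZ.
  by apply: (separated_sub q1 q2); apply: rML => //; rewrite inE eqxx.
move: len; rewrite /total_length !big_cat/= big_cons -h3 /total_length.
by rewrite addrA.
Qed.

End abs_continuous_variation.

(** * Densities of monotone absolutely continuous functions *)

Section Stieltjes_density.
Context {R : realType}.
Notation mu := (@lebesgue_measure R).
Variables (a b : R) (F : R -> R).
Hypothesis ab : a < b.
Hypothesis Fnd : {homo F : x y / x <= y}.
(** Projection onto [a, b]. By [Fcl] the function [F] is constant on either side of [a, b], so it is
    a cumulative function on the whole line. *)
Let cl (x : R) : R := Num.max a (Num.min b x).
Hypothesis Fcl : forall x, F (Num.max a (Num.min b x)) = F x.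
Hypothesis Fac : forall e, 0 < e -> exists2 d, 0 < d &
  forall L, disjoint_itvs a b L -> total_length L < d ->
    \sum_(p <- L) (F p.2 - F p.1) <= e.

Let clP x : a <= cl x <= b.
Proof. by rewrite /cl le_max lexx/= ge_max (ltW ab) ge_min lexx. Qed.

Let cl_homo x y : x <= y -> cl x <= cl y.
Proof.
move=> xy; rewrite /cl ge_max le_max lexx/= le_max; apply/orP; right.
by rewrite le_min ge_min lexx/= ge_min xy orbT.
Qed.

Let cl_len x y : x <= y -> cl y - cl x <= y - x.
Proof.
move=> xy; rewrite /cl /Num.max /Num.min.
by do 4 case: ifPn => //; rewrite -?leNgt; lra.
Qed.

Let F_rc : right_continuous F.
Proof.
move=> x; apply/cvgrPdist_le => /= e e0; have [d d0 H] := Fac e0.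
near=> y; have xy : x <= y by near: y; exact: nbhs_right_ge.
rewrite distrC ger0_norm ?subr_ge0 ?Fnd//.
have := H [:: (cl x, cl y)]; rewrite /disjoint_itvs /total_length !big_seq1 /=.
rewrite cl_homo//= !Fcl andbT.
have /andP[-> _] := clP x; have /andP[_ ->] := clP y; apply => //.
apply: le_lt_trans (cl_len xy) _; rewrite ltrBlDl.
by near: y; apply: nbhs_right_lt; rewrite ltrDl.
Unshelve. all: by end_near. Qed.

Let Fc : cumulative R R := HB.pack F (isCumulative.Build R _ R F Fnd F_rc).

Local Notation nu := (lebesgue_stieltjes_measure Fc).

Let nu_oc x y : x <= y -> nu `]x, y]%classic = (F y - F x)%:E.
Proof.
move=> xy; rewrite /lebesgue_stieltjes_measure /measure_extension.
rewrite measurable_mu_extE/=; last exact: is_ocitv.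
by rewrite wlength_itv_bnd.
Qed.

(** A window around [a, b] that makes the measure finite; all the mass is inside, as [F] is constant
    outside [a, b]. *)
Let D : set (measurableTypeR R) := `]a - 1, b + 1]%classic.

Let mD : measurable D. Proof. exact: measurable_itv. Qed.

Let nuD : (nu D < +oo)%E.
Proof. by rewrite nu_oc ?ltry//; have := ab; lra. Qed.

Let nu' : {finite_measure set (measurableTypeR R) -> \bar R} := mfrestr mD nuD.

(** Openness of [I] and of the left end of [D] keeps the infimum out of the intersection, while its
    supremum may be b + 1 and attained: hence the half-open upper bound. The empty case is coded by
    the degenerate pair (a, a). *)
Let le_itv (I : set R) : is_interval I -> open I -> exists p : R * R,
  [/\ p.1 <= p.2, `]p.1, p.2[ `<=` I `&` D & I `&` D `<=` `]p.1, p.2]] /\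
  ((I `&` D = set0 /\ p = (a, a)) \/ [/\ I `&` D !=set0, p.1 = inf (I `&` D) & p.2 = sup (I `&` D)]).
Proof.
move=> Ii Io; have [J0|] := eqVneq (I `&` D) set0.
  exists (a, a); split; last by left.
  by rewrite J0 /= set_itvoo0; split => //; exact: sub0set.
move=> /set0P J0; set J := I `&` D in J0 *.
have Ji : is_interval J.
  move=> x y [xI xD] [yI yD] z /andP[xz zy]; split.
    by apply: (Ii x y) => //; rewrite xz.
  move: xD yD; rewrite /D/= !in_itv/= => /andP[x1 x2] /andP[y1 y2].
  by rewrite (lt_le_trans x1 xz) (le_trans zy y2).
have Jub : has_ubound J.
  by exists (b + 1) => x [_]; rewrite /D/= in_itv/= => /andP[].
have Jlb : has_lbound J.
  by exists (a - 1) => x [_]; rewrite /D/= in_itv/= => /andP[/ltW].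
exists (inf J, sup J); split; last by right.
split => /=.
- have [x xJ] := J0; apply: (@le_trans _ _ x); first exact: ge_inf.
  exact: ub_le_sup.
- move=> x /=; rewrite in_itv/= => /andP[ix xs].
  have [y yJ yx] := inf_lt J0 ix; have [z zJ xz] := sup_gt J0 xs.
  by apply: (Ji y z) => //; rewrite (ltW yx) (ltW xz).
- move=> x xJ; rewrite /= in_itv/= (ub_le_sup Jub xJ) andbT.
  rewrite lt_neqAle (ge_inf Jlb xJ) andbT; apply/eqP => xE.
  have [xI xD] := xJ; have := Io x xI; rewrite nbhs_ballP => -[/= r r0 rI].
  move: xD; rewrite /D/= in_itv/= => /andP[x1 x2].
  pose m := Num.min (r / 2) ((x - (a - 1)) / 2).
  have m0 : 0 < m by rewrite /m lt_min !divr_gt0// subr_gt0.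
  have mr : m <= r / 2 by rewrite /m ge_min lexx.
  have mx : m <= (x - (a - 1)) / 2 by rewrite /m ge_min lexx orbT.
  have : J (x - m).
    split; last by rewrite /D/= in_itv/=; lra.
    by apply: rI; rewrite /ball/= opprB addrC subrK gtr0_norm//; lra.
  by move=> /(ge_inf Jlb); rewrite xE; lra.
Qed.

(** A null set has an open neighbourhood of length below [d]. Any finitely many of its components,
    projected onto [a, b], have total length below [d], so absolute continuity bounds the increments
    of [F] over them by [e], and countable subadditivity concludes. *)
Let nu_dominated : nu' `<< mu.
Proof.
apply/null_content_dominatesP => A mA A0; rewrite /nu' /mfrestr /mrestr.
apply/eqP; rewrite eq_le measure_ge0 andbT; apply/lee_addgt0Pr => e e0.
rewrite add0e; have [d d0 H] := Fac e0.
have [U [Uo AU]] : exists U : set R, [/\ open U, A `<=` U & (mu (U `\` A) < d%:E)%E].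
  by apply: lebesgue_regularity_outer => //; rewrite A0.
move=> Ud.
have mU : measurable U by exact: open_measurable.
have {}Ud : (mu U < d%:E)%E.
  have mUA : measurable (U `\` A) by exact: measurableD.
  apply: le_lt_trans Ud; rewrite -[leRHS]add0e -A0.
  by rewrite -[in leLHS](setDUK AU); exact: measureU2.
have Io := @open_disjoint_itv_open R U Uo.
have Ii := @open_disjoint_itv_is_interval R U Uo.
have It := @open_disjoint_itv_trivIset R U Uo.
have Uc := @open_disjoint_itv_bigcup R U Uo.
move: (open_disjoint_itv Uo) Io Ii It Uc => I Io Ii It Uc.
have mI i : measurable (I i) by exact: open_measurable.
have [p pP] := choice (fun i => le_itv (Ii i) (Io i)).
pose q i := (cl (p i).1, cl (p i).2).
have sumle n : \sum_(i < n) (F (p i).2 - F (p i).1) <= e.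
  rewrite (eq_bigr (fun i : 'I_n => F (q i).2 - F (q i).1)); last first.
    by move=> i _; rewrite /q/= !Fcl.
  rewrite -(big_mkord xpredT (fun i => F (q i).2 - F (q i).1)).
  rewrite -(big_map q xpredT (fun p => F p.2 - F p.1)); apply: H.
    apply/andP; split.
      apply/allP => _ /mapP[i _ ->]; have [[p12 _ _] _] := pP i.
      have /andP[h1 _] := clP (p i).1; have /andP[_ h2] := clP (p i).2.
      by rewrite /= h1 h2 cl_homo.
    rewrite pairwise_map; apply/(pairwiseP 0%N) => i j.
    rewrite !inE !size_iota subn0 => ni nj ij.
    rewrite !nth_iota ?subn0// !add0n /relpre/=.
    (* The components come in no particular order; disjointness and convexity turn one comparison of
       points into a comparison of intervals. *)
    have sepJ k m : k != m -> I k `&` D !=set0 -> I m `&` D !=set0 ->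
        (exists x y, [/\ (I k `&` D) x, (I m `&` D) y & x < y]) -> (p k).2 <= (p m).1.
      move=> km Jk Jm [x [y [xk ym xy]]].
      have [_ [[Jk0 _]|[_ _ ->]]] := pP k; first by move: Jk; rewrite Jk0 => -[].
      have [_ [[Jm0 _]|[_ -> _]]] := pP m; first by move: Jm; rewrite Jm0 => -[].
      apply: ge_sup => // x' x'k; apply: lb_le_inf => // y' y'm.
      rewrite leNgt; apply/negP => y'x'.
      have dis z : I k z -> I m z -> False.
        by move=> kz mz; move/eqP: km; apply; apply: It => //; exists z.
      have [y'x|xy'] := leP y' x.
        by apply: (dis x); [exact: xk.1|apply: (Ii m y' y) => //; [exact: y'm.1|exact: ym.1|rewrite y'x ltW]].
      apply: (dis y'); [|exact: y'm.1].
      by apply: (Ii k x x') => //; [exact: xk.1|exact: x'k.1|rewrite !ltW].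
    have clq k : a <= cl k by have /andP[] := clP k.
    have cla : cl a = a by apply/max_idPl; rewrite ge_min lexx orbT.
    rewrite /separated /q /=.
    have [_ [[_ ->]|[Ji _ _]]] := pP i; first by apply/orP; left; rewrite /= cla; exact: clq.
    have [_ [[_ ->]|[Jj _ _]]] := pP j; first by apply/orP; right; rewrite /= cla; exact: clq.
    have nij : i != j by rewrite neq_ltn ij.
    have [x xi] := Ji; have [y yj] := Jj; have [xy|yx|xy] := ltgtP x y.
    - by apply/orP; left; apply: cl_homo; apply: sepJ => //; exists x, y.
    - by apply/orP; right; apply: cl_homo; apply: sepJ; rewrite 1?eq_sym//; exists y, x.
    - case/eqP: nij; apply: It => //; exists x; split; [exact: xi.1|].
      by rewrite xy; exact: yj.1.
  rewrite /total_length big_map big_mkord.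
  rewrite -lte_fin; apply: le_lt_trans Ud.
  apply: (@le_trans _ _ (\sum_(i < n) mu (I i))%E).
    rewrite -sumEFin; apply: lee_sum => i _; have [[p12 pI _] _] := pP i.
    apply: (@le_trans _ _ (mu `](p i).1, (p i).2[%classic)); last first.
      apply: le_measure; rewrite ?inE.
      - exact: measurable_itv.
      - exact: mI.
      - exact: (subset_trans pI (@subIsetl _ _ _)).
    apply: (@le_trans _ _ ((p i).2 - (p i).1)%:E); first by rewrite lee_fin /q/= cl_len.
    rewrite lebesgue_measure_itv/= lte_fin; case: ltP => [_|h]; first by rewrite EFinB.
    by rewrite lee_fin subr_le0.
  rewrite Uc measure_semi_bigcup//; last by rewrite -Uc.
  rewrite -(big_mkord xpredT (fun i => mu (I i))).
  by apply: nneseries_lim_ge => i _ _; exact: measure_ge0.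
have sub : A `&` D `<=` \bigcup_i `](p i).1, (p i).2]%classic.
  move=> x [xA xD]; have := AU x xA; rewrite Uc => -[i _ xi]; exists i => //.
  by have [[_ _ h] _] := pP i; exact: h.
have nule : (nu (A `&` D) <= \sum_(0 <= i <oo) nu `](p i).1, (p i).2]%classic)%E.
  apply: measure_sigma_subadditive => //; exact: measurableI.
apply: (le_trans nule); apply: lime_le.
  by apply: is_cvg_nneseries => i _ _; exact: measure_ge0.
near=> n; rewrite big_mkord.
rewrite (eq_bigr (fun i : 'I_n => (F (p i).2 - F (p i).1)%:E)); last first.
  by move=> i _; have [[p12 _ _] _] := pP i; rewrite nu_oc.
rewrite sumEFin lee_fin; exact: sumle.
Unshelve. all: by end_near. Qed.

Lemma Stieltjes_density : exists g : R -> R,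
  [/\ mu.-integrable setT (EFin \o g), forall x, 0 <= g x &
    forall x, a <= x <= b -> F x = F a + \int[mu]_(t in `[a, x]) g t].
Proof.
have [g [g0 gfin gi gE]] := radon_nikodym_sigma_finite nu_dominated.
have gg : EFin \o (fine \o g) = g by apply/funext => x /=; rewrite fineK.
exists (fine \o g); split => [|x|x /andP[ax xb]]; first by rewrite gg.
  by rewrite /= fine_ge0.
have h : (\int[mu]_(t in `]a, x]) g t = (F x - F a)%:E)%E.
  rewrite -gE; last exact: measurable_itv.
  transitivity (nu (`]a, x]%classic `&` D)) => //; rewrite setIidl ?nu_oc//.
  move=> t; rewrite /D/= !in_itv/= => /andP[t1 t2].
  by rewrite (lt_trans _ t1) ?(le_trans t2)// ?gtrBl// (le_trans xb)// lerDl.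
apply/eqP; rewrite addrC -subr_eq; apply/eqP.
rewrite -Rintegral_itv_obnd_cbnd; last first.
  by rewrite gg; apply: integrableS gi.
transitivity (fine (\int[mu]_(t in `]a, x]) g t)); first by rewrite h.
by rewrite /Rintegral; congr fine; apply: eq_integral => t _; rewrite /= fineK.
Qed.



End Stieltjes_density.

(** * Absolutely continuous functions as primitives *)

Section abs_continuous_primitive.
Context {R : realType}.
Notation mu := (@lebesgue_measure R).
Implicit Types (a b c : R) (f g : R -> R).

Lemma primitive_derive1 a b c f g : mu.-integrable setT (EFin \o g) ->
  (forall x, a <= x <= b -> f x = c + \int[mu]_(t in `[a, x]) g t) ->
  {ae mu, forall x, a < x < b -> derivable f x 1 /\ derive1 f x = g x}.
Proof.
move=> gi fE; have := @FTC1 R g (BLeft a).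
have i1 y : mu.-integrable [set` Interval (BLeft a) (BRight y)] (EFin \o g).
  by apply: integrableS gi.
have i2 : locally_integrable setT g by apply: open_integrable_locally => //; exact: openT.
move=> /(_ i1 i2); apply: filterS; first exact: (ae_filter_ringOfSetsType mu).
move=> x h /andP[ax xb].
have [|dF eF] := h; first by rewrite /= lte_fin.
set F := fun x => \int[mu]_(t in _) _ in dF eF.
have dF' : is_derive x 1 F (g x) := DeriveDef dF (etrans (esym (derive1E F x)) eF).
have d2 : is_derive x 1 (cst c + F) (g x).
  by rewrite -[g x]add0r; apply: is_deriveD.
have e : \forall y \near x, (cst c + F) y = f y.
  have xI : x \in `]a, b[ by rewrite in_itv/= ax.
  near=> y; have : y \in `]a, b[ by near: y; exact: near_in_itvoo.
  by rewrite in_itv/= => /andP[ay yb]; rewrite fE ?(ltW ay) ?(ltW yb).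
have [dd de] := d2.
split; first exact: (near_eq_derivable e dd).
by rewrite derive1E -de; apply/esym; apply: near_eq_derive; exact: e.
Unshelve. all: by end_near. Qed.

(** Jordan decomposition: the variation of [f] on [a, x], and that variation minus [f], are
    nondecreasing and absolutely continuous, the increments of the second being at most twice the
    variation. Each has a Radon-Nikodym density, and [g] is their difference. *)
Lemma abs_continuous_primitive a b f : a < b -> abs_continuous a b f ->
  exists g, mu.-integrable setT (EFin \o g) /\
    forall x, a <= x <= b -> f x = f a + \int[mu]_(t in `[a, x]) g t.
Proof.
move=> ab fac; have bv := abs_continuous_bounded_variation ab fac.
pose cl (x : R) : R := Num.max a (Num.min b x).
have clP x : a <= cl x <= b.
  by rewrite /cl le_max lexx/= ge_max (ltW ab) ge_min lexx.
have cla x : a <= cl x by have /andP[] := clP x.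
have clb x : cl x <= b by have /andP[] := clP x.
have cl_homo x y : x <= y -> cl x <= cl y.
  move=> xy; rewrite /cl ge_max le_max lexx/= le_max; apply/orP; right.
  by rewrite le_min ge_min lexx/= ge_min xy orbT.
have cl_id x : a <= x <= b -> cl x = x.
  by move=> /andP[ax xb]; rewrite /cl (min_idPr xb) (max_idPr ax).
pose V x y := fine (total_variation x y f).
have bvs x y : a <= x -> x <= y -> y <= b -> bounded_variation x y f.
  move=> ax xy yb; apply: (bounded_variationl xy yb).
  by apply: (bounded_variationr ax (le_trans xy yb)).
have Vfin x y : a <= x -> x <= y -> y <= b -> total_variation x y f \is a fin_num.
  by move=> ax xy yb; apply/bounded_variationP => //; exact: bvs.
have VD x y : a <= x -> x <= y -> y <= b -> V a y = V a x + V x y.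
  move=> ax xy yb; rewrite /V (total_variationD f ax xy) fineD//.
    by apply: Vfin => //; exact: le_trans yb.
  exact: Vfin.
have Vge x y : a <= x -> x <= y -> y <= b -> `|f y - f x| <= V x y.
  by move=> ax xy yb; rewrite -lee_fin /V fineK ?total_variation_ge//; exact: Vfin.
have V0 x y : a <= x -> x <= y -> y <= b -> 0 <= V x y.
  by move=> ax xy yb; apply: le_trans (Vge _ _ ax xy yb).
pose F1 x := V a (cl x); pose F2 x := F1 x - f (cl x).
have F1D x y : x <= y -> F1 y = F1 x + V (cl x) (cl y).
  by move=> xy; apply: VD => //; exact: cl_homo.
have F1nd : {homo F1 : x y / x <= y}.
  by move=> x y xy; rewrite (F1D _ _ xy) lerDl V0// cl_homo.
have F2nd : {homo F2 : x y / x <= y}.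
  move=> x y xy; rewrite /F2 (F1D _ _ xy).
  have := Vge _ _ (cla x) (cl_homo _ _ xy) (clb y); rewrite ler_norml => /andP[_].
  by lra.
have clcl x : cl (cl x) = cl x by apply: cl_id; exact: clP.
have ac1 e : 0 < e -> exists2 d, 0 < d & forall L, disjoint_itvs a b L ->
    total_length L < d -> \sum_(p <- L) V p.1 p.2 <= e.
  exact: abs_continuous_total_variation.
have F1E L : disjoint_itvs a b L ->
    \sum_(p <- L) (F1 p.2 - F1 p.1) = \sum_(p <- L) V p.1 p.2.
  move=> /andP[/allP h _]; rewrite !big_seq; apply: eq_bigr => p /h /and3P[p1 p12 p2].
  rewrite (F1D _ _ p12) addrAC subrr add0r !cl_id// ?p1 ?p2 ?andbT//=.
    exact: le_trans p1 p12.
  exact: le_trans p12 p2.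
have F2E L : disjoint_itvs a b L ->
    \sum_(p <- L) (F2 p.2 - F2 p.1) <= 2 * \sum_(p <- L) V p.1 p.2.
  move=> /andP[/allP h _]; rewrite mulr_sumr !big_seq; apply: ler_sum => p /h /and3P[p1 p12 p2].
  have e1 : cl p.1 = p.1 by rewrite cl_id// p1 (le_trans p12 p2).
  have e2 : cl p.2 = p.2 by rewrite cl_id// p2 (le_trans p1 p12).
  rewrite /F2 (F1D _ _ p12) e1 e2.
  have := Vge _ _ p1 p12 p2; rewrite ler_norml => /andP[+ _].
  by lra.
have [|e e0|g1 [g1i _ g1E]] := @Stieltjes_density R a b F1 ab F1nd.
- by move=> x; rewrite /F1 clcl.
- have [d d0 H] := ac1 e e0; exists d => // L dL Ld; rewrite F1E//; exact: H.
have [|e e0|g2 [g2i _ g2E]] := @Stieltjes_density R a b F2 ab F2nd.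
- by move=> x; rewrite /F2 /F1 clcl.
- have e20 : 0 < e / 2 by rewrite divr_gt0.
  have [d d0 H] := ac1 _ e20; exists d => // L dL Ld; apply: le_trans (F2E _ dL) _.
  by have := H _ dL Ld; lra.
exists (fun t => g1 t - g2 t); split; first exact: integrableB_EFin.
move=> x xab; rewrite RintegralB//; last 2 first.
- by apply: integrableS g1i.
- by apply: integrableS g2i.
have aab : a <= a <= b by rewrite lexx ltW.
have := g1E _ xab; have := g2E _ xab; rewrite /F2 !cl_id//.
by rewrite /F1 !cl_id//; lra.
Qed.

End abs_continuous_primitive.

(** * Bounded variation and a second mean value estimate *)

Section bounded_variation.
Context {R : realType}.
Notation mu := (@lebesgue_measure R).
Implicit Types (a b c d x : R) (f v Phi H : R -> R).

Lemma Rintegral_itv_split f a c b : a <= c -> c <= b ->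
  mu.-integrable `[a, b] (EFin \o f) ->
  \int[mu]_(x in `[a, b]) f x =
  \int[mu]_(x in `[a, c]) f x + \int[mu]_(x in `[c, b]) f x.
Proof.
move=> ac cb fi; have := Rintegral_itvB (x := c) fi.
rewrite !bnd_simp => /(_ ac cb) /(canRL (subrK _)) ->; rewrite addrC; congr (_ + _).
rewrite Rintegral_itv_obnd_cbnd//; apply: integrableS fi => //.
by apply: subset_itv; rewrite bnd_simp.
Qed.

Lemma integrable_cst_itv a b k : mu.-integrable `[a, b] (EFin \o cst k).
Proof. by apply: within_continuous_integrable; apply: for_continuous_within => x _; exact: cvg_cst. Qed.

Lemma Rintegral_cst_itv a b k : a <= b -> \int[mu]_(x in `[a, b]) k = k * (b - a).
Proof.
move=> ab; rewrite Rintegral_cst//; congr (_ * _).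
transitivity (fine (if (a%:E < b%:E)%E then (b%:E - a%:E)%E else 0%E)).
  by congr fine; exact: lebesgue_measure_itv.
rewrite lte_fin; case: ltP => [_//|ba].
have -> : b = a by apply/eqP; rewrite eq_le ab ba.
by rewrite subrr.
Qed.

Lemma nondecreasing_in_measurable a b f : {in `[a, b] &, nondecreasing_fun f} ->
  measurable_fun `[a, b] f.
Proof.
move=> fnd; have [ab|ba] := leP a b; last first.
  by rewrite set_itv_ge ?bnd_simp -?ltNge//; exact: measurable_fun_set0.
pose g x := f (Num.max a (Num.min b x)).
have cl x : Num.max a (Num.min b x) \in `[a, b].
  by rewrite in_itv/= le_max lexx/= ge_max ab ge_min lexx.
apply: (@eq_measurable_fun _ _ _ _ _ g).
  move=> x; rewrite inE/= in_itv/= => /andP[ax xb].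
  by rewrite /g (min_idPr xb) (max_idPr ax).
apply: nondecreasing_measurable => // x y xy; apply: fnd => //.
by rewrite ge_max le_max lexx/= le_max; apply/orP; right; rewrite le_min ge_min lexx/= ge_min xy orbT.
Qed.

Lemma bounded_variation_nondecreasingB a b f : a <= b -> bounded_variation a b f ->
  exists p q : R -> R, [/\ {in `[a, b] &, nondecreasing_fun p},
    {in `[a, b] &, nondecreasing_fun q} & {in `[a, b], forall x, f x = p x - q x}].
Proof.
move=> ab bv; exists (fine \o pos_tv a f), (fine \o neg_tv a f); split.
- by move=> x y xab yab; apply: (fine_neg_tv_nondecreasing (bounded_variationN bv)).
- by move=> x y xab yab; apply: (fine_neg_tv_nondecreasing bv).
- exact: bounded_variation_pos_neg_tvE bv.
Qed.

Lemma bounded_variation_measurable a b f : bounded_variation a b f ->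
  measurable_fun `[a, b] f.
Proof.
move=> bv; have [ab|ba] := leP a b; last first.
  by rewrite set_itv_ge ?bnd_simp -?ltNge//; exact: measurable_fun_set0.
have [p [q [pnd qnd fE]]] := bounded_variation_nondecreasingB ab bv.
apply: (@eq_measurable_fun _ _ _ _ _ (p \- q)).
  by move=> x; rewrite inE => xab /=; rewrite fE.
by apply: measurable_funB; exact: nondecreasing_in_measurable.
Qed.

Let nondecreasing_cvg_at_right a b f : a < b -> {in `[a, b] &, nondecreasing_fun f} ->
  cvg (f x @[x --> a^'+]).
Proof.
move=> ab fnd; apply: nondecreasing_at_right_is_cvgr.
  near=> x => y z; rewrite !in_itv/= => /andP[ay yx] /andP[az zx].
  have xb : x <= b by near: x; exact: nbhs_right_le.
  by apply: fnd; rewrite in_itv/= ltW//= (le_trans _ xb)// ltW.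
near=> x; exists (f a) => _ [y /= + <-]; rewrite in_itv/= => /andP[ay yx].
have xb : x <= b by near: x; exact: nbhs_right_le.
by apply: fnd; rewrite ?in_itv/= ?lexx ?(ltW ab) ?(ltW ay)//= (le_trans _ xb)// ltW.
Unshelve. all: by end_near. Qed.

Lemma bounded_variation_cvg_at_right a b f : a < b -> bounded_variation a b f ->
  cvg (f x @[x --> a^'+]).
Proof.
move=> ab bv.
have [p [q [pnd qnd fE]]] := bounded_variation_nondecreasingB (ltW ab) bv.
have cp := nondecreasing_cvg_at_right ab pnd.
have cq := nondecreasing_cvg_at_right ab qnd.
apply: (cvgP (lim (p x @[x --> a^'+]) - lim (q x @[x --> a^'+]))).
apply: cvg_trans (cvgB cp cq); apply: near_eq_cvg; near=> x.
rewrite fE// in_itv/=; apply/andP; split; first by near: x; exact: nbhs_right_ge.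
by near: x; exact: nbhs_right_le.
Unshelve. all: by end_near. Qed.

Let V f a b := fine (total_variation a b f).

Let V_ge0 f a b : a <= b -> 0 <= V f a b.
Proof. by move=> ab; rewrite fine_ge0// total_variation_ge0. Qed.

Let BV_sub a b c d f : a <= c -> c <= d -> d <= b -> bounded_variation a b f ->
  bounded_variation c d f.
Proof.
move=> ac cd db bv; apply: (bounded_variationl cd db).
by apply: (bounded_variationr ac (le_trans cd db)).
Qed.

Let BV_fin a b f : a <= b -> bounded_variation a b f ->
  total_variation a b f \is a fin_num.
Proof. by move=> ab /(bounded_variationP f ab). Qed.

Let VD f a b c : a <= c -> c <= b -> bounded_variation a b f ->
  V f a b = V f a c + V f c b.
Proof.
move=> ac cb bv; rewrite /V (total_variationD f ac cb) fineD//.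
  exact: (BV_fin ac (BV_sub (lexx _) ac cb bv)).
exact: (BV_fin cb (BV_sub ac cb (lexx _) bv)).
Qed.

Let V_ge f a b x y : bounded_variation a b f -> a <= x <= b -> a <= y <= b ->
  `|f x - f y| <= V f a b.
Proof.
wlog xy : x y / y <= x.
  move=> h bv xab yab; have [|/ltW] := leP y x => xy; first exact: h.
  by rewrite distrC; exact: h.
move=> bv /andP[ax xb] /andP[ay yb].
have bvx : bounded_variation a x f by exact: BV_sub bv.
rewrite (@VD _ _ _ x)// (@VD _ _ x y)// addrAC [leLHS](_ : _ = 0 + `|f x - f y|); last by rewrite add0r.
apply: lerD; first by rewrite addr_ge0 ?V_ge0.
rewrite -lee_fin /V fineK ?total_variation_ge//.
exact: (BV_fin xy (BV_sub ay xy (lexx _) bvx)).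
Qed.

Lemma integrable_bounded_itv a b f K : measurable_fun `[a, b] f ->
  (forall x, a <= x <= b -> `|f x| <= K) -> mu.-integrable `[a, b] (EFin \o f).
Proof.
move=> mf fK.
apply: (@le_integrable _ _ _ mu _ _ _ (EFin \o cst K)) => //.
- exact/measurable_EFinP.
- move=> x/=; rewrite in_itv/= => xab; rewrite lee_fin [leRHS]ger0_norm.
    exact: fK.
  by apply: le_trans (fK _ xab).
- exact: integrable_cst_itv.
Qed.

Lemma integrable_boundedM a b f (g : R -> R) K : mu.-integrable `[a, b] (EFin \o f) ->
  measurable_fun `[a, b] g -> (forall x, a <= x <= b -> `|g x| <= K) ->
  mu.-integrable `[a, b] (EFin \o (fun x => f x * g x)).
Proof.
move=> fi mg gK.
have mf : measurable_fun `[a, b] f by apply/measurable_EFinP; exact: (measurable_int mu fi).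
apply: (@le_integrable _ _ _ mu _ _ _ (EFin \o (fun y => K * f y))) => //.
- by apply/measurable_EFinP; exact: measurable_funM.
- move=> y/=; rewrite in_itv/= => yI; rewrite lee_fin !normrM mulrC.
  by rewrite ler_wpM2r// (le_trans (gK _ yI))// ler_norm.
- by apply: integrableZl_EFin.
Qed.

Lemma integrable_bounded_variationM a b v Phi K : a <= b ->
  bounded_variation a b v -> measurable_fun `[a, b] Phi ->
  (forall x, a <= x <= b -> `|Phi x| <= K) ->
  mu.-integrable `[a, b] (EFin \o (fun x => v x * Phi x)).
Proof.
move=> ab bv mPhi PhiK.
apply: (@integrable_bounded_itv _ _ _ ((`|v a| + V v a b) * K)) => [|x xab].
  by apply: measurable_funM => //; exact: bounded_variation_measurable.
rewrite normrM ler_pM//; last exact: PhiK.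
rewrite -[v x](subrK (v a)) addrC (le_trans (ler_normD _ _))// lerD2l.
by apply: V_ge => //; rewrite lexx.
Qed.

Section second_mean_value.
Variables (a b : R) (v Phi H : R -> R) (K M : R).
Hypothesis ab : a < b.
Hypothesis bv : bounded_variation a b v.
Hypothesis mPhi : measurable_fun `[a, b] Phi.
Hypothesis PhiK : forall x, a <= x <= b -> `|Phi x| <= K.
Hypothesis PhiH : forall c d, a <= c -> c <= d -> d <= b ->
  \int[mu]_(x in `[c, d]) Phi x = H c - H d.
Hypothesis HM : forall x, a <= x <= b -> `|H x| <= M.
Hypothesis Hb : H b = 0.

Let M0 : 0 <= M.
Proof. by apply: (le_trans (normr_ge0 (H a))); apply: HM; rewrite lexx ltW. Qed.

Let sub c d : a <= c -> d <= b -> `[c, d]%classic `<=` (`[a, b]%classic : set R).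
Proof. by move=> ac db; apply: subset_itv; rewrite bnd_simp. Qed.

Let ivPhi : mu.-integrable `[a, b] (EFin \o (fun x => v x * Phi x)).
Proof. exact: (integrable_bounded_variationM (ltW ab) bv mPhi PhiK). Qed.

(** Freezing [v] at any point of [c, d] costs at most its variation there times the length and the
    bound on [Phi]. *)
Let piece c d : a <= c -> c <= d -> d <= b -> forall p, c <= p <= d ->
  `|\int[mu]_(x in `[c, d]) (v x * Phi x) - v p * (H c - H d)| <= K * (d - c) * V v c d.
Proof.
move=> ac cd db p pcd.
have bvcd : bounded_variation c d v by exact: BV_sub bv.
have iv : mu.-integrable `[c, d] (EFin \o (fun x => v x * Phi x)).
  by apply: integrableS ivPhi => //; exact: sub.
have mPhi' : measurable_fun `[c, d] Phi by apply: measurable_funS mPhi => //; exact: sub.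
have iPhi : mu.-integrable `[c, d] (EFin \o Phi).
  apply: (integrable_bounded_itv mPhi' (K := K)) => x /andP[cx xd].
  by apply: PhiK; rewrite (le_trans ac cx) (le_trans xd db).
rewrite -PhiH// -RintegralZl// -RintegralB//; last exact: integrableZl_EFin.
under eq_Rintegral do rewrite -mulrBl.
have ii : mu.-integrable `[c, d] (EFin \o (fun x => (v x - v p) * Phi x)).
  apply: eq_integrable (integrableB_EFin _ iv (integrableZl_EFin (v p) _ iPhi)) => //.
  by move=> x _ /=; rewrite mulrBl.
apply: le_trans (le_normr_Rintegral _ ii) _ => //.
have -> : K * (d - c) * V v c d = \int[mu]_(x in `[c, d]) (V v c d * K).
  by rewrite Rintegral_cst_itv//; ring.
apply: le_Rintegral => //.
- exact: integrable_norm ii.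
- exact: integrable_cst_itv.
move=> x/=; rewrite in_itv/= => xcd; rewrite normrM ler_pM//.
  exact: V_ge.
by move/andP: xcd => [cx xd]; apply: PhiK; rewrite (le_trans ac cx) (le_trans xd db).
Qed.

(** Abel summation over a uniform partition: the values of [H] meet the increments of [v], which sum
    to at most the variation, and the errors of [piece] sum to at most K times the mesh times the
    variation. *)
Let step (n : nat) : `|\int[mu]_(x in `[a, b]) (v x * Phi x) -
    v (a + (b - a) / n.+1%:R) * H a| <= (M + K * ((b - a) / n.+1%:R)) * V v a b.
Proof.
pose D := (b - a) / n.+1%:R; rewrite -/D.
have D0 : 0 < D by rewrite divr_gt0 ?subr_gt0.
pose X i := a + i%:R * D.
have Xn : X n.+1 = b by rewrite /X /D mulrC divfK// addrC subrK.
have X1 : a + D = X 1%N by rewrite /X mul1r.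
have X0 : X 0%N = a by rewrite /X mul0r addr0.
have XS i : X i.+1 = X i + D by rewrite /X -natr1 mulrDl mul1r addrA.
have Xm i j : (i <= j)%N -> X i <= X j.
  by move=> ij; rewrite lerD2l ler_wpM2r ?ler_nat// ltW.
have Xa i : a <= X i by rewrite -{1}X0 Xm.
have Xb i : (i <= n.+1)%N -> X i <= b by rewrite -Xn; exact: Xm.
suff main i : (i <= n)%N -> `|\int[mu]_(x in `[a, X i.+1]) (v x * Phi x) +
    v (X i.+1) * H (X i.+1) - v (X 1%N) * H a| <=
    M * V v (X 1%N) (X i.+1) + K * D * V v a (X i.+1).
  have := main n (leqnn _); rewrite Xn Hb mulr0 addr0 X1 => /le_trans; apply.
  rewrite mulrDl lerD2r ler_wpM2l// (@VD v a b (X 1%N))// ?Xb//.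
  by rewrite lerDr V_ge0.
elim: i => [|i IH] ni.
  (* The first piece is frozen at its right end, so that v(a+), and not v(a), appears in the
     limit. *)
  have h := @piece a (X 1%N) (lexx _) (Xa 1%N) (Xb 1%N isT) (X 1%N).
  rewrite Xa lexx in h.
  have -> : V v (X 1%N) (X 1%N) = 0 by rewrite /V total_variationxx.
  rewrite mulr0 add0r [D in K * D](_ : D = X 1%N - a); last by rewrite -X1 addrAC subrr add0r.
  apply: le_trans (h isT).
  by rewrite le_eqVlt; apply/orP; left; apply/eqP; congr `|_|; ring.
have ni' : (i.+1 <= n.+1)%N by rewrite ltnW.
have bi : X i.+2 <= b by rewrite Xb.
have ii : mu.-integrable `[a, X i.+2] (EFin \o (fun x => v x * Phi x)).
  by apply: integrableS ivPhi => //; exact: sub.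
rewrite (Rintegral_itv_split (Xa i.+1) (Xm _ _ (leqnSn i.+1)) ii).
set I1 := \int[mu]_(_ in _) _ in IH *; set I2 := \int[mu]_(_ in _) _.
have h2 : `|I2 - v (X i.+1) * (H (X i.+1) - H (X i.+2))| <= K * D * V v (X i.+1) (X i.+2).
  have := @piece (X i.+1) (X i.+2) (Xa _) (Xm _ _ (leqnSn _)) bi (X i.+1).
  have -> : X i.+2 - X i.+1 = D by rewrite (XS i.+1) addrAC subrr add0r.
  by rewrite lexx (Xm _ _ (leqnSn _)) => h; exact: h.
have bv2 : bounded_variation (X i.+1) (X i.+2) v.
  by apply: BV_sub bv => //; exact: Xm.
have h3 : `|(v (X i.+2) - v (X i.+1)) * H (X i.+2)| <= M * V v (X i.+1) (X i.+2).
  rewrite normrM mulrC ler_pM//; first by apply: HM; rewrite Xa.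
  by apply: V_ge => //; rewrite !lexx (Xm _ _ (leqnSn _)).
have e1 : V v a (X i.+2) = V v a (X i.+1) + V v (X i.+1) (X i.+2).
  by apply: VD => //; [exact: Xm|exact: BV_sub bv].
have e2 : V v (X 1%N) (X i.+2) = V v (X 1%N) (X i.+1) + V v (X i.+1) (X i.+2).
  apply: VD => //; [exact: Xm|exact: Xm|apply: BV_sub bv => //; exact: Xm].
rewrite e1 e2 !mulrDr.
have := IH (ltnW ni); rewrite -/I1 => h1.
rewrite [X in `|X|](_ : _ = (I1 + v (X i.+1) * H (X i.+1) - v (X 1%N) * H a) +
   (I2 - v (X i.+1) * (H (X i.+1) - H (X i.+2))) +
   (v (X i.+2) - v (X i.+1)) * H (X i.+2)); last by ring.
apply: le_trans (ler_normD _ _) _.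
apply: le_trans (lerD (ler_normD _ _) (lexx _)) _.
move: h1 h2 h3; lra.
Qed.

(** [step] in the limit of vanishing mesh; it stands in for an integration by parts against dv. *)
Lemma bounded_variation_Rintegral_le :
  `|\int[mu]_(x in `[a, b]) (v x * Phi x)| <=
  `|H a| * `|lim (v x @[x --> a^'+])| + M * fine (total_variation a b v).
Proof.
set I := \int[mu]_(x in _) _; set l := lim _.
have vl : v x @[x --> a^'+] --> l by exact: bounded_variation_cvg_at_right bv.
have Dc : (b - a) / n.+1%:R @[n --> \oo] --> (0 : R).
  by rewrite -(mulr0 (b - a)); apply: cvgMr; exact: cvg_harmonic.
have vc : v (a + (b - a) / n.+1%:R) @[n --> \oo] --> l.
  apply: (@cvg_comp _ _ _ (fun n => a + (b - a) / n.+1%:R) v \oo (a^'+)) => //.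
  move=> S; rewrite /nbhs/= /at_right /= /within/= => S0.
  have ac : a + (b - a) / n.+1%:R @[n --> \oo] --> (a + 0 : R).
    by apply: cvgD; [exact: cvg_cst|exact: Dc].
  rewrite addr0 in ac.
  have h : \forall n \near \oo, a < a + (b - a) / n.+1%:R ->
    S (a + (b - a) / n.+1%:R) := ac _ S0.
  apply: filterS h => n; apply.
  by rewrite ltrDl divr_gt0 ?subr_gt0.
have h1 : `|I - v (a + (b - a) / n.+1%:R) * H a| @[n --> \oo] --> `|I - l * H a|.
  apply: cvg_norm; apply: cvgB; first exact: cvg_cst.
  by apply: cvgMl; exact: vc.
have h2 : (M + K * ((b - a) / n.+1%:R)) * V v a b @[n --> \oo] --> (M + K * 0) * V v a b.
  apply: cvgMl; apply: cvgD; first exact: cvg_cst.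
  by apply: cvgMr; exact: Dc.
have h : `|I - l * H a| <= (M + K * 0) * V v a b.
  by apply: (ler_cvg_to h1 h2); near=> n; exact: step.
rewrite mulr0 addr0 in h.
rewrite -[I](subrK (l * H a)) addrC (le_trans (ler_normD _ _))//.
by rewrite normrM mulrC lerD2l.
Unshelve. all: by end_near. Qed.

End second_mean_value.
End bounded_variation.

Lemma integrable_itvoo_itvcc {R : realType} (a b : R) (f : R -> R) :
  lebesgue_measure.-integrable `]a, b[ (EFin \o f) ->
  lebesgue_measure.-integrable `[a, b] (EFin \o f).
Proof.
move=> /integrableP[mf iF]; apply/integrableP; split.
  by apply/emeasurable_fun_itv_obnd_cbndP/emeasurable_fun_itv_bndo_bndcP.
have mn : measurable_fun (`]a, b[%classic : set R) (fun x => `|(EFin \o f) x|%E).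
  exact: measurableT_comp.
rewrite -integral_itv_obnd_cbnd.
  by rewrite -integral_itv_bndo_bndc.
by apply/emeasurable_fun_itv_bndo_bndcP.
Qed.

(** * The Beta integral and Fubini on a triangle *)

Section Gamma_like_Beta.
Context {R : realType}.
Notation mu := (@lebesgue_measure R).
Implicit Types a b s x : R.

Variable G : R -> R.
Hypothesis G_gt0 : forall s, 0 < s -> 0 < G s.
Hypothesis GS : forall s, 0 < s -> G (s + 1) = s * G s.
Hypothesis G1 : G 1 = 1.
Hypothesis GD_le : forall x s, 0 < x -> 0 <= s <= 1 -> G (x + s) <= x `^ s * G x.

Let cvgMc (c l : R) (u : nat -> R) : u n @[n --> \oo] --> l ->
  c * u n @[n --> \oo] --> c * l.
Proof. by move=> ul; apply: cvgMr. Qed.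

(** Bohr-Mollerup argument for the Beta function: [k b] is invariant under b -> b + 1 and equals
    [G a] at 1. Monotonicity of [h] compares b + m with integers, and the quotients of Gamma values
    so obtained tend to 1. *)
Let Beta_unique a (h : R -> R) : 0 < a ->
  (forall b b', 1 <= b -> b <= b' -> h b' <= h b) ->
  (forall b, 1 <= b -> (a + b) * h (b + 1) = b * h b) ->
  a * h 1 = 1 ->
  forall b, 1 <= b -> h b = G a * G b / G (a + b).
Proof.
move=> a0 hni hS h1.
pose k b := h b * G (a + b) / G b.
have G0 z : 0 < z -> G z != 0 by move=> z0; rewrite gt_eqF// G_gt0.
have kS b m : 1 <= b -> k (m%:R + b) = k b.
  move=> b1; elim: m => [|m IH]; first by rewrite add0r.
  rewrite -IH -natr1 (_ : m%:R + 1 + b = m%:R + b + 1); last by ring.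
  have : 1 <= m%:R + b by rewrite ler_wpDl.
  move: (m%:R + b) => z z1; have z0 : 0 < z by lra.
  have := hS _ z1; rewrite mulrC => /(canRL (mulfK _)) e.
  rewrite /k e ?gt_eqF ?addr_gt0// addrA !GS ?addr_gt0//; field.
  by rewrite !G0// !gt_eqF// addr_gt0.
have kE b : 1 <= b -> h b = k b * G b / G (a + b).
  by move=> b1; rewrite /k; field; rewrite !G0//; lra.
have k1 : k 1 = G a.
  rewrite /k G1 GS// divr1 mulrA [h 1 * a]mulrC h1 mul1r//.
suff kc b : 1 <= b -> k b = G a by move=> b b1; rewrite kE// kc.
move=> b1; pose s := b - 1; have s0 : 0 <= s by rewrite /s; lra.
pose N := (Num.truncn s).+1; have sN : s <= N%:R by rewrite ltW// truncnS_gt.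
have kbE m : k b = h (m.+1%:R + s) * G (m.+1%:R + (a + s)) / G (m.+1%:R + s).
  rewrite -(kS b m b1) (_ : m%:R + b = m.+1%:R + s); last by rewrite -natr1 /s; ring.
  by rewrite /k (_ : a + _ = m.+1%:R + (a + s))//; ring.
have hnatN m (n : nat) : h (m.+1%:R + n%:R) =
    G a * G (m.+1%:R + n%:R) / G (m.+1%:R + (a + n%:R)).
  rewrite kE; last by rewrite -natr1 -addrA addrCA lerDl addr_ge0.
  rewrite (_ : m.+1%:R + n%:R = (m + n)%:R + 1); last by rewrite natrD -natr1; ring.
  by rewrite kS// k1 (_ : a + _ = m.+1%:R + (a + n%:R))// natrD -natr1; ring.
have gt0 m (x : R) : 0 <= x -> 0 < G (m.+1%:R + x) by move=> x0; rewrite G_gt0// ltr_wpDr.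
have as0 : 0 <= a + s by rewrite addr_ge0// ltW.
apply: le_anti; apply/andP; split.
- have q := Gamma_like_quotient_cvg G_gt0 GS GD_le (lexx 0) as0 (ltW a0) s0 (add0r _).
  have q' := cvgMc (c := G a) q; rewrite mulr1 in q'.
  apply: (ler_cvg_to (@cvg_cst _ (k b) _ \oo _) q').
  near=> m; rewrite /= (kbE m).
  have := @hni (m.+1%:R + 0) (m.+1%:R + s); rewrite addr0 ler1n lerDl s0 => /(_ isT isT).
  have := hnatN m 0; rewrite mulr0n !addr0 => -> hle.
  apply: (@le_trans _ _ (G a * G m.+1%:R / G (m.+1%:R + a) *
     G (m.+1%:R + (a + s)) / G (m.+1%:R + s))).
    by rewrite ler_wpM2r ?invr_ge0 ?(ltW (gt0 _ _ _))// ler_wpM2r// ltW// gt0.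
  by rewrite le_eqVlt; apply/orP; left; apply/eqP; field; rewrite !gt_eqF ?gt0// ltW.
- have aN0 : 0 <= a + N%:R by rewrite addr_ge0// ltW.
  have abE : N%:R + (a + s) = a + N%:R + s by ring.
  have q := Gamma_like_quotient_cvg G_gt0 GS GD_le (ler0n _ N) as0 aN0 s0 abE.
  have q' := cvgMc (c := G a) q; rewrite mulr1 in q'.
  apply: (ler_cvg_to q' (@cvg_cst _ (k b) _ \oo _)).
  near=> m; rewrite /= (kbE m).
  have := @hni (m.+1%:R + s) (m.+1%:R + N%:R).
  rewrite lerD2l sN -natr1 (_ : 1 <= _)//; last by rewrite addrAC lerDr addr_ge0.
  move=> /(_ isT isT); rewrite natr1 hnatN => hle.
  apply: (@le_trans _ _ (G a * G (m.+1%:R + N%:R) / G (m.+1%:R + (a + N%:R)) *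
     G (m.+1%:R + (a + s)) / G (m.+1%:R + s))).
    by rewrite le_eqVlt; apply/orP; left; apply/eqP; field; rewrite !gt_eqF ?gt0.
  by rewrite ler_wpM2r ?invr_ge0 ?(ltW (gt0 _ _ _))// ler_wpM2r// ltW// gt0.
Unshelve. all: by end_near. Qed.

Variable y : R.
Hypothesis y1 : y < 1.
Let L : R := 1 - y.
Let L0 : 0 < L. Proof. by rewrite /L subr_gt0. Qed.

(** The intervals [A n, B n] exhaust ]y, 1[, starting from its middle third. *)
Let A (n : nat) : R := y + L / n.+3%:R.
Let B (n : nat) : R := 1 - L / n.+3%:R.

Let itvE : `]y, 1[%classic = \bigcup_n `[A n, B n]%classic :> set R.
Proof.
have L0' := L0.
apply/seteqP; split=> [x/=|x [n _]/=]; rewrite !in_itv/=.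
  move=> /andP[yx x1].
  exists (maxn (Num.truncn (L / (x - y))) (Num.truncn (L / (1 - x)))) => //=.
  set m := maxn _ _; have m0 : 0 < m.+3%:R :> R by [].
  have h (z : R) : 0 < z -> (Num.truncn (L / z) <= m)%N -> L / m.+3%:R <= z.
    move=> z0 zm; rewrite ler_pdivrMr// mulrC -ler_pdivrMr//.
    rewrite (le_trans (ltW (truncnS_gt _)))// ler_nat.
    exact: (leq_trans zm (leq_addl 2 m)).
  rewrite in_itv/= /A /B; apply/andP; split.
    by have := h (x - y); rewrite subr_gt0 leq_maxl => /(_ yx isT); move: (L / _) => q; lra.
  by have := h (1 - x); rewrite subr_gt0 leq_maxr => /(_ x1 isT); move: (L / _) => q; lra.
have : 0 < L / n.+3%:R by rewrite divr_gt0.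
by rewrite /A /B; move: (L / _) => q q0 /andP[]; lra.
Qed.

Let AB n : A n < B n.
Proof.
have : L / n.+3%:R <= L / 3.
  by rewrite ler_pM2l// lef_pV2 ?posrE// ler_nat.
by have := L0; rewrite /A /B; move: (L / n.+3%:R) => q; rewrite /L; lra.
Qed.

Let dLn n : L / n.+4%:R <= L / n.+3%:R.
Proof. by rewrite ler_pM2l// lef_pV2 ?posrE// ler_nat. Qed.

Let A_ni n : A n.+1 <= A n. Proof. by rewrite lerD2l dLn. Qed.
Let B_nd n : B n <= B n.+1. Proof. by rewrite lerD2l lerN2 dLn. Qed.

Let Ln_cvg : L / n.+3%:R @[n --> \oo] --> (0 : R).
Proof.
have h : L / n.+1%:R @[n --> \oo] --> (0 : R).
  by rewrite -(mulr0 L); apply: cvgMr; exact: cvg_harmonic.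
move: h; rewrite -(cvg_shiftn 2).
by rewrite (_ : (fun n => _) = (fun n => L / n.+3%:R))//; apply/funext => n; rewrite addn2.
Qed.

Let powR_cvg (u : nat -> R) (c a : R) : 0 < a -> (forall n, 0 < u n) ->
  u n @[n --> \oo] --> c -> 0 <= c -> u n `^ a @[n --> \oo] --> c `^ a.
Proof.
move=> a0 u0 uc; rewrite le_eqVlt => /predU1P[c0|c0].
  move: uc; rewrite -{}c0 => uc; rewrite powR0 ?gt_eqF//.
  apply: (@cvg_comp _ _ _ u (@powR R ^~ a) \oo (0^'+)); last exact: powR_cvg0.
  move=> S; rewrite /nbhs/= /at_right /= /within/= => S0.
  have h : \forall n \near \oo, 0 < u n -> S (u n) := uc _ S0.
  by apply: filterS h => n; apply.
apply: (@cvg_comp _ _ _ u (@powR R ^~ a) \oo (nbhs c)) => //.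
exact: (is_derive_continuous (is_derive1_powR a c0)).
Qed.

Let f a b s : R := (s - y) `^ (a - 1) * (1 - s) `^ (b - 1).

Let f_ge0 a b s : 0 <= f a b s. Proof. by rewrite mulr_ge0 ?powR_ge0. Qed.

Let dleft a s : y < s -> is_derive s 1 (fun s => (s - y) `^ a) (a * (s - y) `^ (a - 1)).
Proof.
move=> ys; have s0 : 0 < s - y by rewrite subr_gt0.
have h1 := is_derive1_powR a s0.
have h2 : is_derive s 1 (fun s : R => s - y) 1.
  by apply: is_derive_eq; rewrite subr0.
have := @is_derive1_comp R (@powR R ^~ a) (fun s => s - y) s _ _ h1 h2.
by rewrite mulr1.
Qed.

Let f_continuous a b s : y < s < 1 -> {for s, continuous (f a b)}.
Proof.
move=> /andP[ys s1]; apply: cvgM.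
- exact: (is_derive_continuous (dleft (a - 1) ys)).
- exact: (is_derive_continuous (is_derive_powR_1B (b - 1) s1)).
Qed.

Let mf a b : measurable_fun (`]y, 1[%classic : set R) (EFin \o f a b).
Proof.
apply/measurable_EFinP; apply: subspace_continuous_measurable_fun => //.
apply/continuous_in_subspaceT => s; rewrite inE/= in_itv/=; exact: f_continuous.
Qed.

Let E a b := (\int[mu]_(s in `]y, 1%R[) (f a b s)%:E)%E.

Let E_ge0 a b : (0 <= E a b)%E.
Proof. by apply: integral_ge0 => s _; rewrite lee_fin. Qed.

Let EZ c a b : 0 <= c -> (\int[mu]_(s in `]y, 1%R[) (c * f a b s)%:E = c%:E * E a b)%E.
Proof.
move=> c0; rewrite -ge0_integralZl ?lee_fin//; first exact: mf.
by move=> s _; rewrite lee_fin.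
Qed.

Let sub_AB s : (\bigcup_n `[A n, B n]%classic) s -> y < s < 1.
Proof. by rewrite -itvE /= in_itv. Qed.

Let An_y n : A n - y = L / n.+3%:R. Proof. by rewrite /A addrAC subrr add0r. Qed.
Let Bn_1 n : 1 - B n = L / n.+3%:R. Proof. by rewrite /B subKr. Qed.

Let Ln0 n : 0 < L / n.+3%:R. Proof. by rewrite divr_gt0. Qed.

Let Bn_y n : 0 < B n - y.
Proof. by have := AB n; have := Ln0 n; rewrite -An_y; lra. Qed.

Let Bn_y_cvg : B n - y @[n --> \oo] --> L.
Proof.
have h : L - L / n.+3%:R @[n --> \oo] --> (L - 0 : R).
  by apply: cvgB; [exact: cvg_cst|exact: Ln_cvg].
rewrite subr0 in h.
by rewrite (_ : (fun n => B n - y) = (fun n => L - L / n.+3%:R))//; apply/funext => n; rewrite /B /L addrAC.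
Qed.

Let E1 a : 0 < a -> (a%:E * E a 1 = (L `^ a)%:E)%E.
Proof.
move=> a0; rewrite -EZ ?(ltW a0)//.
have := @ge0_FTC2_exhaustion R (fun s => a * f a 1 s) (cst 0)
  (fun s => (s - y) `^ a) A B 0 (L `^ a) AB A_ni B_nd.
rewrite -itvE integral0 adde0 add0e; apply.
- by move=> s _; rewrite mulr_ge0 ?f_ge0// ltW.
- by move=> s _; exact: lexx.
- by move=> s; rewrite itvE => /sub_AB s1; apply: cvgMr; exact: (f_continuous (a := a)).
- by move=> s _; exact: cvg_cst.
- move=> s; rewrite itvE => /sub_AB /andP[s1 _]; have := dleft a s1.
  by rewrite /f subrr powRr0 mulr1 subr0.
- under eq_fun do rewrite An_y.
  have := powR_cvg a0 Ln0 Ln_cvg (lexx _); rewrite powR0 ?gt_eqF//; exact.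
- exact: powR_cvg a0 Bn_y Bn_y_cvg (ltW L0).
Qed.

Let ES a b : 0 < a -> 0 < b -> (a%:E * E a (b + 1) = b%:E * E (a + 1) b)%E.
Proof.
move=> a0 b0; rewrite -(EZ a (b + 1) (ltW a0)) -(EZ (a + 1) b (ltW b0)).
have := @ge0_FTC2_exhaustion R (fun s => a * f a (b + 1) s) (fun s => b * f (a + 1) b s)
  (fun s => (s - y) `^ a * (1 - s) `^ b) A B 0 0 AB A_ni B_nd.
rewrite -itvE !adde0; apply.
- by move=> s _; rewrite mulr_ge0 ?f_ge0// ltW.
- by move=> s _; rewrite mulr_ge0 ?f_ge0// ltW.
- by move=> s; rewrite itvE => /sub_AB s1; apply: cvgMr; exact: (f_continuous (a := a)).
- by move=> s; rewrite itvE => /sub_AB s1; apply: cvgMr; exact: (f_continuous (b := b)).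
- move=> s; rewrite itvE => /sub_AB /andP[s1 s2].
  have d1 := dleft a s1; have d2 := is_derive_powR_1B b s2.
  apply: is_derive_eq; rewrite /f !addrK -![_ *: _]/(_ * _); ring.
- under eq_fun do rewrite An_y.
  have h1 := powR_cvg a0 Ln0 Ln_cvg (lexx _); rewrite powR0 ?gt_eqF// in h1.
  have h2 : 1 - A n @[n --> \oo] --> L.
    have h : L - L / n.+3%:R @[n --> \oo] --> (L - 0 : R).
      by apply: cvgB; [exact: cvg_cst|exact: Ln_cvg].
    rewrite subr0 in h.
    by rewrite (_ : (fun n => 1 - A n) = (fun n => L - L / n.+3%:R))//; apply/funext => n; rewrite /A /L opprD addrA.
  have h3 := powR_cvg b0 (_ : forall n, 0 < 1 - A n) h2 (ltW L0).
  have := cvgM h1 (h3 _); rewrite mul0r; apply.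
  by move=> n; have := AB n; have := Ln0 n; rewrite -Bn_1; lra.
- have h1 := powR_cvg a0 Bn_y Bn_y_cvg (ltW L0).
  under eq_fun do rewrite Bn_1.
  have h2 := powR_cvg b0 Ln0 Ln_cvg (lexx _); rewrite powR0 ?gt_eqF// in h2.
  by have := cvgM h1 h2; rewrite mulr0; apply.
Qed.

(** On ]y, 1[ the factor (1 - s)^(b' - b) is at most L^(b' - b). After rescaling by powers of [L]
    this is the monotonicity asked for in [Beta_unique]; it also yields finiteness from the case b =
    1. *)
Let Emono a b b' : 1 <= b -> b <= b' -> (E a b' <= (L `^ (b' - b))%:E * E a b)%E.
Proof.
move=> b1 bb'; rewrite -EZ ?powR_ge0//; apply: ge0_le_integral => //.
- by move=> s _; rewrite lee_fin.
- exact: mf.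
- apply/measurable_EFinP; apply: measurable_funM; first exact: measurable_cst.
  by have /measurable_EFinP := mf a b.
move=> s/=; rewrite in_itv/= => /andP[ys s1]; rewrite lee_fin /f.
have s0 : 0 < 1 - s by rewrite subr_gt0.
rewrite (_ : b' - 1 = (b - 1) + (b' - b)); last by ring.
rewrite [(1 - s) `^ _]powRD_gt0// mulrA mulrC ler_wpM2r ?mulr_ge0 ?powR_ge0//.
rewrite ge0_ler_powR ?nnegrE ?(ltW s0) ?(ltW L0)//; first lra.
by rewrite /L; lra.
Qed.

Let Efin a b : 0 < a -> 1 <= b -> E a b \is a fin_num.
Proof.
move=> a0 b1; rewrite ge0_fin_numE//.
apply: (le_lt_trans (Emono a (lexx 1) b1)).
suff : (E a 1 < +oo)%E by move=> h; rewrite lte_mul_pinfty ?lee_fin ?powR_ge0.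
have -> : E a 1 = ((a^-1 * L `^ a)%:E)%E; last by rewrite ltry.
by rewrite EFinM -E1// muleA -EFinM mulVf ?gt_eqF// mul1e.
Qed.

Let EL a b : (E (a + 1) b + E a (b + 1) = L%:E * E a b)%E.
Proof.
rewrite -(EZ a b (ltW L0)) -ge0_integralD//; last 4 first.
- by move=> s _; rewrite lee_fin.
- exact: mf.
- by move=> s _; rewrite lee_fin.
- exact: mf.
apply: eq_integral => s; rewrite inE/= in_itv/= => /andP[ys s1].
rewrite -EFinD; congr EFin; rewrite /f !addrK.
have h1 : 0 < s - y by rewrite subr_gt0.
have h2 : 0 < 1 - s by rewrite subr_gt0.
have -> : (s - y) `^ a = (s - y) `^ (a - 1) * (s - y).
  by rewrite -[X in _ * X](powRr1 (ltW h1)) -powRD_gt0// subrK.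
have -> : (1 - s) `^ b = (1 - s) `^ (b - 1) * (1 - s).
  by rewrite -[X in _ * X](powRr1 (ltW h2)) -powRD_gt0// subrK.
by rewrite /L; ring.
Qed.

(** Dividing by L^(a+b-1) rescales to the unit interval. There [ES] and [EL] combine into the
    recurrence of [Beta_unique], and [E1] gives the value at 1. *)
Let betaE a b : 0 < a -> 1 <= b ->
  E a b = (G a * G b / G (a + b) * L `^ (a + b - 1))%:E.
Proof.
move=> a0 b1.
pose h b := fine (E a b) / L `^ (a + b - 1).
have p0 c : 0 < L `^ c by exact: powR_gt0.
have pN c : L `^ c != 0 by rewrite gt_eqF.
rewrite -(fineK (Efin a0 b1)); congr EFin.
rewrite -[LHS](divfK (pN (a + b - 1))) -/(h b); congr (_ * _).
apply: (@Beta_unique a h) => //.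
- move=> {b1} b b' b1 bb'; rewrite /h ler_pdivrMr// mulrAC ler_pdivlMr//.
  rewrite [leRHS](_ : _ = fine (E a b) * L `^ (b' - b) * L `^ (a + b - 1)); last first.
    by rewrite -mulrA -powRD_gt0//; congr (_ * _ `^ _); ring.
  rewrite ler_wpM2r ?(ltW (p0 _))//.
  rewrite -lee_fin EFinM !fineK ?Efin//; last exact: le_trans bb'.
  by rewrite muleC; exact: Emono.
- move=> {b1} b b1; have b0 : 0 < b by lra.
  have b2 : 1 <= b + 1 by lra.
  have a10 : 0 < a + 1 by lra.
  have e1 : a * fine (E a (b + 1)) = b * fine (E (a + 1) b).
    by apply: EFin_inj; rewrite (EFinM a) (EFinM b) (fineK (Efin a0 b2)) (fineK (Efin a10 b1)); exact: ES.
  have e2 : fine (E (a + 1) b) + fine (E a (b + 1)) = L * fine (E a b).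
    by apply: EFin_inj; rewrite (EFinM L) EFinD (fineK (Efin a10 b1)) (fineK (Efin a0 b2)) (fineK (Efin a0 b1)); exact: EL.
  rewrite /h (_ : a + (b + 1) - 1 = (a + b - 1) + 1); last by ring.
  rewrite (powRD_gt0 (a + b - 1) 1 L0) (powRr1 (ltW L0)).
  have L0' : L != 0 by rewrite gt_eqF.
  have -> : (a + b) * (fine (E a (b + 1)) / (L `^ (a + b - 1) * L)) =
    (a * fine (E a (b + 1)) + b * fine (E a (b + 1))) / (L `^ (a + b - 1) * L).
    by rewrite mulrA mulrDl.
  by rewrite e1 -mulrDr e2; field; rewrite L0' pN.
- rewrite /h addrK mulrA.
  suff -> : a * fine (E a 1) = L `^ a by rewrite divff.
  by apply: EFin_inj; rewrite EFinM fineK ?Efin// E1.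
Qed.

Lemma integrable_Beta a b : 0 < a -> 1 <= b ->
  mu.-integrable `[y, 1] (EFin \o (fun s => (s - y) `^ (a - 1) * (1 - s) `^ (b - 1))).
Proof.
move=> a0 b1.
have io : mu.-integrable `]y, 1[ (EFin \o f a b).
  apply/integrableP; split; first exact: mf.
  under eq_integral do rewrite /= ger0_norm//.
  by have := Efin a0 b1; rewrite ge0_fin_numE.
exact: integrable_itvoo_itvcc.
Qed.

Lemma Rintegral_Beta a b : 0 < a -> 1 <= b ->
  \int[mu]_(s in `[y, 1]) ((s - y) `^ (a - 1) * (1 - s) `^ (b - 1)) =
  G a * G b / G (a + b) * (1 - y) `^ (a + b - 1).
Proof.
move=> a0 b1; have ic := integrable_Beta a0 b1.
rewrite -Rintegral_itv_obnd_cbnd -?Rintegral_itv_bndo_bndc.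
- by transitivity (fine (E a b)) => //; rewrite betaE.
- by apply: integrableS ic => //; apply: subset_itv; rewrite bnd_simp.
- by apply: integrableS ic => //; apply: subset_itv; rewrite bnd_simp.
Qed.

End Gamma_like_Beta.

(** * Fubini's theorem on a triangle *)

Section triangle_Fubini.
Context {R : realType}.
Notation mu := (@lebesgue_measure R).
Variables (a b : R) (f Phi kappa : R -> R) (K C : R).
Hypothesis fi : mu.-integrable `[a, b] (EFin \o f).
Hypothesis mPhi : measurable_fun `[a, b] Phi.
Hypothesis PhiK : forall x, a <= x <= b -> `|Phi x| <= K.
Hypothesis mkappa : measurable_fun setT kappa.
Hypothesis kappa_ge0 : forall t, 0 <= kappa t.
Hypothesis kappai : forall y, a <= y <= b ->
  mu.-integrable `[y, b] (EFin \o (fun s => kappa (s - y))).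
Hypothesis kappaC : forall y, a <= y <= b ->
  \int[mu]_(s in `[y, b]) kappa (s - y) <= C.

Let inI (c d x : R) : (x \in (`[c, d]%classic : set R)) = (c <= x <= d).
Proof. by apply/idP/idP; rewrite inE/= in_itv. Qed.

Local Notation I := (`[a, b]%classic : set R).

(** The kernel times [f], extended by 0 off the triangle a <= y <= s <= b; [Phi] is added later as a
    bounded factor. *)
Let P (z : R * R) : R :=
  \1_I z.1 * (f \_ I) z.2 * (kappa \_ (`[0, +oo[%classic : set R)) (z.1 - z.2).

Let in0y x : (x \in (`[0, +oo[%classic : set R)) = (0 <= x).
Proof. by apply/idP/idP; rewrite inE/= in_itv/= andbT. Qed.

Let Pin1 s y : a <= s <= b -> P (s, y) = ((fun y => f y * kappa (s - y)) \_ `[a, s]) y.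
Proof.
move=> /andP[sa sb]; rewrite /P !patchE indicE !inI in0y/= subr_ge0 sa sb/= mul1r.
have [ay|ya] := leP a y; last by rewrite mul0r.
have [ys|sy] := leP y s; last by rewrite mulr0.
by rewrite (le_trans ys sb).
Qed.

Let Pin2 s y : a <= y <= b -> P (s, y) = ((fun s => f y * kappa (s - y)) \_ `[y, b]) s.
Proof.
move=> /andP[ya yb]; rewrite /P !patchE indicE !inI in0y/= subr_ge0 ya yb/=.
have [sb|bs] := leP s b; last by rewrite !andbF !mul0r.
have [ys|sy] := leP y s; last by rewrite mulr0.
by rewrite (le_trans ya ys) mul1r.
Qed.

Let Pout1 s y : ~~ (a <= s <= b) -> P (s, y) = 0.
Proof. by move=> /negbTE h; rewrite /P indicE inI/= h !mul0r. Qed.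

Let Pout2 s y : ~~ (a <= y <= b) -> P (s, y) = 0.
Proof. by move=> /negbTE h; rewrite /P patchE inI/= h mulr0 mul0r. Qed.

Let mrestrict (D : set R) (g : R -> R) : measurable D -> measurable_fun D g ->
  measurable_fun setT (g \_ D).
Proof. by move=> mD; exact: (measurable_restrictT g mD).1. Qed.

Let mfI : measurable_fun setT (f \_ I).
Proof.
apply: mrestrict => //.
apply/measurable_EFinP; exact: (measurable_int mu fi).
Qed.

Let mP : measurable_fun setT P.
Proof.
apply: measurable_funM; first apply: measurable_funM.
- by apply: measurableT_comp; [exact: measurable_indic|exact: measurable_fst].
- by apply: measurableT_comp; [exact: mfI|exact: measurable_snd].
apply: (measurableT_comp (f := kappa \_ (`[0, +oo[%classic : set R))).
  by apply: mrestrict => //; exact: measurable_funS mkappa.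
by apply: measurable_funB; [exact: measurable_fst|exact: measurable_snd].
Qed.

(** Tonelli with the inner integral in s: by [kappaC] it is at most C |f y|. *)
Let iP : (mu \x mu)%E.-integrable setT (EFin \o P).
Proof.
have fiT : mu.-integrable setT ((EFin \o f) \_ I).
  by apply: (iffLR (integrable_mkcond _ _)).
have iC : mu.-integrable setT (fun y => C%:E * `|((EFin \o f) \_ I) y|)%E.
  apply: integrableZl => //; exact: integrable_abse.
apply/(integrable21ltyP mu mu); first exact/measurable_EFinP.
apply: (@le_lt_trans _ _ (\int[mu]_y (C%:E * `|((EFin \o f) \_ I) y|))%E).
  apply: ge0_le_integral => //.
  - by move=> y _; apply: integral_ge0 => s _.
  - apply: (@measurable_fun_fubini_tonelli_G _ _ _ _ _ mu (fun z => `|(EFin \o P) z|%E)) => //.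
    by apply: measurableT_comp => //; exact/measurable_EFinP.
  - exact: (measurable_int mu iC).
  move=> y _; have [yI|yI] := boolP (a <= y <= b); last first.
    rewrite patchE inI (negbTE yI) abse0 mule0.
    by under eq_integral do rewrite /= Pout2//= normr0; rewrite integral0.
  rewrite patchE inI yI /=.
  have -> : (\int[mu]_s `|(P (s, y))%:E| = \int[mu]_(s in `[y, b]) (`|f y|%:E * (kappa (s - y))%:E))%E.
    rewrite [RHS]integral_mkcond; apply: eq_integral => s _.
    rewrite Pin2// !patchE; case: ifP => _; last by rewrite /= normr0.
    by rewrite /= normrM [X in _ * X]ger0_norm.
  have e : (\int[mu]_(s in `[y, b]) (kappa (s - y))%:E =
      (\int[mu]_(s in `[y, b]) kappa (s - y))%:E)%E.
    by rewrite /Rintegral fineK// integrable_fin_num// kappai.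
  rewrite integralZl//; last exact: kappai.
  by rewrite e -!EFinM lee_fin mulrC ler_wpM2r// kappaC.
by have := integrable_fin_num measurableT iC; rewrite fin_numElt => /andP[].
Qed.

Lemma triangle_Fubini :
  \int[mu]_(s in `[a, b]) (Phi s * \int[mu]_(y in `[a, s]) (f y * kappa (s - y))) =
  \int[mu]_(y in `[a, b]) (f y * \int[mu]_(s in `[y, b]) (Phi s * kappa (s - y))).
Proof.
pose Q (z : R * R) := (Phi \_ I) z.1 * P z.
have iQ : (mu \x mu)%E.-integrable setT (EFin \o Q).
  apply: (@le_integrable _ _ _ (mu \x mu)%E _ _ _ (EFin \o (fun z => K * P z))) => //.
  - apply/measurable_EFinP; apply: measurable_funM; last exact: mP.
    apply: measurableT_comp; last exact: measurable_fst.
    by apply: mrestrict.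
  - move=> [s y] _ /=; rewrite lee_fin /Q (normrM ((Phi \_ I) s)) (normrM K).
    have [sI|sI] := boolP (a <= s <= b); last by rewrite Pout1// normr0 !mulr0.
    by rewrite ler_wpM2r// patchE inI sI (le_trans (PhiK sI))// ler_norm.
  - exact: (integrableZl_EFin K measurableT iP).
(* Integrability in y on [a, s] is known for almost every s only; for fixed y, in [E2], [kappai]
   gives integrability in s without exception. *)
have E1 : {ae mu, forall s, setT s -> (\int[mu]_y (EFin \o Q) (s, y) =
    ((EFin \o (fun s => Phi s * \int[mu]_(y in `[a, s]) (f y * kappa (s - y)))%R) \_ I) s)%E}.
  have := ae_integrable1 iP; apply: filterS => s si _.
  rewrite patchE inI; have [sI|sI] := boolP (a <= s <= b); last first.
    by under eq_integral do rewrite /= /Q Pout1// mulr0; rewrite integral0.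
  have ki : mu.-integrable `[a, s] (EFin \o (fun y => f y * kappa (s - y))).
    apply/integrable_mkcond => //; apply: eq_integrable (si) => // y _.
    by rewrite /= Pin1// !patchE; case: ifP.
  rewrite /= EFinM /Rintegral fineK; last exact: integrable_fin_num.
  rewrite -integralZl// [RHS]integral_mkcond; apply: eq_integral => y _.
  by rewrite /Q /= patchE inI sI Pin1// !patchE; case: ifP => _; rewrite ?mulr0.
have E2 : {ae mu, forall y, setT y -> (\int[mu]_s (EFin \o Q) (s, y) =
    ((EFin \o (fun y => f y * \int[mu]_(s in `[y, b]) (Phi s * kappa (s - y)))%R) \_ I) y)%E}.
  apply: aeW => y _.
  rewrite patchE inI; have [yI|yI] := boolP (a <= y <= b); last first.
    by under eq_integral do rewrite /= /Q Pout2// mulr0; rewrite integral0.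
  have yb : `[y, b]%classic `<=` I by apply: subset_itv; rewrite bnd_simp//; case/andP: yI.
  have ki : mu.-integrable `[y, b] (EFin \o (fun s => Phi s * kappa (s - y))).
    apply: (@le_integrable _ _ _ mu _ _ _ (EFin \o (fun s => K * kappa (s - y)))) => //.
    - apply/measurable_EFinP; apply: measurable_funM; first exact: measurable_funS mPhi.
      by have /integrableP[/measurable_EFinP] := kappai yI.
    - move=> s /= sy; rewrite lee_fin !normrM ler_wpM2r// (le_trans _ (ler_norm _))// PhiK//.
      by have := yb _ sy; rewrite /I/= in_itv.
    - by apply: integrableZl_EFin => //; exact: kappai.
  rewrite /= EFinM /Rintegral fineK; last exact: integrable_fin_num.
  rewrite -integralZl// [RHS]integral_mkcond; apply: eq_integral => s _.
  rewrite /Q /= Pin2// !patchE.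
  have [sy|sy] := boolP (s \in (`[y, b]%classic : set R)); last by rewrite mulr0.
  have -> : s \in I by rewrite inE; apply: yb; rewrite -inE.
  by rewrite /= -EFinM mulrCA.
rewrite /Rintegral [in LHS]integral_mkcond [in RHS]integral_mkcond.
by rewrite -(ae_eq_integral_any E1) -(ae_eq_integral_any E2) Fubini.
Qed.

End triangle_Fubini.

(** * Weierstrass approximation *)

Section Weierstrass.
Context {R : realType}.
Implicit Types (w x y : R) (g h : nat -> R) (n i : nat).

(* [binomial_mean w n g] is the expectation of [g] at a binomial(n, w) variable. *)
Fixpoint binomial_mean w n g : R :=
  if n is m.+1 then
    (1 - w) * binomial_mean w m g + w * binomial_mean w m (fun i => g i.+1)
  else g 0%N.

Let mean_cst w n c : binomial_mean w n (fun=> c) = c.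
Proof. by elim: n => //= n ->; ring. Qed.

Let mean_lin w n g h c : binomial_mean w n (fun i => g i + c * h i) =
  binomial_mean w n g + c * binomial_mean w n h.
Proof. by elim: n g h => //= n IH g h; rewrite !IH; ring. Qed.

Let mean_sqr w n y : binomial_mean w n (fun i => (i%:R - y) ^+ 2) =
  n%:R * w * (1 - w) + (n%:R * w - y) ^+ 2.
Proof.
elim: n y => [|n IH] y /=; first by rewrite !mul0r; ring.
have -> : (fun i => (i.+1%:R - y) ^+ 2) = (fun i : nat => (i%:R - (y - 1)) ^+ 2).
  by apply/funext => i; rewrite -natr1; ring.
by rewrite !IH -natr1; ring.
Qed.

Let mean_le w n g h : 0 <= w <= 1 -> (forall i, (i <= n)%N -> g i <= h i) ->
  binomial_mean w n g <= binomial_mean w n h.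
Proof.
move=> /andP[w0 w1]; elim: n g h => [|n IH] g h gh /=; first exact: gh.
apply: lerD; apply: ler_wpM2l; rewrite ?subr_ge0//; apply: IH => i ni; apply: gh => //.
exact: leqW.
Qed.

Let mean_poly n g : exists p : {poly R}, forall x,
  p.[x] = binomial_mean ((1 + x) / 2) n g.
Proof.
elim: n g => [|n IH] g /=; first by exists (g 0%N)%:P => x; rewrite hornerC.
have [p pE] := IH g; have [q qE] := IH (fun i => g i.+1).
exists ((2^-1%:P - 2^-1 *: 'X) * p + (2^-1%:P + 2^-1 *: 'X) * q) => x.
by rewrite !hornerE pE qE; field.
Qed.

(** Bernstein's proof: [u (X i)] differs from [u x] by at most e/2 near x and, elsewhere, by at most
    a multiple of the squared deviation, whose binomial mean is the variance. *)
Lemma Weierstrass_approximation (u : R -> R) (M : R) :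
  (forall x, -1 <= x <= 1 -> `|u x| <= M) ->
  (forall e : R, 0 < e -> exists2 d : R, 0 < d & forall x y, -1 <= x <= 1 -> -1 <= y <= 1 ->
    `|x - y| < d -> `|u x - u y| < e) ->
  forall e : R, 0 < e -> exists p : {poly R}, forall x, -1 <= x <= 1 -> `|u x - p.[x]| <= e.
Proof.
move=> uM uc e e0.
have e20 : 0 < e / 2 by rewrite divr_gt0.
have [d d0 ud] := uc _ e20.
have M0 : 0 <= M by apply: le_trans (uM 0 _); rewrite ?normr_ge0//; lra.
(* As w (1 - w) <= 1/4, the variance term is at most 2 M / (d^2 n), and this n makes it at most
   e/2. *)
pose n := (Num.truncn (4 * M / (e * d ^+ 2))).+1.
have n0 : 0 < n%:R :> R by rewrite ltr0n.
have ed0 : 0 < e * d ^+ 2 by rewrite mulr_gt0 ?exprn_gt0.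
have nle : 4 * M <= n%:R * (e * d ^+ 2).
  by rewrite -ler_pdivrMr// ltW// truncnS_gt.
pose X i : R := 2 * i%:R / n%:R - 1.
have [p pE] := mean_poly n (fun i => u (X i)).
exists p => x xI; rewrite pE; set w := (1 + x) / 2.
have w01 : 0 <= w <= 1 by rewrite /w; lra.
have XI i : (i <= n)%N -> -1 <= X i <= 1.
  move=> ni; have h : 0 <= (i%:R / n%:R : R) <= 1.
    by apply/andP; split; [exact: divr_ge0|rewrite ler_pdivrMr// mul1r ler_nat].
  by rewrite /X -mulrA; move: (i%:R / n%:R) h => q; lra.
pose q i := (i%:R - n%:R * w) ^+ 2.
(* Makes [c * q i] equal to 2 M ((X i - x)/d)^2, which is at least 2 M when |X i - x| >= d. *)
pose c := 8 * M / (d ^+ 2 * n%:R ^+ 2).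
have c0 : 0 <= c.
  by rewrite /c; apply: divr_ge0; [apply: mulr_ge0|apply: mulr_ge0; apply: sqr_ge0].
have key i : (i <= n)%N -> `|u (X i) - u x| <= e / 2 + c * q i.
  move=> ni; have [xd|xd] := ltP `|X i - x| d.
    by rewrite (le_trans (ltW (ud _ _ (XI _ ni) xI xd)))// lerDl mulr_ge0 ?sqr_ge0.
  apply: (@le_trans _ _ (M + M)).
    by rewrite (le_trans (ler_normB _ _))// lerD// uM// XI.
  have -> : c * q i = 2 * M * ((X i - x) ^+ 2 / d ^+ 2).
    have -> : X i - x = 2 * (i%:R - n%:R * w) / n%:R.
      by rewrite /X /w; field; rewrite gt_eqF.
    by rewrite /c /q; field; rewrite !gt_eqF.
  have h : 1 <= (X i - x) ^+ 2 / d ^+ 2.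
    rewrite ler_pdivlMr ?exprn_gt0// mul1r -[leRHS]real_normK ?num_real//.
    by rewrite ler_sqr ?nnegrE// ltW.
  have h' : M + M <= 2 * M * ((X i - x) ^+ 2 / d ^+ 2).
    by rewrite -[leLHS](_ : 2 * M * 1 = _) ?ler_wpM2l ?mulr_ge0//; ring.
  by rewrite (le_trans h')// lerDr ltW// divr_gt0.
have hq : binomial_mean w n (fun i => e / 2 + c * q i) <= e.
  rewrite mean_lin mean_cst mean_sqr subrr expr0n/= addr0.
  have -> : c * (n%:R * w * (1 - w)) = 8 * M * (w * (1 - w)) / (d ^+ 2 * n%:R).
    by rewrite /c; field; rewrite !gt_eqF.
  have h : 8 * M * (w * (1 - w)) / (d ^+ 2 * n%:R) <= e / 2.
    rewrite ler_pdivrMr ?mulr_gt0 ?exprn_gt0//.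
    have w4 : w * (1 - w) <= 4^-1 by have := sqr_ge0 (w - 2^-1); lra.
    have : 8 * M * (w * (1 - w)) <= 8 * M * 4^-1 by rewrite ler_wpM2l ?mulr_ge0.
    by move: nle; lra.
  by lra.
have e1 : u x = binomial_mean w n (fun=> u x) by rewrite mean_cst.
have lo : - e <= binomial_mean w n (fun i => u (X i)) - u x.
  have := @mean_le w n (fun i => u x + (- 1) * (e / 2 + c * q i)) (fun i => u (X i)) w01.
  rewrite mean_lin mean_cst => h; move: hq; set B := binomial_mean w n (fun i => e / 2 + c * q i) in h *.
  suff : u x + -1 * B <= binomial_mean w n (fun i => u (X i)) by lra.
  apply: h => i /key; rewrite ler_norml; move: (c * q i) (u (X i)) => z t /andP[]; lra.
have hi : binomial_mean w n (fun i => u (X i)) - u x <= e.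
  have := @mean_le w n (fun i => u (X i)) (fun i => u x + 1 * (e / 2 + c * q i)) w01.
  rewrite mean_lin mean_cst => h; move: hq; set B := binomial_mean w n (fun i => e / 2 + c * q i) in h *.
  suff : binomial_mean w n (fun i => u (X i)) <= u x + 1 * B by lra.
  apply: h => i /key; rewrite ler_norml; move: (c * q i) (u (X i)) => z t /andP[]; lra.
by rewrite distrC ler_norml lo hi.
Qed.

End Weierstrass.

(** * Antiderivatives and integration by parts *)

Section legendre_antiderivatives.
Context {R : realType}.
Implicit Types (n k : nat) (t : R).

(* [legendre_prim k n] is the [k]-fold antiderivative of [P_n] vanishing at 1,
   up to the sign (-1)^k, as long as [k <= n]. *)
Fixpoint legendre_prim k n : {poly R} :=
  if k is k'.+1 then
    (2 * n%:R + 1)^-1 *: (legendre_prim k' n.-1 - legendre_prim k' n.+1)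
  else legendre n.

Let primS k n : legendre_prim k.+1 n =
  (2 * n%:R + 1)^-1 *: (legendre_prim k n.-1 - legendre_prim k n.+1).
Proof. by []. Qed.

Let den_neq0 n : 2 * n%:R + 1 != 0 :> R.
Proof. by rewrite gt_eqF// ltr_wpDl// mulr_ge0. Qed.

Lemma deriv_legendre_sub n : (legendre n.+2)^`() - (legendre n)^`() =
  (2 * n.+1%:R + 1) *: legendre n.+1 :> {poly R}.
Proof.
have e1 := @deriv_legendreS R n.+1; have e2 := @deriv_legendre_pred R n.
move: e1 e2; move: (@legendre R n) (@legendre R n.+1) (@legendre R n.+2) => r s p e1 e2.
have -> : r^`() = 'X * s^`() - n.+1%:R *: s by rewrite -e2 subKr.
have -> : 2 * n.+1%:R + 1 = n.+1%:R + n.+2%:R :> R by rewrite -!natr1; ring.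
by rewrite e1 [in RHS]scalerDl opprB [LHS]addrC addrA subrK.
Qed.

(** The bound [k < n] ensures that every [n.-1] met in the recursion is a true predecessor. *)
Lemma deriv_legendre_prim k n : (k < n)%N ->
  (legendre_prim k.+1 n)^`() = - legendre_prim k n.
Proof.
elim: k n => [|k IH] [|n]// kn.
  rewrite primS /= derivZ derivB -opprB deriv_legendre_sub.
  by move: (legendre n.+1) => p; rewrite scalerN scalerA mulVf ?scale1r.
have h1 := IH n kn; have h2 := IH n.+2 (leqW (ltnW kn)).
rewrite primS derivZ derivB {IH}h1 h2 primS /=.
by rewrite -opprD scalerN.
Qed.

Lemma legendre_primN k n t : (k <= n)%N ->
  (legendre_prim k n).[- t] = (- 1) ^+ (n + k) * (legendre_prim k n).[t].
Proof.
elim: k n => [|k IH] n kn; first by rewrite addn0 legendreN.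
case: n kn => // n kn; have h1 := IH n kn; have h2 := IH n.+2 (ltnW (leqW kn)).
rewrite primS /=; move: (legendre_prim k n) (legendre_prim k n.+2) h1 h2 => p q h1 h2.
have e3 : (n.+1 + k.+1 = (n + k).+2)%N by rewrite addSn addnS.
rewrite !(hornerZ, hornerD, hornerN) h1 h2 e3 (_ : (n.+2 + k = (n + k).+2)%N)// !exprS.
by move: ((-1) ^+ (n + k)) (_^-1) => z c; ring.
Qed.

Lemma legendre_prim1 k n : (k < n)%N -> (legendre_prim k.+1 n).[1] = 0.
Proof.
elim: k n => [|k IH] [|n]// kn.
  have := @legendre1 R n; have := @legendre1 R n.+2.
  rewrite /=; move: (legendre n) (legendre n.+2) => p q pE qE.
  by rewrite !(hornerZ, hornerD, hornerN) pE qE subrr mulr0.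
have h1 := IH n kn; have h2 := IH n.+2 (leqW (ltnW kn)).
rewrite primS [n.+1.-1]/=; move: (legendre_prim k.+1 n) (legendre_prim k.+1 n.+2) h1 h2 => p q h1 h2.
by rewrite !(hornerZ, hornerD, hornerN) h1 h2 subrr mulr0.
Qed.

Lemma legendre_primN1 k n : (k < n)%N -> (legendre_prim k.+1 n).[-1] = 0.
Proof. by move=> kn; rewrite legendre_primN// legendre_prim1// mulr0. Qed.

Variable G : R -> R.
Hypothesis G_gt0 : forall s, 0 < s -> 0 < G s.
Hypothesis GS : forall s, 0 < s -> G (s + 1) = s * G s.
Hypothesis G1 : G 1 = 1.

Let Gnat n : G (n%:R + 1) = n`!%:R.
Proof.
elim: n => [|n IH]; first by rewrite add0r G1.
by rewrite GS// -natr1 IH factS natrM -natr1 mulrC.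
Qed.

(** At order 0 the expansion is Taylor's formula at 1. *)
Lemma frac_poly0 (p : {poly R}) t : t <= 1 -> frac_poly G 0 p t = p.[t].
Proof.
move=> t1; rewrite /frac_poly -[in RHS](subrK 1 t) [in RHS]addrC.
rewrite nderiv_taylor; last exact: mulrC.
apply: eq_bigr => j _.
rewrite nderivn_def hornerMn addr0 Gnat powR_mulrn ?subr_ge0// -[t - 1]opprB [in RHS]exprNn.
have j0 : j`!%:R != 0 :> R by rewrite pnatr_eq0 -lt0n fact_gt0.
rewrite -[_.[1] *+ _]mulr_natr.
by move: ((-1) ^+ j) ((1 - t) ^+ j) (_.[1]) (j`!%:R) j0 => x y z w w0; field.
Qed.

Lemma frac_poly_legendreS s n t :
  (2 * n.+1%:R + 1) * frac_poly G (s + 1) (legendre n.+1) t =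
  frac_poly G s (legendre n) t - frac_poly G s (legendre n.+2) t.
Proof.
rewrite -frac_polyZ -deriv_legendre_sub frac_polyB !frac_poly_deriv.
by rewrite !legendre1; ring.
Qed.

(** Both sides obey the same recursion in k. This identifies the fractional integrals of integer
    order with the antiderivatives that integration by parts produces. *)
Lemma frac_poly_legendre_prim k n t : (k <= n)%N -> t <= 1 ->
  frac_poly G k%:R (legendre n) t = (legendre_prim k n).[t].
Proof.
move=> + t1; elim: k n => [|k IH] n kn; first exact: frac_poly0.
case: n kn => // n kn; have h1 := IH n kn; have h2 := IH n.+2 (ltnW (leqW kn)).
rewrite -natr1 primS /= !(hornerZ, hornerD, hornerN) -h1 -h2 -frac_poly_legendreS.
by rewrite mulrA mulVf ?mul1r.
Qed.

End legendre_antiderivatives.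

(** * Integrals under x -> -x *)

Section reflection.
Context {R : realType}.
Notation mu := (@lebesgue_measure R).
Implicit Types (a b : R) (f : R -> R).

Let mopp : measurable_fun (setT : set (measurableTypeR R)) (-%R : measurableTypeR R -> measurableTypeR R).
Proof. by apply: (measurable_funTS (D := setT)); exact: oppr_measurable. Qed.

Let opp_itv a b : -%R @^-1` `[a, b]%classic = `[- b, - a]%classic :> set R.
Proof. by apply/seteqP; split=> x /=; rewrite !in_itv/= lerNl (lerNr x) andbC. Qed.

Let mu_opp (A : set R) : measurable A -> mu A = mu (-%R @^-1` A).
Proof.
move=> mA; have := @lebesgue_measure_unique R (pushforward mu (-%R : measurableTypeR R -> measurableTypeR R)).
apply => // X /ocitvP[->|[[x y] /= xy ->]]; first by rewrite measure0.
rewrite [RHS](_ : _ = mu `[- y, - x[%classic); last first.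
  congr (mu _); apply/seteqP; split=> z /=; rewrite !in_itv/=.
    by rewrite ltrNr lerNl andbC.
  by rewrite ltrNr lerNl andbC.
by rewrite !lebesgue_measure_itv/= !lte_fin ltrN2 opprK addrC.
Qed.

Let ge0_reflect a b (h : R -> \bar R) :
  measurable_fun (`[a, b]%classic : set (measurableTypeR R)) h -> (forall x, 0 <= h x)%E ->
  (\int[mu]_(x in `[a, b]) h x = \int[mu]_(x in `[(- b)%R, (- a)%R]) h (- x)%R)%E.
Proof.
move=> mh h0; rewrite -opp_itv.
rewrite -(ge0_integral_pushforward mopp mu (measurable_itv `[a, b]) mh); last by move=> x _.
by apply: eq_measure_integral => A mA _; exact: mu_opp.
Qed.

Lemma Rintegral_reflect a b f : measurable_fun `[a, b] f ->
  \int[mu]_(x in `[a, b]) f x = \int[mu]_(x in `[- b, - a]) f (- x).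
Proof.
move=> mf; rewrite /Rintegral; congr fine.
have mEf : measurable_fun (`[a, b]%classic : set (measurableTypeR R)) (EFin \o f).
  exact/measurable_EFinP.
rewrite [LHS]integralE [RHS]integralE.
rewrite (ge0_reflect (measurable_funepos mEf) (funepos_ge0 _)).
rewrite (ge0_reflect (measurable_funeneg mEf) (funeneg_ge0 _)).
by congr (_ - _)%E; apply: eq_integral => x _; rewrite ?funeposE ?funenegE.
Qed.

Lemma integrable_reflect a b f : mu.-integrable `[a, b] (EFin \o f) ->
  mu.-integrable `[- b, - a] (EFin \o (fun x => f (- x))).
Proof.
move=> /integrableP[mf fi]; apply/integrableP; split.
  have mI : measurable (`[a, b]%classic : set (measurableTypeR R)) by exact: measurable_itv.
  have mr := (measurable_restrictT (EFin \o f) mI).1 mf.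
  have mc := measurableT_comp mr mopp.
  apply: eq_measurable_fun (measurable_funTS mc) => x; rewrite inE/= in_itv/= => xI.
  by rewrite patchE ifT// inE/= in_itv/=; lra.
apply: le_lt_trans fi; rewrite le_eqVlt; apply/orP; left; apply/eqP/esym.
have mh : measurable_fun (`[a, b]%classic : set (measurableTypeR R)) (fun x => `|(EFin \o f) x|%E).
  exact: measurableT_comp.
by rewrite (ge0_reflect mh).
Qed.

(* No integrability is needed: both sides are 0 when an integral is infinite. *)
Lemma Rintegral_signM (n : nat) (D : set R) f :
  \int[mu]_(x in D) ((- 1) ^+ n * f x) = (- 1) ^+ n * \int[mu]_(x in D) f x.
Proof.
rewrite -signr_odd; case: (odd n); last first.
  by rewrite expr0 mul1r; apply: eq_Rintegral => x _; rewrite mul1r.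
rewrite expr1 mulN1r; under eq_Rintegral do rewrite mulN1r.
rewrite /Rintegral [in LHS]integralE [in RHS]integralE.
have -> : ((fun x => (- f x)%:E)^\+)%E = ((EFin \o f)^\-)%E.
  by apply/funext => x; rewrite funeposE funenegE.
have -> : ((fun x => (- f x)%:E)^\-)%E = ((EFin \o f)^\+)%E.
  by apply/funext => x; rewrite funeposE funenegE /= opprK.
have : (0 <= \int[mu]_(x in D) ((EFin \o f)^\-)%E x)%E.
  by apply: integral_ge0 => x _; exact: funeneg_ge0.
have : (0 <= \int[mu]_(x in D) ((EFin \o f)^\+)%E x)%E.
  by apply: integral_ge0 => x _; exact: funepos_ge0.
case: (\int[mu]_(x in D) ((EFin \o f)^\+)%E x)%E => [y| |] //;
case: (\int[mu]_(x in D) ((EFin \o f)^\-)%E x)%E => [z| |] //=; rewrite ?oppr0//.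
by move=> _ _; rewrite opprB.
Qed.

Lemma ae_reflect (P : R -> Prop) : {ae mu, forall x, P x} -> {ae mu, forall x, P (- x)}.
Proof.
move=> [A [mA A0 AP]]; exists (-%R @^-1` A); split.
- by rewrite -[X in measurable X]setTI; exact: mopp.
- by rewrite -mu_opp.
- by move=> x /= Px; apply: AP.
Qed.

Lemma ae_imp (P Q : R -> Prop) : (forall x, P x -> Q x) -> {ae mu, forall x, P x} ->
  {ae mu, forall x, Q x}.
Proof. by move=> PQ; apply: filterS => //; exact: (ae_filter_ringOfSetsType mu). Qed.

Lemma ae_and (P Q : R -> Prop) : {ae mu, forall x, P x} -> {ae mu, forall x, Q x} ->
  {ae mu, forall x, P x /\ Q x}.
Proof. by move=> hP hQ; apply: filterI hP hQ; exact: (ae_filter_ringOfSetsType mu). Qed.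

End reflection.

(** * Fractional integration by parts on [a, 1] *)

Section right_half.
Context {R : realType}.
Notation mu := (@lebesgue_measure R).
Implicit Types (y s t : R) (p : {poly R}).

Variable G : R -> R.
Hypothesis G_gt0 : forall s, 0 < s -> 0 < G s.
Hypothesis GS : forall s, 0 < s -> G (s + 1) = s * G s.
Hypothesis G1 : G 1 = 1.
Hypothesis GD_le : forall x s, 0 < x -> 0 <= s <= 1 -> G (x + s) <= x `^ s * G x.

Let Rintegral_11 (f : R -> R) : \int[mu]_(x in `[1, 1]) f x = 0.
Proof. by rewrite set_itv1 Rintegral_set1. Qed.

Lemma frac_poly1 s p : 0 < s -> frac_poly G s p 1 = 0.
Proof.
move=> s0; rewrite /frac_poly big1// => j _.
by rewrite subrr powR0 ?mulr0 ?mul0r// gt_eqF// ltr_wpDl.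
Qed.

Lemma measurable_frac_poly (D : set R) s p : measurable D -> measurable_fun D (frac_poly G s p).
Proof.
move=> mD; apply: measurable_sum => j; apply: measurable_funM => //.
apply: measurable_funM => //.
apply: (measurableT_comp (f := fun x => x `^ (j%:R + s))); first exact: measurable_powR.
by apply: measurable_funB.
Qed.

Lemma frac_poly_bounded s p (a : R) : 0 <= s ->
  exists K, forall t, a <= t <= 1 -> `|frac_poly G s p t| <= K.
Proof.
move=> s0; rewrite /frac_poly.
exists (\sum_(j < size p) `|(- 1) ^+ j * p^`(j).[1]| * (1 - a) `^ (j%:R + s) / G (j%:R + s + 1)).
move=> t /andP[at_ t1]; apply: le_trans (ler_norm_sum _ _ _) _; apply: ler_sum => j _.
have G0 : 0 < G (j%:R + s + 1) by apply: G_gt0; rewrite ltr_wpDl// addr_ge0.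
rewrite !normrM [`|_^-1|]gtr0_norm ?invr_gt0// ler_wpM2r ?invr_ge0 ?(ltW G0)//.
rewrite [`|_ `^ _|]ger0_norm ?powR_ge0// ler_wpM2l ?mulr_ge0//.
have j0 : 0 <= j%:R + s by rewrite addr_ge0.
rewrite ge0_ler_powR// ?nnegrE ?subr_ge0//; first exact: le_trans t1.
by rewrite lerD2l lerN2.
Qed.

Section order_rho.
Variable rho : R.
Hypothesis rho_gt0 : 0 < rho.

Let kappa t : R := t `^ (rho - 1).

Let kappai y : y <= 1 -> mu.-integrable `[y, 1] (EFin \o (fun s => kappa (s - y))).
Proof.
rewrite le_eqVlt => /predU1P[->|y1].
  apply: (integrable_bounded_itv (K := kappa 0)).
    apply: (measurableT_comp (f := kappa)); first exact: measurable_powR.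
    exact: measurable_funB.
  move=> x /andP[x1 x2]; have -> : x = 1 by apply/eqP; rewrite eq_le x1 x2.
  by rewrite subrr ger0_norm ?powR_ge0.
have := integrable_Beta y1 rho_gt0 (lexx 1).
by apply: eq_integrable => // x _; rewrite /= subrr powRr0 mulr1.
Qed.

Let kappaI y : y <= 1 -> \int[mu]_(s in `[y, 1]) kappa (s - y) =
  G rho / G (rho + 1) * (1 - y) `^ rho.
Proof.
rewrite le_eqVlt => /predU1P[->|y1].
  by rewrite Rintegral_11 subrr powR0 ?mulr0// gt_eqF.
have := Rintegral_Beta G_gt0 GS G1 GD_le y1 rho_gt0 (lexx 1).
by rewrite G1 mulr1 addrK => <-; apply: eq_Rintegral => x _; rewrite subrr powRr0 mulr1.
Qed.

(** The semigroup law I^rho I^m = I^(m+rho), term by term from the Beta integral, whose second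
    parameter j + m + 1 is at least 1. *)
Lemma Rintegral_frac_poly m p y : 0 <= m -> y <= 1 ->
  \int[mu]_(s in `[y, 1]) (frac_poly G m p s * (s - y) `^ (rho - 1)) =
  G rho * frac_poly G (m + rho) p y.
Proof.
move=> m0; rewrite le_eqVlt => /predU1P[->|y1].
  by rewrite Rintegral_11 frac_poly1 ?mulr0// ltr_wpDl.
pose c j : R := (- 1) ^+ j * p^`(j).[1] / G (j%:R + m + 1).
pose h j s : R := (s - y) `^ (rho - 1) * (1 - s) `^ (j%:R + m + 1 - 1).
have b1 (j : nat) : 1 <= j%:R + m + 1 by rewrite lerDr addr_ge0.
have ih (j : nat) : mu.-integrable `[y, 1] (EFin \o h j).
  exact: (integrable_Beta y1 rho_gt0 (b1 j)).
have -> : \int[mu]_(s in `[y, 1]) (frac_poly G m p s * (s - y) `^ (rho - 1)) =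
    \int[mu]_(s in `[y, 1]) (\sum_(j < size p) c j * h j s).
  apply: eq_Rintegral => s _; rewrite /frac_poly mulr_suml; apply: eq_bigr => j _.
  by rewrite /c /h addrK; ring.
rewrite Rintegral_sum//; last by move=> j; apply: integrableZl_EFin.
rewrite /frac_poly mulr_sumr; apply: eq_bigr => j _; rewrite RintegralZl//.
rewrite (Rintegral_Beta G_gt0 GS G1 GD_le y1 rho_gt0 (b1 j)) /c.
rewrite (_ : rho + (j%:R + m + 1) - 1 = j%:R + (m + rho)); last by ring.
rewrite (_ : rho + (j%:R + m + 1) = j%:R + (m + rho) + 1); last by ring.
have G0 z : 0 < z -> G z != 0 by move=> z0; rewrite gt_eqF// G_gt0.
field; rewrite !G0//; first by rewrite (lt_le_trans _ (b1 j)).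
by rewrite ltr_wpDl// !addr_ge0// ltW.
Qed.

(** Fractional integration by parts: Fubini with the kernel (s - y)^(rho - 1), then the semigroup
    law. *)
Lemma frac_poly_Fubini m p (a : R) (f : R -> R) : 0 <= m -> a <= 1 ->
  mu.-integrable `[a, 1] (EFin \o f) ->
  \int[mu]_(s in `[a, 1])
    (frac_poly G m p s * \int[mu]_(y in `[a, s]) (f y * (s - y) `^ (rho - 1))) =
  G rho * \int[mu]_(y in `[a, 1]) (f y * frac_poly G (m + rho) p y).
Proof.
move=> m0 a1 fi; have [K PhiK] := frac_poly_bounded p a m0.
rewrite (@triangle_Fubini R a 1 f (frac_poly G m p) kappa K (G rho / G (rho + 1) * (1 - a) `^ rho))//.
- under eq_Rintegral => y.
    rewrite inE/= in_itv/= => /andP[ay y1].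
    rewrite Rintegral_frac_poly// mulrCA.
    over.
  rewrite RintegralZl//.
  have [K' K'P] := frac_poly_bounded p a (addr_ge0 m0 (ltW rho_gt0)).
  by apply: (integrable_boundedM fi _ K'P); exact: measurable_frac_poly.
- exact: measurable_frac_poly.
- exact: measurable_powR.
- by move=> t; exact: powR_ge0.
- by move=> y /andP[_ y1]; exact: kappai.
- move=> y /andP[ay y1]; rewrite kappaI// ler_wpM2l//.
    by rewrite divr_ge0// ltW// G_gt0// addr_gt0.
  by rewrite ge0_ler_powR ?nnegrE ?subr_ge0 ?(ltW rho_gt0)// lerD2l lerN2.
Qed.

End order_rho.

Lemma Rintegral_frac_poly_prim m p c d : 0 <= m -> c <= d -> d <= 1 ->
  \int[mu]_(s in `[c, d]) frac_poly G m p s =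
  frac_poly G (m + 1) p c - frac_poly G (m + 1) p d.
Proof.
move=> m0 cd d1.
have e y : y <= 1 -> \int[mu]_(s in `[y, 1]) frac_poly G m p s = frac_poly G (m + 1) p y.
  move=> y1; have := Rintegral_frac_poly ltr01 p m0 y1; rewrite G1 mul1r => <-.
  by apply: eq_Rintegral => s _; rewrite subrr powRr0 mulr1.
have [K PhiK] := frac_poly_bounded p c m0.
have i : mu.-integrable `[c, 1] (EFin \o frac_poly G m p).
  by apply: (integrable_bounded_itv (K := K)) => //; exact: measurable_frac_poly.
have := Rintegral_itv_split cd d1 i; rewrite !e//; last exact: le_trans d1.
by move=> ->; rewrite addrK.
Qed.

Lemma bounded_variation_frac_poly_le m p (a M : R) (v : R -> R) : 0 <= m -> a < 1 ->
  bounded_variation a 1 v ->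
  (forall t, a <= t <= 1 -> `|frac_poly G (m + 1) p t| <= M) ->
  `|\int[mu]_(s in `[a, 1]) (v s * frac_poly G m p s)| <=
  `|frac_poly G (m + 1) p a| * `|lim (v x @[x --> a^'+])| +
  M * fine (total_variation a 1 v).
Proof.
move=> m0 a1 bv HM; have [K PhiK] := frac_poly_bounded p a m0.
apply: (bounded_variation_Rintegral_le a1 bv _ PhiK _ HM).
- exact: measurable_frac_poly.
- by move=> c d _ cd d1; exact: Rintegral_frac_poly_prim.
- by rewrite frac_poly1// ltr_wpDl.
Qed.

(** Applied with m = mu and rho = k - mu, where [f] represents u^(k) and [v] its integral of order
    rho. It exchanges [f] against order k for [v] against order mu, one below the order at which a
    uniform bound is available. *)
Lemma right_half_le m rho p (a M : R) (f v : R -> R) : 0 <= m -> 0 < rho -> a < 1 ->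
  mu.-integrable `[a, 1] (EFin \o f) -> bounded_variation a 1 v ->
  {ae mu, forall x, a <= x <= 1 ->
    v x = (G rho)^-1 * \int[mu]_(y in `[a, x]) (f y * (x - y) `^ (rho - 1))} ->
  (forall t, a <= t <= 1 -> `|frac_poly G (m + 1) p t| <= M) ->
  `|\int[mu]_(y in `[a, 1]) (f y * frac_poly G (m + rho) p y)| <=
  M * (`|lim (v x @[x --> a^'+])| + fine (total_variation a 1 v)).
Proof.
move=> m0 rho0 a1 fi bv vE HM.
have G0 : G rho != 0 by rewrite gt_eqF// G_gt0.
have := frac_poly_Fubini rho0 p m0 (ltW a1) fi.
have -> : \int[mu]_(s in `[a, 1])
    (frac_poly G m p s * \int[mu]_(y in `[a, s]) (f y * (s - y) `^ (rho - 1))) =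
    G rho * \int[mu]_(s in `[a, 1]) (v s * frac_poly G m p s).
  rewrite -RintegralZl//; last first.
    have [K PhiK] := frac_poly_bounded p a m0.
    apply: (integrable_bounded_variationM (ltW a1) bv _ PhiK).
    exact: measurable_frac_poly.
  apply: ae_eq_Rintegral_any; apply: filterS vE; first exact: (ae_filter_ringOfSetsType mu).
  move=> x xE /=; rewrite in_itv/= => /xE ->.
  by move: (\int[mu]_(y in _) _) (frac_poly _ _ _ _) => I q; field.
move=> /(mulfI G0) <-.
apply: le_trans (bounded_variation_frac_poly_le m0 a1 bv HM) _.
by rewrite mulrDr lerD2r ler_wpM2r// HM// lexx ltW.
Qed.

End right_half.

(** * Repeated integration by parts *)

Section abs_continuous_parts.
Context {R : realType}.
Notation mu := (@lebesgue_measure R).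
Implicit Types (a b : R) (f g h u : R -> R) (p : {poly R}).

Lemma abs_continuous_uniform a b f : abs_continuous a b f ->
  forall e : R, 0 < e -> exists2 d : R, 0 < d & forall x y, a <= x <= b -> a <= y <= b ->
    `|x - y| < d -> `|f x - f y| < e.
Proof.
move=> fac e e0; have e20 : 0 < e / 2 by rewrite divr_gt0.
have [d d0 H] := abs_continuous_list fac e20; exists d => // x y.
wlog xy : x y / y <= x.
  move=> h xab yab; have [|/ltW] := leP y x => xy; first exact: h.
  by rewrite distrC [X in _ -> X < _]distrC; exact: h.
move=> /andP[ax xb] /andP[ay yb]; rewrite ger0_norm ?subr_ge0// => xyd.
have := H [:: (y, x)]; rewrite /disjoint_itvs /total_length !big_seq1/= ay xb xy.
by move=> /(_ isT xyd) /le_lt_trans; apply; rewrite ltr_pdivrMr// ltr_pMr// ltr1n.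
Qed.

Lemma abs_continuous_within a b f : abs_continuous a b f -> {within `[a, b], continuous f}.
Proof.
move=> fac; apply/subspace_continuousP => x /=; rewrite in_itv/= => xab.
apply/cvgrPdist_lt => e e0; have [d d0 H] := abs_continuous_uniform fac e0.
rewrite near_withinE; have := nbhsx_ballx x d d0; apply: filterS => y xy /=.
by rewrite in_itv/= => yab; exact: H.
Qed.

Let integrable_within_horner a b f p : {within `[a, b], continuous f} ->
  mu.-integrable `[a, b] (EFin \o (fun x => f x * p.[x])).
Proof.
move=> fc; apply: within_continuous_integrable.
have pc : {within `[a, b], continuous (fun x => p.[x])}.
  by apply: continuous_subspaceT => x; exact: continuous_horner.
by move=> x; apply: cvgM; [exact: fc|exact: pc].
Qed.

Lemma integrable_abs_continuous_horner a b f p : abs_continuous a b f ->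
  mu.-integrable `[a, b] (EFin \o (fun x => f x * p.[x])).
Proof. by move=> /abs_continuous_within; exact: integrable_within_horner. Qed.

Lemma integrable_hornerM a b g p : mu.-integrable `[a, b] (EFin \o g) ->
  mu.-integrable `[a, b] (EFin \o (fun x => g x * p.[x])).
Proof.
move=> gi; have [ab|ba] := leP a b; last first.
  by rewrite set_itv_ge ?bnd_simp -?ltNge//; exact: integrable_set0.
have pc : {within `[a, b], continuous (fun x => p.[x])}.
  by apply: continuous_subspaceT => x; exact: continuous_horner.
have [K pK] := within_continuous_bounded ab pc.
by apply: (integrable_boundedM gi _ pK); exact: subspace_continuous_measurable_fun.
Qed.

(** Fubini on the triangle with kernel 1: the inner integrals are f(s) - f(a) and -p(y), and the
    constant f(a) drops out because p' has integral 0. *)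
Lemma abs_continuous_by_parts a b f g p : a < b -> abs_continuous a b f ->
  mu.-integrable setT (EFin \o g) ->
  (forall x, a <= x <= b -> f x = f a + \int[mu]_(t in `[a, x]) g t) ->
  p.[a] = 0 -> p.[b] = 0 ->
  \int[mu]_(x in `[a, b]) (f x * p^`().[x]) = - \int[mu]_(x in `[a, b]) (g x * p.[x]).
Proof.
move=> ab fac gi fE pa pb.
have gi' : mu.-integrable `[a, b] (EFin \o g) by apply: integrableS gi.
have pm q : measurable_fun `[a, b] (fun x => q.[x]).
  by have /measurable_int/measurable_EFinP := integrable_horner q a b.
have pbd q : exists K, forall x, a <= x <= b -> `|q.[x]| <= K.
  have qc : {within `[a, b], continuous (fun x => q.[x])}.
    by apply: continuous_subspaceT => x; exact: continuous_horner.
  exact: within_continuous_bounded (ltW ab) qc.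
have [K p'K] := pbd p^`().
have pI y : a <= y <= b -> \int[mu]_(s in `[y, b]) p^`().[s] = - p.[y].
  move=> /andP[ay]; rewrite le_eqVlt => /predU1P[->|yb].
    by rewrite set_itv1 Rintegral_set1 pb oppr0.
  by have := Rintegral_deriv_poly p yb; rewrite pb sub0r.
have gpi := integrable_hornerM p gi'.
have fqi := integrable_abs_continuous_horner p^`() fac.
have qi : mu.-integrable `[a, b] (EFin \o (fun x => p^`().[x])) := integrable_horner _ a b.
have pmq := pm p^`().
move: (horner p^`()) (horner p) p'K pI gpi fqi qi pmq pa pb => q P qK qI gpi fqi qi pmq pa pb.
have H : \int[mu]_(s in `[a, b]) (q s * \int[mu]_(y in `[a, s]) (g y * cst 1 (s - y))) =
    \int[mu]_(y in `[a, b]) (g y * \int[mu]_(s in `[y, b]) (q s * cst 1 (s - y))).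
  apply: (@triangle_Fubini R a b g q (cst 1) K (b - a) gi' pmq qK) => //.
    by move=> y _; exact: integrable_cst_itv.
  by move=> y /andP[ay yb]; rewrite Rintegral_cst_itv// mul1r lerD2l lerN2.
have F1 s : a <= s <= b -> \int[mu]_(y in `[a, s]) (g y * cst 1 (s - y)) = f s - f a.
  move=> sab; rewrite (fE s sab) addrAC subrr add0r.
  by apply: eq_Rintegral => y _; rewrite /= mulr1.
have F2 y : a <= y <= b -> \int[mu]_(s in `[y, b]) (q s * cst 1 (s - y)) = - P y.
  by move=> yab; rewrite -(qI y yab); apply: eq_Rintegral => s _; rewrite /= mulr1.
have aab : a <= a <= b by rewrite lexx ltW.
have mI : measurable (`[a, b]%classic : set (measurableTypeR R)) by exact: measurable_itv.
have iZ : mu.-integrable `[a, b] (EFin \o (fun x => f a * q x)).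
  exact: (integrableZl_EFin (f a) mI qi).
have e1 : \int[mu]_(s in `[a, b]) (f s * q s - f a * q s) =
    \int[mu]_(s in `[a, b]) (f s * q s) - \int[mu]_(s in `[a, b]) (f a * q s).
  exact: (RintegralB mI fqi iZ).
have e2 : \int[mu]_(s in `[a, b]) (f a * q s) = f a * \int[mu]_(s in `[a, b]) q s.
  exact: (RintegralZl (f a) mI qi).
have e3 : \int[mu]_(x in `[a, b]) (-1 * (g x * P x)) = -1 * \int[mu]_(x in `[a, b]) (g x * P x).
  exact: (RintegralZl (-1) mI gpi).
rewrite -mulN1r -e3; transitivity (\int[mu]_(s in `[a, b]) (f s * q s - f a * q s)).
  by rewrite e1 e2 (qI a aab) pa oppr0 mulr0 subr0.
have e4 : \int[mu]_(s in `[a, b]) (f s * q s - f a * q s) = \int[mu]_(s in `[a, b])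
    (q s * \int[mu]_(y in `[a, s]) (g y * cst 1 (s - y))).
  apply: eq_Rintegral => s; rewrite inE/= in_itv/= => sab.
  by rewrite (F1 s sab) -mulrBl mulrC.
rewrite e4 H; apply: eq_Rintegral => y; rewrite inE/= in_itv/= => yab.
by rewrite (F2 y yab) mulN1r -mulrN.
Qed.

Let ae_ends (P : R -> Prop) a b : {ae mu, forall x, a < x < b -> P x} ->
  {ae mu, forall x, a <= x <= b -> P x}.
Proof.
move=> h.
have ne c : {ae mu, forall x : R, x <> c}.
  exists [set c]; split => //; first exact: lebesgue_measure_set1.
  by move=> x /= /contrapT.
have := ae_and h (ae_and (ne a) (ne b)); apply: ae_imp => x [hx [xa xb]] /andP[ax bx].
by apply: hx; rewrite !lt_neqAle ax bx !andbT; apply/andP; split; apply/eqP => // /esym.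
Qed.

(** [h] is the absolutely continuous extension of u^(j) to the closed interval; its density serves
    as u^(j+1), and the boundary terms vanish because [legendre_prim j.+1 n] does at -1 and 1. *)
Let derive1_step j u h : abs_continuous (-1) 1 h ->
  (forall x, -1 < x < 1 -> h x = derive1n j u x) ->
  exists g, [/\ mu.-integrable setT (EFin \o g),
    {ae mu, forall x, -1 <= x <= 1 -> derive1n j.+1 u x = g x} &
    forall n, (j < n)%N -> \int[mu]_(x in `[-1, 1]) (h x * (legendre_prim j n).[x]) =
      \int[mu]_(x in `[-1, 1]) (g x * (legendre_prim j.+1 n).[x])].
Proof.
move=> hac hu; have ab : -1 < 1 :> R by rewrite gtrN.
have [g [gi gE]] := abs_continuous_primitive ab hac.
exists g; split => // [|n jn].
  have := primitive_derive1 gi gE => H; apply: ae_ends; apply: ae_imp H => x H x1.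
  have [_ <-] := H x1; rewrite derive1nS !derive1E; apply: near_eq_derive.
  have xI : x \in `]-1, 1[ by rewrite in_itv.
  near=> y; have : y \in `]-1, 1[ by near: y; exact: near_in_itvoo.
  by rewrite in_itv/= => y1; rewrite hu.
have := @abs_continuous_by_parts (-1) 1 h g (legendre_prim j.+1 n) ab hac gi gE.
rewrite (legendre_primN1 jn) (legendre_prim1 jn) => /(_ erefl erefl).
rewrite (deriv_legendre_prim jn) => e; apply: oppr_inj; rewrite -e -[LHS]mulN1r.
have mI : measurable (`[-1, 1]%classic : set (measurableTypeR R)) by exact: measurable_itv.
move: (legendre_prim j n) => P; have hi := integrable_abs_continuous_horner P hac.
rewrite -(RintegralZl (-1) mI hi); apply: eq_Rintegral => x _.
by rewrite hornerN mulN1r mulrN.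
Unshelve. all: by end_near. Qed.

(** [derive1_step] is iterated. Below order k its density is replaced by the extension that
    [ac_derivs] provides, equal to it almost everywhere on [-1, 1]; at order k the density itself is
    kept. *)
Lemma ac_derivs_density k u : (0 < k)%N -> ac_derivs (-1) 1 k u ->
  exists g, [/\ mu.-integrable setT (EFin \o g),
    {ae mu, forall x, -1 <= x <= 1 -> derive1n k u x = g x} &
    forall n, (k <= n)%N -> \int[mu]_(x in `[-1, 1]) (u x * (legendre n).[x]) =
      \int[mu]_(x in `[-1, 1]) (g x * (legendre_prim k n).[x])].
Proof.
case: k => // k _ [uac ud].
suff main j : (j <= k)%N -> exists h, [/\ abs_continuous (-1) 1 h,
    forall x, -1 < x < 1 -> h x = derive1n j u x &
    forall n, (j <= n)%N -> \int[mu]_(x in `[-1, 1]) (u x * (legendre n).[x]) =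
      \int[mu]_(x in `[-1, 1]) (h x * (legendre_prim j n).[x])].
  have [h [hac hu hE]] := main k (leqnn k).
  have [g [gi gu gE]] := derive1_step hac hu; exists g; split => // n kn.
  by rewrite hE ?(ltnW kn)// gE.
elim: j => [_|j IH jk]; first by exists u.
have [h [hac hu hE]] := IH (ltnW jk).
have [g [gi gu gE]] := derive1_step hac hu.
have [_ [h' h'ac h'u]] := ud j.+1 jk.
exists h'; split => // n jn; rewrite hE ?(ltnW jn)// gE//.
apply: ae_eq_Rintegral_any.
have : {ae mu, forall x, -1 <= x <= 1 -> h' x = derive1n j.+1 u x}.
  by apply: ae_ends; apply: aeW => x; exact: h'u.
move=> H; have := ae_and gu H; apply: ae_imp => x [gx h'x] /=; rewrite in_itv/= => x1.
by rewrite -gx// h'x.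
Qed.

End abs_continuous_parts.

(** * The projection error *)

Section legendre_projection.
Context {R : realType}.
Notation mu := (@lebesgue_measure R).
Variable u : R -> R.
Hypothesis uac : abs_continuous (-1) 1 u.
Implicit Types (p q r : {poly R}) (n m N d : nat).

Let I11 : measurable (`[-1, 1]%classic : set (measurableTypeR R)).
Proof. exact: measurable_itv. Qed.

Let wc (f : R -> R) := {within `[-1, 1], continuous f}.

Let wcu : wc u. Proof. exact: abs_continuous_within. Qed.

Let wcp p : wc (fun x => p.[x]).
Proof. by apply: continuous_subspaceT => x; exact: continuous_horner. Qed.

Let wcB f g : wc f -> wc g -> wc (fun x => f x - g x).
Proof. by move=> fc gc x; apply: cvgB; [exact: fc|exact: gc]. Qed.

Let wcM f g : wc f -> wc g -> wc (fun x => f x * g x).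
Proof. by move=> fc gc x; apply: cvgM; [exact: fc|exact: gc]. Qed.

Arguments wcu : clear implicits.
Arguments wcp : clear implicits.
Arguments wcB {f g} _ _.
Arguments wcM {f g} _ _.

Let wci f : wc f -> mu.-integrable `[-1, 1] (EFin \o f).
Proof. exact: within_continuous_integrable. Qed.

Let int (f : R -> R) := \int[mu]_(x in `[-1, 1]) f x.

Let intD f g : wc f -> wc g -> int (fun x => f x + g x) = int f + int g.
Proof. by move=> /wci fi /wci gi; exact: (RintegralD I11 fi gi). Qed.

Let intB f g : wc f -> wc g -> int (fun x => f x - g x) = int f - int g.
Proof. by move=> /wci fi /wci gi; exact: (RintegralB I11 fi gi). Qed.

Let intZ c f : wc f -> int (fun x => c * f x) = c * int f.
Proof. by move=> /wci fi; exact: (RintegralZl c I11 fi). Qed.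

Let int_sum n (c : nat -> R) (f : nat -> R -> R) : (forall i, wc (f i)) ->
  int (fun x => \sum_(i < n) c i * f i x) = \sum_(i < n) c i * int (f i).
Proof.
move=> fc; have iZ (i : 'I_n) : mu.-integrable `[-1, 1] (EFin \o (fun x => c i * f i x)).
  exact: (integrableZl_EFin (c i) I11 (wci (fc i))).
rewrite /int (Rintegral_sum I11 iZ); apply: eq_bigr => i _.
exact: (RintegralZl (c i) I11 (wci (fc i))).
Qed.

Let eq_int f g : (forall x, f x = g x) -> int f = int g.
Proof. by move=> fg; apply: eq_Rintegral => x _. Qed.

Let horner_Lsum n (c : nat -> R) (k : nat -> nat) x :
  (\sum_(i < n) c i *: legendre (k i)).[x] = \sum_(i < n) c i * (legendre (k i)).[x].
Proof. by rewrite horner_sum; apply: eq_bigr => i _; rewrite hornerZ. Qed.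

Local Notation c := (legendre_coef u).
Let proj m := legendre_proj m u.

Let w n : R := 2 / (2 * n%:R + 1).

Lemma Rintegral_legendre_coef n :
  \int[mu]_(x in `[-1, 1]) (u x * (legendre n).[x]) = c n * (2 / (2 * n%:R + 1)).
Proof.
rewrite /legendre_coef; move: (\int[mu]_(x in _) _) => J; field.
by rewrite gt_eqF// ltr_wpDl// mulr_ge0.
Qed.

Let orth n m : int (fun x => (legendre n).[x] * (legendre m).[x]) = w n *+ (n == m).
Proof. exact: legendre_orthogonal. Qed.

Let size_proj m : (size (proj m) <= m.+1)%N.
Proof.
apply: (leq_trans (size_sum _ _ _)); apply/bigmax_leqP => i _.
by apply: (leq_trans (size_scale_leq _ _)); rewrite size_legendre.
Qed.

Let proj_orth m r : (size r <= m.+1)%N -> int (fun x => (u x - (proj m).[x]) * r.[x]) = 0.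
Proof.
move=> /legendre_span[d ->].
have e (i : nat) : (i < m.+1)%N -> int (fun x => (u x - (proj m).[x]) * (legendre i).[x]) = 0.
  move=> im; rewrite (eq_int (g := fun x => u x * (legendre i).[x] - (proj m).[x] * (legendre i).[x])).
    2: by move=> x; rewrite mulrBl.
  rewrite (intB (wcM wcu (wcp (legendre i))) (wcM (wcp (proj m)) (wcp (legendre i)))).
  have -> : int (fun x => u x * (legendre i).[x]) = c i * w i.
    exact: Rintegral_legendre_coef.
  have -> : int (fun x => (proj m).[x] * (legendre i).[x]) =
      int (fun x => \sum_(j < m.+1) c j * ((legendre j).[x] * (legendre i).[x])).
    apply: eq_int => x; rewrite /proj /legendre_proj (horner_Lsum _ _ id) mulr_suml.
    by apply: eq_bigr => j _; rewrite mulrA.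
  rewrite (@int_sum m.+1 c (fun j x => (legendre j).[x] * (legendre i).[x])).
    2: by move=> j; exact: (wcM (wcp _) (wcp _)).
  rewrite (bigD1 (Ordinal im))//= orth eqxx mulr1n big1 ?addr0 ?subrr// => j ji.
  by rewrite orth; case: eqVneq => [jE|_]; [case/eqP: ji; exact: val_inj|rewrite mulr0n mulr0].
rewrite (eq_int (g := fun x => \sum_(i < m.+1) d i * ((u x - (proj m).[x]) * (legendre i).[x]))).
  2: by move=> x; rewrite (horner_Lsum _ _ id) mulr_sumr; apply: eq_bigr => i _; rewrite mulrCA.
rewrite (@int_sum m.+1 d (fun i x => (u x - (proj m).[x]) * (legendre i).[x])).
  2: by move=> i; exact: (wcM (wcB wcu (wcp _)) (wcp _)).
by apply: big1 => i _; rewrite e ?mulr0.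
Qed.

Let sqr_int_ge0 f : 0 <= int (fun x => f x ^+ 2).
Proof. by apply: Rintegral_ge0 => x _; exact: sqr_ge0. Qed.

Let Pythagoras m q : (size q <= m.+1)%N ->
  int (fun x => (u x - q.[x]) ^+ 2) =
  int (fun x => (u x - (proj m).[x]) ^+ 2) + int (fun x => ((proj m - q).[x]) ^+ 2).
Proof.
move=> sq; have sr : (size (proj m - q)%R <= m.+1)%N.
  by rewrite (leq_trans (size_polyD _ _))// geq_max size_proj size_polyN.
have := proj_orth sr; set r := proj m - q => h.
have wr : wc (fun x => u x - (proj m).[x]) := wcB wcu (wcp _).
rewrite (eq_int (g := fun x => ((u x - (proj m).[x]) ^+ 2 + r.[x] ^+ 2) +
    2 * ((u x - (proj m).[x]) * r.[x]))); last first.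
  by move=> x; rewrite /r hornerD hornerN; ring.
have w2 : wc (fun x => (u x - (proj m).[x]) ^+ 2) := wcM wr wr.
have w3 : wc (fun x => r.[x] ^+ 2) := wcM (wcp r) (wcp r).
have w4 := wcM wr (wcp r).
have w5 : wc (fun x => (u x - (proj m).[x]) ^+ 2 + r.[x] ^+ 2).
  by move=> x; apply: cvgD; [exact: w2|exact: w3].
have w6 : wc (fun x => 2 * ((u x - (proj m).[x]) * r.[x])).
  by move=> x; apply: cvgMr; exact: w4.
by rewrite (intD w5 w6) (intD w2 w3) (intZ 2 w4) h mulr0 addr0.
Qed.

(** The polynomial E of the overview, with M = N + d. *)
Let blk N d : {poly R} := \sum_(i < d) c (N.+1 + i)%N *: legendre (N.+1 + i)%N.

Let proj_blk N d : proj (N + d) = proj N + blk N d.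
Proof.
have rec m : proj m.+1 = proj m + c m.+1 *: legendre m.+1.
  by rewrite /proj /legendre_proj big_ord_recr.
elim: d => [|d IH]; first by rewrite addn0 /blk big_ord0 addr0.
by rewrite addnS rec IH /blk big_ord_recr/= addrA addSn.
Qed.

Let blk_sqr N d : int (fun x => (blk N d).[x] ^+ 2) =
  \sum_(i < d) c (N.+1 + i)%N ^+ 2 * w (N.+1 + i)%N.
Proof.
pose k i := (N.+1 + i)%N.
have e (i : 'I_d) : int (fun x => (blk N d).[x] * (legendre (k i)).[x]) = c (k i) * w (k i).
  rewrite (eq_int (g := fun x => \sum_(j < d) c (k j) * ((legendre (k j)).[x] * (legendre (k i)).[x]))).
    2: by move=> x; rewrite /blk (horner_Lsum d (c \o k) k) mulr_suml; apply: eq_bigr => j _; rewrite mulrA.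
  rewrite (@int_sum d (c \o k) (fun j x => (legendre (k j)).[x] * (legendre (k i)).[x])).
    2: by move=> j; exact: (wcM (wcp _) (wcp _)).
  rewrite (bigD1 i)//= orth eqxx mulr1n big1 ?addr0// => j ji.
  rewrite orth; case: eqVneq => [jE|_]; last by rewrite mulr0n mulr0.
  by case/eqP: ji; apply: val_inj; exact: (addnI jE).
rewrite (eq_int (g := fun x => \sum_(i < d) c (k i) * ((blk N d).[x] * (legendre (k i)).[x]))).
  2: by move=> x; rewrite expr2 {1}/blk (horner_Lsum d (c \o k) k) mulr_suml; apply: eq_bigr => j _; rewrite -mulrA [(legendre _).[x] * _]mulrC.
rewrite (@int_sum d (c \o k) (fun i x => (blk N d).[x] * (legendre (k i)).[x])).
  2: by move=> i; exact: (wcM (wcp _) (wcp _)).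
by apply: eq_bigr => i _; rewrite e /= expr2 mulrA.
Qed.

(** By Pythagoras pi_M u is at least as close to u as any polynomial of degree at most M, hence as a
    Weierstrass approximant once M is large; the rest of the error is a block, bounded by [B]. *)
Lemma legendre_proj_error_le N (B : R) :
  (forall d, \sum_(i < d) c (N.+1 + i)%N ^+ 2 * (2 / (2 * (N.+1 + i)%N%:R + 1)) <= B) ->
  \int[mu]_(x in `[-1, 1]) (u x - (legendre_proj N u).[x]) ^+ 2 <= B.
Proof.
move=> dB; apply/ler_addgt0Pr => e e0.
have [M uM] : exists M, forall x, -1 <= x <= 1 -> `|u x| <= M.
  by apply: within_continuous_bounded; [lra|exact: wcu].
(* A uniform error e' gives a squared norm of at most 2 e'^2, since [-1, 1] has length 2, and 2 e'^2
   <= 2 e' <= e. *)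
pose e' := Num.min 1 (e / 2).
have e'0 : 0 < e' by rewrite lt_min ltr01 divr_gt0.
have e'1 : e' <= 1 by rewrite ge_min lexx.
have e'e : e' <= e / 2 by rewrite ge_min lexx orbT.
have [p pE] := Weierstrass_approximation uM (abs_continuous_uniform uac) e'0.
have sp : (size p <= (N + size p).+1)%N by rewrite ltnW// ltnS leq_addl.
have sN : (size (proj N) <= (N + size p).+1)%N.
  by rewrite (leq_trans (size_proj N))// ltnS leq_addr.
have P1 := Pythagoras sN; have P2 := Pythagoras sp.
rewrite -/(proj N) -/(int (fun x => (u x - (proj N).[x]) ^+ 2)) P1 addrC.
rewrite (_ : proj (N + size p) - proj N = blk N (size p)); last first.
  by rewrite proj_blk addrC addKr.
rewrite blk_sqr; apply: lerD; first exact: dB.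
have h : int (fun x => (u x - p.[x]) ^+ 2) <= int (fun=> e' ^+ 2).
  apply: le_Rintegral => //.
  - by apply: wci; exact: (wcM (wcB wcu (wcp p)) (wcB wcu (wcp p))).
  - exact: integrable_cst_itv.
  - move=> x /=; rewrite in_itv/= => /pE xp.
    by rewrite -[leLHS]real_normK ?num_real// lerXn2r ?nnegrE// ltW.
have h2 : int (fun=> e' ^+ 2) = e' ^+ 2 * (1 - -1) by apply: Rintegral_cst_itv; lra.
have h3 := sqr_int_ge0 (fun x => (proj (N + size p) - p).[x]).
have h4 : e' ^+ 2 <= e' by rewrite expr2 ler_piMr// ltW.
by move: P2 h; rewrite h2; lra.
Qed.

End legendre_projection.

(** * Uniform bounds for fractional integrals of Legendre sums *)

Section frac_legendre_sum.
Context {R : realType}.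
Variable G : R -> R.
Hypothesis G_gt0 : forall s, 0 < s -> 0 < G s.
Hypothesis GS : forall s, 0 < s -> G (s + 1) = s * G s.
Hypothesis G1 : G 1 = 1.
Hypothesis GD_le : forall x s : R, 0 < x -> 0 <= s <= 1 -> G (x + s) <= x `^ s * G x.
Hypothesis Ghalf_le : forall x, 0 < x -> G (x + 2^-1) ^+ 2 <= x * G x ^+ 2.
Variable m : R.
Hypothesis m_gt0 : 0 < m.

Let T (n : nat) : R := G (n%:R - m) / G (n%:R + m + 1).

Let T_ge0 (n : nat) : m < n%:R -> 0 <= T n.
Proof.
have m0 := m_gt0; move=> mn; rewrite /T divr_ge0// ltW// G_gt0//; first by rewrite subr_gt0.
by rewrite !addr_gt0// (lt_trans m0).
Qed.

(** Over the common denominator Gamma(n+m+2) the functional equation leaves Gamma(n-m) times (n+m+1)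
    - (n-m) = 2m+1: the origin of the factor 2 mu + 1 in the final constant. *)
Let TS (n : nat) : m < n%:R -> G (n.+1%:R - m - 1) / G (n.+1%:R + m + 1) =
  (2 * m + 1)^-1 * (T n - T n.+1).
Proof.
have m0 := m_gt0; move=> mn; rewrite /T -natr1.
have n0 : 0 < n%:R :> R by apply: lt_trans mn.
rewrite (_ : n%:R + 1 - m - 1 = n%:R - m); last by ring.
rewrite (_ : n%:R + 1 - m = n%:R - m + 1); last by ring.
rewrite (_ : n%:R + 1 + m = n%:R + m + 1); last by ring.
have h1 : 0 < n%:R - m by rewrite subr_gt0.
have h2 : 0 < n%:R + m + 1 by rewrite !addr_gt0.
rewrite (GS h1) (GS h2); have g2 := G_gt0 h2; move: (G (n%:R - m)) (G (n%:R + m + 1)) g2 => x y y0.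
by field; rewrite !gt_eqF//; lra.
Qed.

Let weighted_Cauchy_Schwarz (d : nat) (c w q : nat -> R) : (forall i, 0 < w i) ->
  (\sum_(i < d) c i * q i) ^+ 2 <=
  (\sum_(i < d) c i ^+ 2 * w i) * \sum_(i < d) (w i)^-1 * q i ^+ 2.
Proof.
move=> w0; elim: d => [|d IH]; first by rewrite !big_ord0 expr0n mulr0.
rewrite !big_ord_recr/=.
have A0 : 0 <= \sum_(i < d) c i ^+ 2 * w i.
  by apply: sumr_ge0 => i _; rewrite mulr_ge0 ?sqr_ge0 ?ltW.
have B0 : 0 <= \sum_(i < d) (w i)^-1 * q i ^+ 2.
  by apply: sumr_ge0 => i _; rewrite mulr_ge0 ?sqr_ge0 ?invr_ge0 ?ltW.
move: (\sum_(i < d) c i * q i) (\sum_(i < d) c i ^+ 2 * w i)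
  (\sum_(i < d) (w i)^-1 * q i ^+ 2) (w0 d) IH A0 B0 => X A B wd XAB A0 B0.
move: (c d) (q d) (w d) wd => a b v v0.
pose P := A * (v^-1 * b ^+ 2); pose Q := a ^+ 2 * v * B.
have P0 : 0 <= P by rewrite mulr_ge0// mulr_ge0 ?sqr_ge0// invr_ge0 ltW.
have Q0 : 0 <= Q.
  by apply: mulr_ge0 => //; apply: mulr_ge0; [exact: sqr_ge0|exact: ltW].
have vv : v * v^-1 = 1 by rewrite mulfV// gt_eqF.
have PQ : P * Q = A * B * (a * b) ^+ 2.
  by rewrite /P /Q; transitivity (A * B * (a * b) ^+ 2 * (v * v^-1)); [ring|rewrite vv mulr1].
suff h : 2 * X * (a * b) <= P + Q.
  rewrite [leRHS](_ : _ = A * B + (P + Q) + (v * v^-1) * (a * b) ^+ 2); last by rewrite /P /Q; ring.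
  by rewrite vv mul1r; move: XAB; rewrite sqrrD; lra.
have [h|h] := leP (2 * X * (a * b)) 0; first by rewrite (le_trans h)// addr_ge0.
rewrite -ler_sqr ?nnegrE ?addr_ge0 ?(ltW h)//.
have h1 : X ^+ 2 * (a * b) ^+ 2 <= P * Q by rewrite PQ ler_wpM2r ?sqr_ge0.
have := sqr_ge0 (P - Q); rewrite sqrrB sqrrD.
have -> : (2 * X * (a * b)) ^+ 2 = 4 * (X ^+ 2 * (a * b) ^+ 2) by ring.
by rewrite !mulr2n; move: (P ^+ 2) (Q ^+ 2) (P * Q) h1 => x y z; lra.
Qed.

(** Weighting with the squared norms 2/(2n+1) of the P_n makes the first factor the norm of the
    block. The telescoped sum is bounded by dropping [T (N + d)], which is nonnegative, so its bound
    does not depend on d. *)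
Lemma frac_legendre_sum_le (N d : nat) (c : nat -> R) t : m < N%:R -> -1 <= t <= 1 ->
  `|\sum_(i < d) c (N.+1 + i)%N * frac_poly G (m + 1) (legendre (N.+1 + i)%N) t| <=
  Num.sqrt (\sum_(i < d) c (N.+1 + i)%N ^+ 2 * (2 / (2 * (N.+1 + i)%N%:R + 1))) *
  Num.sqrt (2 / ((2 * m + 1) * pi) * (G (N%:R - m) / G (N%:R + m + 1))).
Proof.
have m0 := m_gt0; move=> mN t1; pose k i := (N.+1 + i)%N.
have m21 : 0 < 2 * m + 1 by lra.
have p0 := @pi_gt0 R.
pose Q n := frac_poly G (m + 1) (legendre n) t.
have QT n : (N < n)%N -> (2 * n%:R + 1) / 2 * Q n ^+ 2 <=
    2 / pi * (G (n%:R - m - 1) / G (n%:R + m + 1)).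
  move=> Nn; apply: (frac_legendre_sqr_le G_gt0 GS G1 GD_le Ghalf_le m_gt0 _ t1).
  by rewrite (lt_le_trans (_ : m + 1 < N%:R + 1))// ?ltrD2r// natr1 ler_nat.
have main : \sum_(i < d) (2 * (k i)%:R + 1) / 2 * Q (k i) ^+ 2 <=
    2 / ((2 * m + 1) * pi) * T N.
  suff h : \sum_(i < d) (2 * (k i)%:R + 1) / 2 * Q (k i) ^+ 2 <=
      2 / ((2 * m + 1) * pi) * (T N - T (N + d)%N).
    apply: (le_trans h); apply: ler_wpM2l; first by rewrite divr_ge0// mulr_ge0// ltW.
    by rewrite gerBl T_ge0// (lt_le_trans mN)// ler_nat leq_addr.
  elim: d => [|d' IH]; first by rewrite big_ord0 addn0 subrr mulr0.
  rewrite big_ord_recr/=.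
  have mNd : m < (N + d')%N%:R by rewrite (lt_le_trans mN)// ler_nat leq_addr.
  have := QT (k d') (leq_addr _ _).
  have -> : k d' = (N + d').+1 by rewrite /k addSn.
  rewrite (TS mNd) addnS => h; apply: le_trans (lerD IH h) _.
  move: (@pi R) p0 (T N) (T (N + d')) (T (N + d').+1) => P p0' x y z.
  rewrite le_eqVlt; apply/orP; left; apply/eqP; field.
  by rewrite !gt_eqF.
have wE i : (2 / (2 * (k i)%:R + 1))^-1 = (2 * (k i)%:R + 1) / 2 :> R by rewrite invf_div.
have w0 i : 0 < 2 / (2 * (k i)%:R + 1) :> R by rewrite divr_gt0// ltr_wpDl// mulr_ge0.
have CS := weighted_Cauchy_Schwarz d (c \o k) (Q \o k) w0.
have {}CS : (\sum_(i < d) c (k i) * Q (k i)) ^+ 2 <=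
    (\sum_(i < d) c (k i) ^+ 2 * (2 / (2 * (k i)%:R + 1))) * (2 / ((2 * m + 1) * pi) * T N).
  apply: le_trans CS _; apply: ler_wpM2l.
    by apply: sumr_ge0 => i _; rewrite mulr_ge0 ?sqr_ge0 ?ltW.
  by apply: le_trans main; apply: ler_sum => i _; rewrite wE.
rewrite -sqrtrM; last by apply: sumr_ge0 => i _; rewrite mulr_ge0 ?sqr_ge0// ltW// (w0 i).
by rewrite -sqrtr_sqr ler_sqrt// (le_trans (sqr_ge0 _) CS).
Qed.

End frac_legendre_sum.

(** * The energy of a block of Legendre coefficients *)

Section energy_estimates.
Context {R : realType}.
Notation mu := (@lebesgue_measure R).
Variable G : R -> R.
Hypothesis G_gt0 : forall s, 0 < s -> 0 < G s.
Hypothesis GS : forall s, 0 < s -> G (s + 1) = s * G s.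
Hypothesis G1 : G 1 = 1.
Hypothesis GD_le : forall x s : R, 0 < x -> 0 <= s <= 1 -> G (x + s) <= x `^ s * G x.
Hypothesis Ghalf_le : forall x, 0 < x -> G (x + 2^-1) ^+ 2 <= x * G x ^+ 2.

Lemma frac_poly_sum s n (c : nat -> R) (p : nat -> {poly R}) t :
  frac_poly G s (\sum_(i < n) c i *: p i) t = \sum_(i < n) c i * frac_poly G s (p i) t.
Proof.
elim: n => [|n IH]; last by rewrite !big_ord_recr/= frac_polyD frac_polyZ IH.
by rewrite !big_ord0 -(scale0r 1) frac_polyZ mul0r.
Qed.

(** Cancels one factor [Num.sqrt S], the norm of the block; the case S = 0 is treated apart. *)
Let sqr_le (S C U : R) : 0 <= S -> S <= Num.sqrt S * C * U -> S <= (C * U) ^+ 2.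
Proof.
rewrite le_eqVlt => /predU1P[<- _|S0 h]; first exact: sqr_ge0.
have s0 : 0 < Num.sqrt S by rewrite sqrtr_gt0.
have {}h : Num.sqrt S <= C * U.
  by rewrite -(ler_pM2l s0) mulrA -expr2 sqr_sqrtr// ltW.
by rewrite -[leLHS]sqr_sqrtr ?(ltW S0)// ler_sqr ?nnegrE// (le_trans (ltW s0) h).
Qed.

Variables (u : R -> R) (k N : nat).
Hypothesis k_gt0 : (0 < k)%N.
Hypothesis uac : abs_continuous (-1) 1 u.
Variable g : R -> R.
Hypothesis gi : mu.-integrable setT (EFin \o g).
Hypothesis gE : forall n, (k <= n)%N ->
  \int[mu]_(x in `[-1, 1]) (u x * (legendre n).[x]) =
  \int[mu]_(x in `[-1, 1]) (g x * (legendre_prim k n).[x]).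
Hypothesis kN : (k <= N.+1)%N.

Let c i := legendre_coef u (N.+1 + i)%N.
Let L i : {poly R} := legendre (N.+1 + i)%N.
Let w i : R := 2 / (2 * (N.+1 + i)%N%:R + 1).
(** The squared L^2 norm of the block with indices N + 1 to N + d. *)
Let S d : R := \sum_(i < d) c i ^+ 2 * w i.
Let Psi d : {poly R} := \sum_(i < d) c i *: legendre_prim k (N.+1 + i)%N.

Let kNi i : (k <= N.+1 + i)%N. Proof. exact: leq_trans (leq_addr _ _). Qed.

Let S_ge0 d : 0 <= S d.
Proof.
apply: sumr_ge0 => i _; apply: mulr_ge0; first exact: sqr_ge0.
by rewrite divr_ge0// addr_ge0// mulr_ge0.
Qed.

Let gpi (p : {poly R}) a b : mu.-integrable `[a, b] (EFin \o (fun x => g x * p.[x])).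
Proof. by apply: integrable_hornerM; apply: integrableS gi. Qed.

Let S_int d : S d = \int[mu]_(x in `[-1, 1]) (g x * (Psi d).[x]).
Proof.
have I11 : measurable (`[-1, 1]%classic : set (measurableTypeR R)) by exact: measurable_itv.
have ii (i : 'I_d) := gpi (legendre_prim k (N.+1 + i)%N) (-1) 1.
have iZ (i : 'I_d) : mu.-integrable `[-1, 1]
    (EFin \o (fun x => c i * (g x * (legendre_prim k (N.+1 + i)%N).[x]))).
  exact: (integrableZl_EFin (c i) I11 (ii i)).
transitivity (\int[mu]_(x in `[-1, 1])
    (\sum_(i < d) c i * (g x * (legendre_prim k (N.+1 + i)%N).[x]))); last first.
  apply: eq_Rintegral => x _; rewrite /Psi horner_sum mulr_sumr; apply: eq_bigr => i _.
  by rewrite hornerZ mulrCA.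
rewrite (Rintegral_sum I11 iZ); apply: eq_bigr => i _.
rewrite (RintegralZl (c i) I11 (ii i)) -(gE (kNi i)) Rintegral_legendre_coef.
by rewrite expr2 mulrA.
Qed.

Let Psi_frac d t : t <= 1 -> (Psi d).[t] = frac_poly G k%:R (\sum_(i < d) c i *: L i) t.
Proof.
move=> t1; rewrite frac_poly_sum /Psi horner_sum; apply: eq_bigr => i _.
by rewrite hornerZ /L (frac_poly_legendre_prim GS G1 (kNi i) t1).
Qed.

Let C m : R := Num.sqrt (2 / ((2 * m + 1) * pi) * (G (N%:R - m) / G (N%:R + m + 1))).

(** The boundary term at -1 carries the (k+1)-fold antiderivative of the block, which vanishes there
    because k is below every index of the block. *)
Lemma legendre_proj_error_classical (v : R -> R) : (k < N)%N ->
  bounded_variation (-1) 1 v ->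
  {ae mu, forall x, -1 <= x <= 1 -> v x = g x} ->
  \int[mu]_(x in `[-1, 1]) (u x - (legendre_proj N u).[x]) ^+ 2 <=
  (C k%:R * fine (total_variation (-1) 1 v)) ^+ 2.
Proof.
move=> kN' bv vg; apply: legendre_proj_error_le => // d.
apply: (sqr_le (S_ge0 d)); rewrite {1}S_int.
have k0 : 0 < k%:R :> R by rewrite ltr0n.
have kN1 : k%:R < N%:R :> R by rewrite ltr_nat.
have HM t : -1 <= t <= 1 ->
    `|frac_poly G (k%:R + 1) (\sum_(i < d) c i *: L i) t| <= Num.sqrt (S d) * C k%:R.
  move=> t1; rewrite frac_poly_sum.
  exact: (frac_legendre_sum_le G_gt0 GS G1 GD_le Ghalf_le k0 _ _ kN1 t1).
have a1 : -1 < 1 :> R by lra.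
have := bounded_variation_frac_poly_le G_gt0 GS G1 GD_le (ltW k0) a1 bv HM.
have -> : frac_poly G (k%:R + 1) (\sum_(i < d) c i *: L i) (-1) = 0.
  rewrite frac_poly_sum big1// => i _; rewrite natr1 /L.
  have kn : (k < N.+1 + i)%N by rewrite (leq_trans kN')// (leq_trans (leqnSn N))// leq_addr.
  rewrite (frac_poly_legendre_prim GS G1 kn (ltW a1)) (legendre_primN1 kn).
  exact: mulr0.
rewrite normr0 mul0r add0r; apply: le_trans; rewrite [leRHS](_ : _ =
  `|\int[mu]_(x in `[-1, 1]) (g x * (Psi d).[x])|); first exact: ler_norm.
congr `|_|; apply: ae_eq_Rintegral_any; move: vg; apply: filterS.
  exact: (ae_filter_ringOfSetsType mu).
by move=> x vx /=; rewrite in_itv/= => x1; rewrite vx// Psi_frac//; case/andP: x1.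
Qed.

Lemma legendre_proj_error_fractional (m theta : R) (vl vr : R -> R) :
  0 < m -> m < k%:R -> m < N%:R -> -1 < theta < 1 ->
  bounded_variation theta 1 vr -> bounded_variation (-1) theta vl ->
  {ae mu, forall x, theta <= x <= 1 -> vr x = (G (k%:R - m))^-1 *
    \int[mu]_(y in `[theta, x]) (g y * (x - y) `^ (k%:R - m - 1))} ->
  {ae mu, forall x, -1 <= x <= theta -> vl x = (- 1) ^+ k * ((G (k%:R - m))^-1 *
    \int[mu]_(y in `[x, theta]) (g y * (y - x) `^ (k%:R - m - 1)))} ->
  \int[mu]_(x in `[-1, 1]) (u x - (legendre_proj N u).[x]) ^+ 2 <=
  (C m * (fine (total_variation (-1) theta vl) + fine (total_variation theta 1 vr) +
          `|lim (vl @ theta^'-)| + `|lim (vr @ theta^'+)|)) ^+ 2.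
Proof.
move=> m0 mk mN /andP[t1 t2] bvr bvl vrE vlE; apply: legendre_proj_error_le => // d.
apply: (sqr_le (S_ge0 d)); rewrite {1}S_int.
rewrite (Rintegral_itv_split (ltW t1) (ltW t2) (gpi _ _ _)).
set M := Num.sqrt (S d) * C m.
have rho0 : 0 < k%:R - m by rewrite subr_gt0.
have mk' : m + (k%:R - m) = k%:R by ring.
have giab a b : mu.-integrable `[a, b] (EFin \o g) by apply: integrableS gi.
have right : \int[mu]_(x in `[theta, 1]) (g x * (Psi d).[x]) <=
    M * (`|lim (vr @ theta^'+)| + fine (total_variation theta 1 vr)).
  have HM t : theta <= t <= 1 ->
      `|frac_poly G (m + 1) (\sum_(i < d) c i *: L i) t| <= M.
    move=> /andP[tt tt1]; rewrite frac_poly_sum.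
    apply: (frac_legendre_sum_le G_gt0 GS G1 GD_le Ghalf_le m0 _ _ mN).
    by rewrite (le_trans (ltW t1) tt).
  have := right_half_le G_gt0 GS G1 GD_le (ltW m0) rho0 t2 (giab _ _) bvr vrE HM.
  rewrite mk'; apply: le_trans; apply: le_trans (ler_norm _) _.
  rewrite le_eqVlt; apply/orP; left; apply/eqP; congr `|_|.
  by apply: eq_Rintegral => x; rewrite inE/= in_itv/= => /andP[_ x1]; rewrite Psi_frac.
(* Under x -> -x the coefficient of P_n is multiplied by (-1)^n, which leaves [S d] unchanged. The
   k-fold antiderivatives bring (-1)^(n+k); the part (-1)^k goes into [g'] and matches the sign in
   the right Caputo derivative. *)
pose g' y := (- 1) ^+ k * g (- y); pose v' x := vl (- x).
pose c' i := (- 1) ^+ (N.+1 + i) * c i.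
have left : \int[mu]_(x in `[-1, theta]) (g x * (Psi d).[x]) <=
    M * (`|lim (vl @ theta^'-)| + fine (total_variation (-1) theta vl)).
  have Nt2 : - theta < 1 by rewrite ltrNl.
  have tvE : total_variation (- theta) 1 v' = total_variation (-1) theta vl.
    by rewrite [RHS]total_variation_opp opprK.
  have bv' : bounded_variation (- theta) 1 v'.
    apply/bounded_variationP; first exact: ltW.
    by rewrite tvE; apply/bounded_variationP => //; exact: ltW.
  have limE : lim (vl @ theta^'-) = lim (v' x @[x --> (- theta)^'+]).
    apply/cvg_lim; first exact: Rhausdorff.
    by apply/cvg_at_leftNP; exact: (bounded_variation_cvg_at_right Nt2 bv').
  have g'i : mu.-integrable `[- theta, 1] (EFin \o g').
    have := integrable_reflect (giab (-1) theta); rewrite opprK => gi'.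
    have It : measurable (`[- theta, 1]%classic : set (measurableTypeR R)) by exact: measurable_itv.
    exact: (integrableZl_EFin ((- 1) ^+ k) It gi').
  have v'E : {ae mu, forall x, - theta <= x <= 1 -> v' x = (G (k%:R - m))^-1 *
      \int[mu]_(y in `[- theta, x]) (g' y * (x - y) `^ (k%:R - m - 1))}.
    have := ae_reflect vlE; apply: filterS; first exact: (ae_filter_ringOfSetsType mu).
    move=> x h x1; rewrite /v' h; last by rewrite lerN2 lerNl andbC.
    rewrite mulrCA; congr (_ * _).
    rewrite Rintegral_reflect ?opprK; last first.
      apply: measurable_funM; first by apply/measurable_EFinP; exact: measurable_int (giab _ _).
      apply: (measurableT_comp (f := fun z => z `^ (k%:R - m - 1))); first exact: measurable_powR.
      exact: measurable_funD.
    rewrite -Rintegral_signM; apply: eq_Rintegral => y _.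
    by rewrite /g' mulrA; congr (_ * _ `^ _); ring.
  have HM t : - theta <= t <= 1 ->
      `|frac_poly G (m + 1) (\sum_(i < d) c' i *: L i) t| <= M.
    move=> /andP[tt tt1]; rewrite frac_poly_sum.
    pose cc n := (- 1) ^+ n * legendre_coef u n.
    have tI : -1 <= t <= 1 by rewrite tt1 andbT (le_trans _ tt)// lerN2 ltW.
    have := frac_legendre_sum_le G_gt0 GS G1 GD_le Ghalf_le m0 d cc mN tI.
    rewrite [X in Num.sqrt X * _](_ : _ = S d) => [h|]; first exact: h.
    by apply: eq_bigr => i _; rewrite /cc exprMn sqrr_sign mul1r.
  have := right_half_le G_gt0 GS G1 GD_le (ltW m0) rho0 Nt2 g'i bv' v'E HM.
  rewrite mk' tvE limE; apply: le_trans; apply: le_trans (ler_norm _) _.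
  rewrite le_eqVlt; apply/orP; left; apply/eqP; congr `|_|.
  rewrite Rintegral_reflect ?opprK; last first.
    by apply/measurable_EFinP; exact: measurable_int (gpi _ _ _).
  apply: eq_Rintegral => x; rewrite inE/= in_itv/= => /andP[x1 x2].
  rewrite /g' -[RHS]mulrA [RHS]mulrCA; congr (_ * _).
  rewrite frac_poly_sum /Psi horner_sum mulr_sumr; apply: eq_bigr => i _.
  rewrite hornerZ (legendre_primN _ (kNi i)) /L (frac_poly_legendre_prim GS G1 (kNi i) x2).
  by rewrite exprD /c'; ring.
by move: left right; rewrite !mulrDr; lra.
Qed.

End energy_estimates.

(** * The L^2 norm and the final estimate *)

Lemma L2norm_le {R : realType} (f : R -> R) (B : R) :
  {within `[-1, 1], continuous f} -> 0 <= B ->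
  \int[lebesgue_measure]_(x in `[-1, 1]) f x ^+ 2 <= B ^+ 2 -> (L2norm f <= B%:E)%E.
Proof.
move=> fc B0 fB; pose D := \int[lebesgue_measure]_(x in `[-1, 1]) f x ^+ 2.
have f2c : {within `[-1, 1], continuous (fun x => f x ^+ 2)}.
  by move=> x; apply: cvgM; exact: fc.
have f2i := within_continuous_integrable f2c.
have D0 : 0 <= D by apply: Rintegral_ge0 => x _; exact: sqr_ge0.
rewrite /L2norm unlock /=.
have -> : (\int[lebesgue_measure]_x (`|((f \_ `]-1, 1[) x)%:E| `^ 2) = D%:E)%E.
  have f2o : measurable_fun (`]-1, 1[%classic : set R) (fun x => (f x ^+ 2)%:E).
    apply/emeasurable_fun_itv_bndo_bndcP/emeasurable_fun_itv_obnd_cbndP.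
    exact: measurable_int f2i.
  transitivity (\int[lebesgue_measure]_(x in `](-1)%R, 1%R[) (f x ^+ 2)%:E)%E.
    rewrite [RHS]integral_mkcond; apply: eq_integral => x _.
    rewrite !patchE; case: ifP => _ /=; rewrite powR_mulrn//.
      by rewrite real_normK ?num_real.
    by rewrite normr0 expr0n.
  rewrite integral_itv_bndo_bndc// integral_itv_obnd_cbnd; last first.
    exact/emeasurable_fun_itv_bndo_bndcP.
  by rewrite /D /Rintegral fineK// integrable_fin_num.
rewrite poweR_EFin lee_fin powR12_sqrt//.
by rewrite -[leRHS]ger0_norm// -sqrtr_sqr ler_sqrt// sqr_ge0.
Qed.

Theorem theorem4 (R : realType) (k : nat) (u : R -> R)
    (hk : (1 <= k)%N) (hu : ac_derivs (-1) 1 k u) :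
  (forall (mu theta : R) (vl vr : R -> R),
      k%:R - 1 < mu < k%:R ->
      -1 < theta < 1 ->
      bv_representative theta 1 (caputo_left theta k mu u) vr ->
      bv_representative (-1) theta (caputo_right theta k mu u) vl ->
      forall N : nat, - (1 / 2) < mu < N%:R ->
      (L2norm (fun x => u x - (legendre_proj N u).[x])%R <=
       (legendre_const mu N)%:E * U_theta theta vl vr)%E)
  /\
  (forall w : R -> R,
      bv_representative (-1) 1 (derive1n k u) w ->
      forall N : nat, (k < N)%N ->
      (L2norm (fun x => u x - (legendre_proj N u).[x])%R <=
       (legendre_const k%:R N)%:E * total_variation (-1) 1 w)%E).
Proof.
have uac := hu.1; have [g [gi gu gE]] := ac_derivs_density hk hu.
have errc N : {within `[-1, 1], continuous (fun x => u x - (legendre_proj N u).[x])}.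
  have uc := abs_continuous_within uac.
  have pc : {within `[-1, 1], continuous (fun x => (legendre_proj N u).[x])}.
    by apply: continuous_subspaceT => x; exact: continuous_horner.
  by move=> x; apply: cvgB; [exact: uc|exact: pc].
split=> [m theta vl vr /andP[km mk] /andP[t1 t2] [bvr vrE] [bvl vlE] N /andP[_ mN]|
    w [bw wE] N kN].
- have k1 : 1 <= k%:R :> R by rewrite ler1n.
  have m0 : 0 < m by move: km k1; lra.
  have kN : (k <= N.+1)%N.
    by rewrite ltnW// -(ltr_nat R) -natr1; move: km mN; lra.
  have rho0 : k%:R - m == 0 = false by apply/negbTE; rewrite gt_eqF// subr_gt0.
  have fr : total_variation theta 1 vr \is a fin_num.
    by apply/bounded_variationP => //; exact: ltW.
  have fl : total_variation (-1) theta vl \is a fin_num.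
    by apply/bounded_variationP => //; exact: ltW.
  have -> : U_theta theta vl vr = (fine (total_variation (-1) theta vl) +
      fine (total_variation theta 1 vr) + `|lim (vl @ theta^'-)| +
      `|lim (vr @ theta^'+)|)%:E by rewrite /U_theta !EFinD !fineK.
  (* The Caputo derivatives are rewritten with the integrable density [g], which equals
     [derive1n k u] almost everywhere and thus has the same fractional integrals. *)
  have vrE' : {ae lebesgue_measure, forall x, theta <= x <= 1 ->
      vr x = (Gamma (k%:R - m))^-1 *
      \int[lebesgue_measure]_(y in `[theta, x]) (g y * (x - y) `^ (k%:R - m - 1))}.
    move: vrE; apply: ae_imp => x h x1; rewrite h// /caputo_left /frac_int_left rho0.
    congr (_ * _); apply: ae_eq_Rintegral_any; move: gu; apply: ae_imp => y gy /=.
    rewrite in_itv/= => /andP[y1 y2]; move/andP: x1 => [_ x1].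
    rewrite gy; last by rewrite (le_trans (ltW t1) y1) (le_trans y2 x1).
    by rewrite -powRN opprB.
  have vlE' : {ae lebesgue_measure, forall x, -1 <= x <= theta ->
      vl x = (- 1) ^+ k * ((Gamma (k%:R - m))^-1 *
      \int[lebesgue_measure]_(y in `[x, theta]) (g y * (y - x) `^ (k%:R - m - 1)))}.
    move: vlE; apply: ae_imp => x h x1; rewrite h// /caputo_right /frac_int_right rho0.
    congr (_ * (_ * _)); apply: ae_eq_Rintegral_any; move: gu; apply: ae_imp => y gy /=.
    rewrite in_itv/= => /andP[y1 y2]; move/andP: x1 => [x1 _].
    rewrite gy; last by rewrite (le_trans x1 y1) (le_trans y2 (ltW t2)).
    by rewrite -powRN opprB.
  have t12 : -1 < theta < 1 by rewrite t1.
  rewrite -EFinM; apply: L2norm_le (errc N) _ _.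
    by rewrite mulr_ge0 ?sqrtr_ge0// !addr_ge0// fine_ge0// total_variation_ge0// ltW.
  exact: (legendre_proj_error_fractional (@Gamma_gt0 R) (@GammaS R) (@Gamma1 R) (@GammaD_le R)
    (@GammaDhalf_le R) uac gi gE kN m0 mk mN t12 bvr bvl vrE' vlE').
- have fw : total_variation (-1) 1 w \is a fin_num.
    by apply/bounded_variationP => //; lra.
  have wg : {ae lebesgue_measure, forall x, -1 <= x <= 1 -> w x = g x}.
    have := ae_and wE gu; apply: ae_imp => x [wx gx] x1.
    by rewrite wx// gx.
  rewrite -(fineK fw) -EFinM; apply: L2norm_le (errc N) _ _.
    by rewrite mulr_ge0 ?sqrtr_ge0// fine_ge0// total_variation_ge0//; lra.
  have kN' : (k <= N.+1)%N by rewrite ltnW// ltnW.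
  exact: (legendre_proj_error_classical (@Gamma_gt0 R) (@GammaS R) (@Gamma1 R) (@GammaD_le R)
    (@GammaDhalf_le R) hk uac gi gE kN' kN bw wg).
Qed.
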